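(* Let $H$ be a strictly $2$-balanced graph with $k$ edges. Fix $\eta\in[0,1)$ and $c>0$ with $c<\overline c_k(\eta)$. If $p\sim c\,\Delta_H^{-\frac1{k-1}}$, then $$\lim_{n\to\infty}\Delta_H^{\frac1{k-1}}\binom n2^{-1}\log\mathbb{P}_p(\mathbf X_H\le\eta\,\mathbb{E}_p\mathbf X_H)=x^\ast+(x^\ast)^k\left(1-\frac1k\right)\zeta-\log(1-\zeta)\frac{\eta c^k}{k}-c,$$ where $\zeta$ is the unique solution in $[0,1]$ of $(1-\zeta)\,(x_k^\ast(c,\zeta))^k=\eta c^k$ and $x^\ast=x_k^\ast(c,\zeta)$ (when $\eta=0$ one has $\zeta=1$ and the term $\log(1-\zeta)\eta c^k/k$ is interpreted as $0$). Similarly, fix $\eta\in[0,1)$ and $b>0$ with $(k-1)b^{k-1}(1-\eta)<1$. If $m\sim b\,\Delta_H^{-\frac1{k-1}}\binom n2$, then $$\lim_{n\to\infty}\Delta_H^{\frac1{k-1}}\binom n2^{-1}\log\mathbb{P}_m(\mathbf X_H\le\eta\,\mathbb{E}_m\mathbf X_H)=-\frac{b^k(1-\eta+\eta\log\eta)}{k}$$ (with $0\log0=0$).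
   Context: For a graph $H$, $m_2(H)=\max_{F\subseteq H,|V(F)|\ge3}\frac{|E(F)|-1}{|V(F)|-2}$; $H$ (with $|E(H)|\ge3$) is strictly $2$-balanced if this maximum is attained uniquely at $F=H$. $\mathbf X_H$ is the number of copies of $H$; $\mathbb{P}_p,\mathbb{E}_p$ refer to $G(n,p)$ and $\mathbb{P}_m,\mathbb{E}_m$ to $G(n,m)$. With $h=|V(H)|$, $\Delta_H=\frac{2k\,(n-2)_{h-2}}{|\mathrm{Aut}(H)|}$ where $(n)_j=n(n-1)\cdots(n-j+1)$. $W$ is the Lambert $W$ function. For $\zeta\in(0,1]$, $x_k^\ast(c,\zeta)=\left(\frac{W((k-1)c^{k-1}\zeta)}{(k-1)\zeta}\right)^{\frac1{k-1}}$, and $x_k^\ast(c,0)=c$ (the limit). $\eta_k^\ast=e^{-k/(k-1)}$ and $\overline c_k(\eta)=\left(\frac{e}{(k-1)(1-\eta/\eta_k^\ast)}\right)^{\frac1{k-1}}$ if $\eta<\eta_k^\ast$, $\overline c_k(\eta)=+\infty$ if $\eta\ge\eta_k^\ast$. *)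

(* Defs.v *)
From HB Require Import structures.
From mathcomp Require Import all_boot all_order all_algebra.
From mathcomp Require Import all_classical all_reals all_analysis.
Unset Printing Implicit Defensive.
Import Order.TTheory GRing.Theory Num.Theory.
Local Open Scope ring_scope.

Definition is_graph (n : nat) (E : {set {set 'I_n}}) : bool :=
  [forall e in E, #|e| == 2%N].

Definition Kn (n : nat) : {set {set 'I_n}} := [set e : {set 'I_n} | #|e| == 2%N].

Definition is_subgraph (h : nat) (EH : {set {set 'I_h}})
  (VF : {set 'I_h}) (EF : {set {set 'I_h}}) : bool :=
  (EF \subset EH) && [forall e in EF, e \subset VF].

Definition dens2 (R : realType) (nv ne : nat) : R :=
  (ne%:R - 1) / (nv%:R - 2).

Definition m2 (R : realType) (h : nat) (EH : {set {set 'I_h}}) : R :=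
  \big[Num.max/0]_(VF : {set 'I_h} | (3 <= #|VF|)%N)
   \big[Num.max/0]_(EF : {set {set 'I_h}} | is_subgraph h EH VF EF)
      dens2 R #|VF| #|EF|.

Definition strictly_2_balanced (R : realType) (h : nat) (EH : {set {set 'I_h}}) : Prop :=
  (3 <= #|EH|)%N /\ (3 <= h)%N /\
  m2 R h EH = dens2 R h #|EH| /\
  forall (VF : {set 'I_h}) (EF : {set {set 'I_h}}),
    is_subgraph h EH VF EF -> (3 <= #|VF|)%N -> (VF, EF) != ([set: 'I_h], EH) ->
    dens2 R #|VF| #|EF| < m2 R h EH.

Definition autH (h : nat) (EH : {set {set 'I_h}}) : nat :=
  #|[set f : {ffun 'I_h -> 'I_h} | injectiveb f &&
       [forall e : {set 'I_h}, (e \in EH) == (f @: e \in EH)]]|.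

Definition embH (h n : nat) (EH : {set {set 'I_h}}) (EG : {set {set 'I_n}}) : nat :=
  #|[set f : {ffun 'I_h -> 'I_n} | injectiveb f &&
       [forall e in EH, f @: e \in EG]]|.

(* X_H(G): number of copies of H in G *)
Definition XH (R : realType) (h n : nat) (EH : {set {set 'I_h}})
  (EG : {set {set 'I_n}}) : R :=
  (embH h n EH EG)%:R / (autH h EH)%:R.

Definition DeltaH (R : realType) (h : nat) (EH : {set {set 'I_h}}) (n : nat) : R :=
  (2 * #|EH| * (n - 2) ^_ (h - 2))%:R / (autH h EH)%:R.

Definition wp (R : realType) (n : nat) (p : R) (G : {set {set 'I_n}}) : R :=
  p ^+ #|G| * (1 - p) ^+ (#|Kn n| - #|G|).

Definition Prob_p (R : realType) (n : nat) (p : R) (A : pred {set {set 'I_n}}) : R :=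
  \sum_(G : {set {set 'I_n}} | (G \subset Kn n) && A G) wp R n p G.

Definition Exp_p (R : realType) (n : nat) (p : R) (X : {set {set 'I_n}} -> R) : R :=
  \sum_(G : {set {set 'I_n}} | G \subset Kn n) wp R n p G * X G.

Definition Prob_m (R : realType) (n m : nat) (A : pred {set {set 'I_n}}) : R :=
  #|[set G : {set {set 'I_n}} | [&& G \subset Kn n, #|G| == m & A G]]|%:R
  / ('C(#|Kn n|, m))%:R.

Definition Exp_m (R : realType) (n m : nat) (X : {set {set 'I_n}} -> R) : R :=
  (\sum_(G : {set {set 'I_n}} | (G \subset Kn n) && (#|G| == m)) X G)
  / ('C(#|Kn n|, m))%:R.

(* principal branch of the Lambert W function on [0, +oo):
   the unique y >= 0 with y e^y = x *)
Definition lambertW (R : realType) (x : R) : R :=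
  xget 0 [set y : R | 0 <= y /\ y * expR y = x].

Definition xstar (R : realType) (k : nat) (c zeta : R) : R :=
  if zeta == 0 then c
  else powR (lambertW R ((k%:R - 1) * c ^+ (k.-1) * zeta) / ((k%:R - 1) * zeta))
            (k%:R - 1)^-1.

Definition eta_star (R : realType) (k : nat) : R := expR (- (k%:R / (k%:R - 1))).

Definition cbar (R : realType) (k : nat) (eta : R) : \bar R :=
  if eta < eta_star R k then
    (powR (expR 1 / ((k%:R - 1) * (1 - eta / eta_star R k))) (k%:R - 1)^-1)%:E
  else +oo%E.

(* Main.v *)
(** The copies of [H] in [K_n] form a [(k + 1)]-uniform hypergraph on the edges of [K_n] (so
    [k] below is the paper's [k - 1]), and [X_H] counts the hyperedges contained in a random set.
    Its lower tail is read off from the partition function [Z(l, z)], the sum of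
    [l ^ |A| z ^ X(A)] over all edge sets [A], at [z = 1 - zeta]: Chernoff's bound gives the upper
    estimate, and the tilted measure, which concentrates, gives the matching lower one.

    To evaluate [ln Z], differentiate in [l]: the logarithmic derivative is a sum of ratios
    [Z(v pinned) / Z].  Adding the hyperedges through [v] one at a time writes such a ratio as a
    product of factors [1 - (1 - z) p ^ k * (product of k ratios)], so upper bounds on all ratios
    yield lower bounds and conversely; strict 2-balancedness makes the hyperedges through [v]
    essentially disjoint elsewhere.  At the scale [q = Delta ^ (-1/k)] this is the iteration of
    [y -> g exp (- k y)], and two steps of it are a contraction near its fixed point exactly when
    [k zeta x ^ k < 1], which is the condition [c < cbar(eta)].

    In [G(n,m)] the lower tail probability is decreasing in [m] (LYM), so it is compared with the
    tilted binomial measures restricted to windows of edge counts just below or just above [m]. *)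

Require Import Defs.
From HB Require Import structures.
From mathcomp Require Import all_boot all_order all_algebra.
From mathcomp Require Import all_classical all_reals all_analysis.
From mathcomp Require Import perm ring lra.
Import Order.TTheory GRing.Theory Num.Theory.
Import numFieldNormedType.Exports.
Import boot.fintype boot.finset.
Set Implicit Arguments.
Unset Strict Implicit.
Local Open Scope ring_scope.

(** * Partition functions of hypergraphs *)

Section WeightedSums.
Variables (R : realType) (T : finType) (K : {set T}).
Implicit Types (A P Q S : {set T}) (C : {set {set T}}) (l : R) (g : {set T} -> R).

(** Telescoping over the hyperedges at [v] passes through hypergraphs that have lost hyperedges and
    carry more pinned vertices, so a ratio bound is usable only if it holds uniformly over all such
    configurations. The bounds are therefore stated for every admissible triple whose exceptional
    set [D] has at most [r] vertices, and one step at [r] consumes the opposite bound at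
    [r + 1 + k]. Finitely many steps from the trivial upper bound 1 reach any given accuracy, so [r]
    stays bounded and one sparsity threshold suffices. Only upper bounds are iterated; the lower
    bound comes from a single further step. The free energy is integrated along [x], with
    [l = fug z x * q], and not along [l]: the limiting ratios are explicit in [x], and the
    contraction condition at [x] persists at all smaller values. No second moment is computed. Size
    and count concentrate because free energies at nearby parameters can be compared. At [z = 0] the
    parameter [z] cannot be moved both ways, but there the tilted measure charges only sets without
    hyperedges, so the count needs no control. *)

Definition ncov C A : nat := #|[set e in C | e \subset A]|.

Definition wsum (l : R) g : R := \sum_(A : {set T} | A \subset K) l ^+ #|A| * g A.

(** Pinned vertices are still summed over in [A], so pinning carries no factor of [l]. Under the
    weights of [Zf l z P C], a vertex [v] of [K] is in the random set with probability [l / (1 + l)]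
    times [Zf l z (v |: P) C / Zf l z P C]. *)
Definition Zf (l z : R) P C : R := wsum l (fun A => z ^+ ncov C (A :|: P)).

Lemma ncov_le C C' A A' : C \subset C' -> A \subset A' -> (ncov C A <= ncov C' A')%N.
Proof.
move=> sC sA; apply: subset_leq_card; apply/subsetP=> e; rewrite !inE.
by case/andP=> eC eA; rewrite (subsetP sC _ eC) (subset_trans eA sA).
Qed.

Lemma ncovU1 C A e : e \notin C -> ncov (e |: C) A = ((e \subset A) + ncov C A)%N.
Proof.
move=> eC; rewrite /ncov; case: (boolP (e \subset A)) => eA; last first.
  rewrite add0n; congr #|pred_of_set _|; apply/setP=> f; rewrite !inE.
  by case: eqP => [->|_] //=; rewrite (negPf eA) andbF.
have -> : [set f in e |: C | f \subset A] = e |: [set f in C | f \subset A].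
  by apply/setP=> f; rewrite !inE; case: eqP => [->|_] //=; rewrite eA.
by rewrite cardsU1 inE (negPf eC).
Qed.

Lemma eq_wsum l g1 g2 : (forall A, A \subset K -> g1 A = g2 A) -> wsum l g1 = wsum l g2.
Proof. by move=> eg; apply: eq_bigr => A AK; rewrite eg. Qed.

Lemma ler_wsum l g1 g2 : 0 <= l -> (forall A, A \subset K -> g1 A <= g2 A) ->
  wsum l g1 <= wsum l g2.
Proof.
by move=> l0 eg; apply: ler_sum => A AK; rewrite ler_wpM2l ?exprn_ge0 ?eg.
Qed.

Lemma wsumB l g1 g2 : wsum l g1 - wsum l g2 = wsum l (fun A => g1 A - g2 A).
Proof. by rewrite /wsum -sumrB; apply: eq_bigr => A _; rewrite mulrBr. Qed.

Lemma wsumZ l (a : R) g : wsum l (fun A => a * g A) = a * wsum l g.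
Proof. by rewrite /wsum mulr_sumr; apply: eq_bigr => A _; rewrite mulrCA. Qed.

Lemma sum_in_out (f : {set T} -> R) v : v \in K ->
  \sum_(A : {set T} | (A \subset K) && (v \in A)) f A =
  \sum_(A : {set T} | (A \subset K) && (v \notin A)) f (v |: A).
Proof.
move=> vK; rewrite (reindex_onto (fun A => v |: A) (fun A => A :\ v)) /=; last first.
  by move=> A /andP[_ vA]; rewrite setD1K.
apply: eq_bigl => A; rewrite subUset sub1set vK setU11 andbT /=.
case: (A \subset K) => //=; apply/eqP/idP => [<-|vA]; first by rewrite setD11.
by rewrite setU1K.
Qed.

Lemma wsum_out l g v : v \in K ->
  wsum l g = \sum_(A : {set T} | (A \subset K) && (v \notin A)) l ^+ #|A| * (g A + l * g (v |: A)).
Proof.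
move=> vK; rewrite /wsum (bigID (fun A : {set T} => v \in A)) /= addrC.
under [RHS]eq_bigr do rewrite mulrDr.
rewrite big_split /= sum_in_out //; congr (_ + _).
by apply: eq_bigr => A /andP[_ vA]; rewrite cardsU1 vA add1n exprS; ring.
Qed.

Lemma wsum_in1 l g v : 0 <= l -> v \in K ->
  wsum l (fun A => g A *+ (v \in A)) = l / (1 + l) * wsum l (fun A => g (v |: A)).
Proof.
move=> l0 vK; rewrite !(@wsum_out _ _ v) // mulr_sumr; apply: eq_bigr => A /andP[_ vA].
rewrite (negPf vA) setU11 mulr0n mulr1n add0r setUA setUid.
by field; rewrite gt_eqF // ltr_pwDl.
Qed.

Lemma wsum_in l g S : 0 <= l -> S \subset K ->
  wsum l (fun A => g A *+ (S \subset A)) =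
  (l / (1 + l)) ^+ #|S| * wsum l (fun A => g (S :|: A)).
Proof.
move=> l0; have [n le_n] := ubnP #|S|; elim: n S le_n g => // n IH S le_n g SK.
case: (set_0Vmem S) => [->|[v vS]].
  rewrite cards0 expr0 mul1r; apply: eq_wsum => A _.
  by rewrite sub0set set0U mulr1n.
have -> : wsum l (fun A => g A *+ (S \subset A)) =
    wsum l (fun A => (g A *+ (v \in A)) *+ (S :\ v \subset A)).
  apply: eq_wsum => A _; rewrite -mulrnA; congr (_ *+ _).
  by rewrite -{1}(setD1K vS) subUset sub1set; case: (v \in A); case: (_ \subset A).
have cS : #|S| = #|S :\ v|.+1 by rewrite (cardsD1 v) vS.
have SvK : S :\ v \subset K by apply: subset_trans SK; apply: subD1set.
rewrite (IH _ _ (fun A => g A *+ (v \in A))) //; last by rewrite -ltnS -cS.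
have -> : wsum l (fun A => g (S :\ v :|: A) *+ (v \in S :\ v :|: A)) =
    wsum l (fun A => g (S :\ v :|: A) *+ (v \in A)).
  by apply: eq_wsum => A _; rewrite in_setU setD11.
rewrite (@wsum_in1 _ (fun A => g (S :\ v :|: A))) //; last exact: (subsetP SK).
rewrite cS exprSr -[RHS]mulrA; congr (_ * (_ * _)); apply: eq_wsum => A _.
by congr g; rewrite setUA [S :\ v :|: _]setUC setD1K.
Qed.

(** The parenthesized sum is the derivative of [wsum] in [l], and on the right [v] is pinned: this
    turns the logarithmic derivative of [Zf] into a sum of pinning ratios. *)
Lemma sum_card_wsum l g : 0 <= l ->
  (1 + l) * (\sum_(A : {set T} | A \subset K) #|A|%:R * l ^+ #|A|.-1 * g A) =
  \sum_(v in K) wsum l (fun A => g (v |: A)).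
Proof.
move=> l0; rewrite mulr_sumr.
transitivity (\sum_(A : {set T} | A \subset K) \sum_(v in K)
    ((1 + l) * (l ^+ #|A|.-1 * g A)) *+ (v \in A)).
  apply: eq_bigr => A AK; rewrite (bigID (mem A)) /= [X in _ = _ + X]big1 ?addr0; last first.
    by move=> v /andP[_ /negPf ->].
  rewrite (eq_bigr (fun=> (1 + l) * (l ^+ #|A|.-1 * g A))); last by move=> v /andP[_ ->].
  rewrite sumr_const -[RHS]mulr_natl (_ : #|_| = #|A|); first by rewrite [RHS]mulrCA -!mulrA.
  apply: eq_card => v; apply/andP/idP => [[]//|vA]; split=> //.
  exact: (subsetP AK).
rewrite exchange_big /=; apply: eq_bigr => v vK.
under eq_bigr do rewrite mulrb.
rewrite -big_mkcondr /= sum_in_out // (@wsum_out _ _ v) //; apply: eq_bigr => A /andP[_ vA].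
by rewrite cardsU1 vA add1n /= setUA setUid; ring.
Qed.

Section Zf.
Variables (l z : R).
Hypotheses (l0 : 0 <= l) (z0 : 0 <= z) (z1 : z <= 1).

Lemma Zf_ge0 P C : 0 <= Zf l z P C.
Proof. by apply: sumr_ge0 => A _; rewrite mulr_ge0 ?exprn_ge0. Qed.

Lemma Zf_gt0 P C : (forall e, e \in C -> ~~ (e \subset P)) -> 0 < Zf l z P C.
Proof.
move=> CP; rewrite /Zf /wsum (bigD1 set0) ?sub0set //=.
rewrite cards0 expr0 mul1r set0U ltr_pwDl //; last first.
  by apply: sumr_ge0 => A _; rewrite mulr_ge0 ?exprn_ge0.
rewrite /ncov (_ : finset _ = set0) ?cards0 ?expr0 //.
by apply/setP=> e; rewrite !inE; apply/andP=> -[/CP/negP].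
Qed.

Lemma Zf_le P P' C C' : P \subset P' -> C \subset C' -> Zf l z P' C' <= Zf l z P C.
Proof.
move=> sP sC; apply: ler_wsum => // A _; apply: ler_wiXn2l => //.
by apply: ncov_le; rewrite ?setUS.
Qed.

Lemma Zf_free v P C : v \in K ->
  (forall e, e \in C -> v \notin e) -> Zf l z (v |: P) C = Zf l z P C.
Proof.
move=> vK Cv; apply: eq_wsum => A _; congr (_ ^+ _); congr #|pred_of_set _|.
apply/setP=> e; rewrite !inE; case: (boolP (e \in C)) => //= eC.
apply/subsetP/subsetP => eA x xe; have := eA _ xe; rewrite !inE.
  by case: (altP (x =P v)) => [xv|//]; move: (Cv _ eC); rewrite -xv xe.
by case/orP=> ->; rewrite ?orbT.
Qed.

(** A set avoiding [v] has the same weight before and after the hyperedges at [v] are deleted. After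
    the deletion, summing over the membership of [v] multiplies these weights by [1 + l]. *)
Lemma Zf_outl v P C : v \in K -> v \notin P ->
  Zf l z P [set e in C | v \notin e] <= (1 + l) * Zf l z P C.
Proof.
move=> vK vP; rewrite /Zf !(@wsum_out _ _ v) // mulr_sumr.
apply: ler_sum => A /andP[_ vA]; rewrite mulrCA ler_wpM2l ?exprn_ge0 //.
set Cv := [set e in C | _].
have -> : ncov Cv (v |: A :|: P) = ncov Cv (A :|: P).
  congr #|pred_of_set _|; apply/setP=> e; rewrite !inE.
  case: (e \in C) => //=; case: (boolP (v \in e)) => //= ve.
  apply/subsetP/subsetP => eA x xe; have := eA _ xe; rewrite !inE.
    by case: (altP (x =P v)) => [xv|//]; move: ve; rewrite -xv xe.
  by case/orP=> ->; rewrite ?orbT.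
have -> : ncov Cv (A :|: P) = ncov C (A :|: P).
  congr #|pred_of_set _|; apply/setP=> e; rewrite !inE.
  case: (e \in C) => //=; case: (boolP (v \in e)) => //= ve; apply/esym/negP => /subsetP/(_ _ ve).
  by rewrite inE (negPf vA) (negPf vP).
have := exprn_ge0 (ncov C (v |: A :|: P)) z0.
move: (z ^+ ncov C (v |: A :|: P)) (z ^+ ncov C (A :|: P)) => w' w w'0.
by rewrite -subr_ge0 (_ : _ - _ = (1 + l) * (l * w')) ?mulr_ge0 ?addr_ge0 //; ring.
Qed.

(** Only sets that together with [Q] contain [e] are affected by the new hyperedge, each losing the
    fraction [1 - z]. Containing [e :\: Q] costs [l / (1 + l)] per vertex and leaves [e] pinned.
    This is one factor of the telescoping product. *)
Lemma Zf_addE Q C (e : {set T}) : e \subset K -> e \notin C ->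
  Zf l z Q (e |: C) = Zf l z Q C
    - (1 - z) * (l / (1 + l)) ^+ #|e :\: Q| * Zf l z (Q :|: e) C.
Proof.
move=> eK eC; apply/eqP; rewrite eq_sym subr_eq addrC -subr_eq; apply/eqP.
rewrite wsumB.
have -> : Zf l z (Q :|: e) C = wsum l (fun A => z ^+ ncov C ((e :\: Q :|: A) :|: Q)).
  apply: eq_wsum => A _; congr (_ ^+ ncov _ _); apply/setP=> x; rewrite !inE.
  by case: (x \in Q); case: (x \in e); case: (x \in A).
have DK : e :\: Q \subset K by apply: subset_trans eK; apply: subsetDl.
rewrite -mulrA -(@wsum_in _ (fun A => z ^+ ncov C (A :|: Q))) // -wsumZ.
apply: eq_wsum => A AK; rewrite ncovU1 //.
have -> : (e \subset A :|: Q) = (e :\: Q \subset A) by rewrite subDset setUC.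
rewrite exprD; move: (z ^+ ncov C _) => w.
by case: (e :\: Q \subset A); rewrite /= ?expr1 ?expr0 ?mulr1n ?mulr0n; ring.
Qed.

End Zf.
End WeightedSums.

(** * One-step bounds for pinning ratios *)

Lemma disjointP (T : finType) (A B : {pred T}) :
  reflect (forall x, x \in A -> x \in B -> False) [disjoint A & B].
Proof.
apply: (iffP pred0P) => [H x xA xB|H x]; first by have := H x; rewrite /= xA xB.
by apply/negP=> /andP[xA xB]; apply: (H x).
Qed.

Lemma set_ind_sub (X : finType) (S : {set X}) (Q : {set X} -> Prop) :
  Q set0 ->
  (forall x (S' : {set X}), x \in S -> x \notin S' -> S' \subset S -> Q S' -> Q (x |: S')) -> Q S.
Proof.
move=> Q0 QS; suff H n (S' : {set X}) : S' \subset S -> #|S'| = n -> Q S' by exact: (H #|S|).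
elim: n S' => [|n IH] S' sS' cS'; first by rewrite (cards0_eq cS').
have [x xS'] : exists x, x \in S' by apply/card_gt0P; rewrite cS'.
have sx : S' :\ x \subset S by apply: subset_trans sS'; apply: subD1set.
rewrite -(setD1K xS'); apply: QS; rewrite ?setD11 ?(subsetP sS') //.
by apply: IH => //; move: cS'; rewrite (cardsD1 x) xS' => -[].
Qed.

Section OneStep.
Variables (R : realType) (T : finType) (K : {set T}) (E : {set {set T}}) (k : nat).
Variables (l z : R).
Hypotheses (l0 : 0 <= l) (z0 : 0 <= z) (z1 : z <= 1).
Hypotheses (EK : forall e : {set T}, e \in E -> e \subset K)
  (Ek : forall e : {set T}, e \in E -> #|e| = k.+1) (k_gt0 : (0 < k)%N).
Implicit Types (D P Q S e : {set T}) (C F : {set {set T}}) (v : T).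

Let p := l / (1 + l).

(* [P] is a set of vertices pinned into the random set; [C] may have lost any of the
   hyperedges that meet the small exceptional set [D], but no other one *)
Definition admissible r D P C :=
  [/\ D \subset K, (#|D| <= r)%N, P \subset D, C \subset E &
      forall e, e \in E -> [disjoint e & D] -> e \in C].

Definition ratio_le r (U : R) := forall D P C v, admissible r D P C ->
  v \in K -> v \notin D -> Zf K l z (v |: P) C <= U * Zf K l z P C.

(** The side condition excludes a hyperedge that [v] completes inside the exceptional set. If such a
    hyperedge were already contained in [v |: P], pinning [v] would multiply every weight by [z],
    and no lower bound close to the expected one could hold. *)
Definition ratio_ge r (L : R) := forall D P C v, admissible r D P C ->
  v \in K -> v \notin D -> (forall e, e \in C -> v \in e -> ~~ (e \subset v |: D)) ->
  L * Zf K l z P C <= Zf K l z (v |: P) C.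

Lemma admissibleU r D P C S : admissible r D P C -> S \subset K ->
  admissible (r + #|S|) (S :|: D) (S :|: P) C.
Proof.
case=> DK Dr PD CE DC SK; split=> //.
- by rewrite subUset SK.
- by rewrite addnC; apply: leq_trans (leq_card_setU _ _) _; rewrite leq_add2l.
- exact: setUS.
- move=> e eE /disjointP H; apply: DC => //; apply/disjointP => x xe xD.
  by apply: (H x) => //; rewrite inE xD orbT.
Qed.

Lemma admissibleW r r' D P C : (r <= r')%N -> admissible r D P C -> admissible r' D P C.
Proof. by move=> rr' [? Dr ? ? ?]; split=> //; apply: leq_trans Dr rr'. Qed.

Lemma ratio_le_chain r U D P C S n : 0 <= U -> ratio_le (r + n) U -> admissible r D P C ->
  S \subset K -> [disjoint S & D] -> (#|S| <= n)%N ->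
  Zf K l z (S :|: P) C <= U ^+ #|S| * Zf K l z P C.
Proof.
move=> U0 rU adm SK /disjointP SD Sn; apply: (@set_ind_sub _ S (fun S =>
  Zf K l z (S :|: P) C <= U ^+ #|S| * Zf K l z P C)).
  by rewrite cards0 expr0 mul1r set0U.
move=> v S' vS vS' sS' IH; rewrite -setUA cardsU1 vS' exprS -mulrA.
have adm' : admissible (r + n) (S' :|: D) (S' :|: P) C.
  apply: admissibleW (admissibleU adm (subset_trans sS' SK)).
  by rewrite leq_add2l (leq_trans (subset_leq_card sS')).
apply: le_trans (rU _ _ _ v adm' _ _) _; rewrite ?(subsetP SK) //.
  by rewrite inE negb_or vS' /=; apply/negP=> /(SD _ vS).
exact: ler_wpM2l.
Qed.

(** The last hypothesis supplies the side condition of [ratio_ge] at every stage: a hyperedge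
    completed while [S] is being pinned would lie in [S :|: D] and meet [S]. *)
Lemma ratio_ge_chain r L D P C S n : 0 <= L -> ratio_ge (r + n) L -> admissible r D P C ->
  S \subset K -> [disjoint S & D] -> (#|S| <= n)%N ->
  (forall e, e \in C -> e \subset S :|: D -> [disjoint e & S]) ->
  L ^+ #|S| * Zf K l z P C <= Zf K l z (S :|: P) C.
Proof.
move=> L0 rL adm SK /disjointP SD Sn HS; apply: (@set_ind_sub _ S (fun S =>
  L ^+ #|S| * Zf K l z P C <= Zf K l z (S :|: P) C)).
  by rewrite cards0 expr0 mul1r set0U.
move=> v S' vS vS' sS' IH; rewrite -setUA cardsU1 vS' exprS -mulrA.
have adm' : admissible (r + n) (S' :|: D) (S' :|: P) C.
  apply: admissibleW (admissibleU adm (subset_trans sS' SK)).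
  by rewrite leq_add2l (leq_trans (subset_leq_card sS')).
apply: le_trans (rL _ _ _ v adm' _ _ _); rewrite ?(subsetP SK) //.
- exact: ler_wpM2l.
- by rewrite inE negb_or vS' /=; apply/negP=> /(SD _ vS).
move=> e eC ve; apply/negP=> esub.
have : e \subset S :|: D.
  apply: subset_trans esub _; rewrite setUA setSU // subUset sub1set vS //.
by move=> /(HS _ eC)/disjointP/(_ _ ve).
Qed.

Lemma p_ge0 : 0 <= p. Proof. by rewrite divr_ge0 // addr_ge0. Qed.

Lemma p_lt1 : p < 1. Proof. by rewrite ltr_pdivrMr ?ltr_pwDl // mul1r ltrDr ltr01. Qed.

(** Since [1 - p = (1 + l)^-1], the bound [a <= p] gives [(1 - a)^-1 = 1 + a / (1 - a) <= 1 + (1 +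
    l) * a]. *)
Lemma expR_le_1B (a : R) : 0 <= a -> a <= p -> expR (- ((1 + l) * a)) <= 1 - a.
Proof.
move=> a0 ap; rewrite expRN.
have l1 : 0 < 1 + l by rewrite ltr_pwDl.
have a1 : a < 1 by apply: le_lt_trans ap p_lt1.
have al : (1 + l) * a <= l by rewrite mulrC -ler_pdivlMr.
have h : 1 + (1 + l) * a <= expR ((1 + l) * a) by exact: expR_ge1Dx.
rewrite invf_ple ?posrE ?expR_gt0 ?subr_gt0 //; apply: le_trans h.
rewrite -[leLHS]mul1r ler_pdivrMr ?subr_gt0 //.
nra.
Qed.

(** Base of the telescoping: once no hyperedge contains [v], pinning [v] changes nothing, and the
    deletion itself costs a factor between 1 and [1 + l]. *)
Lemma Zf_delete_in r D P C v : admissible r D P C -> v \in K -> v \notin D ->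
  Zf K l z P C <= Zf K l z (v |: P) [set e in C | v \notin e] /\
  Zf K l z (v |: P) [set e in C | v \notin e] <= (1 + l) * Zf K l z P C.
Proof.
move=> [DK Dr PD CE DC] vK vD.
have -> : Zf K l z (v |: P) [set e in C | v \notin e] = Zf K l z P [set e in C | v \notin e].
  by apply: Zf_free => // e; rewrite inE => /andP[].
split; first by apply: Zf_le => //; apply/subsetP => e; rewrite inE => /andP[].
by apply: Zf_outl => //; apply: contra vD => /(subsetP PD).
Qed.

Lemma split_at v C : C = [set e in C | v \notin e] :|: [set e in C | v \in e].
Proof. by apply/setP=> e; rewrite !inE; case: (e \in C) => //=; case: (v \in e). Qed.

(** The intermediate hypergraphs of the telescoping, with only the part [F] of the hyperedges at [v]
    restored. They are admissible because [v] joins [D], which allows hyperedges at [v] to be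
    missing. *)
Lemma admissible_delete r D P C v F : admissible r D P C -> v \in K ->
  F \subset [set e in C | v \in e] ->
  admissible r.+1 (v |: D) (v |: P) (F :|: [set e in C | v \notin e]).
Proof.
move=> adm vK sF; have := admissibleU adm (_ : [set v] \subset K).
rewrite sub1set vK cards1 addn1 => /(_ isT) [DK Dr PD CE DC].
case: adm => _ _ _ _ DC'; split=> //.
  rewrite subUset; apply/andP; split; apply: subset_trans CE.
    by apply: subset_trans sF _; apply/subsetP => e; rewrite inE => /andP[].
  by apply/subsetP => e; rewrite inE => /andP[].
move=> e eE eD; rewrite !inE (DC _ eE eD) /=; apply/orP; right.
by apply/negP=> ve; move: eD => /disjointP/(_ _ ve); rewrite setU11 => /(_ isT).
Qed.

Lemma pinned_edge D P e v : P \subset D -> v \in e -> [disjoint e & D] ->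
  [/\ v |: P :|: e = (e :\ v) :|: (v |: P), e :\: (v |: P) = e :\ v &
      [disjoint e :\ v & v |: D]].
Proof.
move=> PD ve /disjointP eD; split.
- by apply/setP => x; rewrite !inE; case: eqP => [->|]; rewrite ?ve //= orbC.
- apply/setP => x; rewrite !inE negb_or; case: eqP => //= xv.
  case: (boolP (x \in e)) => xe; rewrite ?andbF // andbT; apply/negP => /(subsetP PD).
  exact: eD xe.
- apply/disjointP => x; rewrite !inE => /andP[/negPf -> xe] /=; exact: eD xe.
Qed.

(** Hyperedges at [v] are restored one at a time, and [a e] bounds the relative loss. If [e] avoids
    [D], pinning its other [k] vertices costs at most [U ^+ k]. If [e] meets [D], the ratio is
    bounded by 1 and only the power of [p] is kept; these losses add up to [err]. The hypothesis
    [good] keeps each of them at most [p], as [expR_le_1B] requires. *)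
Lemma ratio_ge_step r U (deg err : R) : 0 <= U -> U <= 1 ->
  (forall v, v \in K -> (#|[set e in E | v \in e]|)%:R <= deg) ->
  (forall D v, D \subset K -> (#|D| <= r)%N -> v \in K -> v \notin D ->
     \sum_(e in E | [&& v \in e, ~~ [disjoint e & D] & ~~ (e \subset v |: D)])
        p ^+ #|e :\: (v |: D)| <= err) ->
  ratio_le (r.+1 + k) U ->
  ratio_ge r (expR (- ((1 + l) * ((1 - z) * deg * p ^+ k * U ^+ k + err)))).
Proof.
move=> U0 U1 Hdeg Herr rU D P C v adm vK vD good.
have [DK Dr PD CE DC] := adm.
have p0 := p_ge0; have p1 := ltW p_lt1.
pose a e := if [disjoint e & D] then (1 - z) * p ^+ k * U ^+ k else p ^+ #|e :\: (v |: D)|.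
pose C0 := [set e in C | v \notin e]; pose C1 := [set e in C | v \in e].
have ge0a e : 0 <= a e by rewrite /a; case: ifP => _; rewrite ?mulr_ge0 ?exprn_ge0 ?subr_ge0.
have ap e : e \in C1 -> a e <= p.
  rewrite inE => /andP[eC ve]; rewrite /a; case: ifP => _.
    rewrite -mulrA; apply: le_trans (_ : 1 * (p * 1) <= _); last by rewrite mulr1 mul1r.
    apply: ler_pM; rewrite ?mulr_ge0 ?exprn_ge0 ?subr_ge0 //; first by rewrite lerBlDr lerDl.
    apply: ler_pM; rewrite ?exprn_ge0 ?exprn_ile1 //.
    by rewrite -[leRHS]expr1; apply: ler_wiXn2l.
  rewrite -[leRHS]expr1; apply: ler_wiXn2l => //.
  by rewrite card_gt0 setD_eq0; apply: good.
have tele F : F \subset C1 ->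
    \prod_(e in F) (1 - a e) * Zf K l z (v |: P) C0 <= Zf K l z (v |: P) (F :|: C0).
  move=> sF; apply: (@set_ind_sub _ F (fun F =>
    \prod_(e in F) (1 - a e) * Zf K l z (v |: P) C0 <= Zf K l z (v |: P) (F :|: C0))).
    by rewrite big_set0 mul1r set0U.
  move=> e F' eF eF' sF' IH; rewrite big_setU1 //= -mulrA -setUA.
  have eC1 := subsetP sF _ eF; have [eC ve] : e \in C /\ v \in e by apply/andP; move: eC1; rewrite inE.
  have eE := subsetP CE _ eC.
  have adm' := admissible_delete adm vK (subset_trans sF' sF).
  rewrite Zf_addE ?EK //; last by rewrite !inE negb_or eF' ve andbF.
  apply: (@le_trans _ _ ((1 - a e) * Zf K l z (v |: P) (F' :|: C0))).
    by apply: ler_wpM2l IH; rewrite subr_ge0 (le_trans (ap _ eC1)).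
  rewrite mulrBl mul1r lerD2l lerN2 /a; case: ifP => [eD|_].
    have [-> -> dev] := pinned_edge PD ve eD.
    have cev : #|e :\ v| = k by move: (Ek eE); rewrite (cardsD1 v) ve => -[].
    rewrite cev -!mulrA ler_wpM2l ?subr_ge0 // ler_wpM2l ?exprn_ge0 //.
    rewrite -[X in U ^+ X]cev; apply: (ratio_le_chain U0 rU adm'); rewrite ?cev //.
    by apply: subset_trans (subD1set _ _) (EK eE).
  apply: ler_pM; rewrite ?Zf_ge0 ?mulr_ge0 ?exprn_ge0 ?subr_ge0 //; last first.
    by apply: Zf_le => //; apply: subsetUl.
  apply: (@le_trans _ _ (1 * p ^+ #|e :\: (v |: P)|)).
    by rewrite ler_wpM2r ?exprn_ge0 // lerBlDr lerDl.
  rewrite mul1r; apply: ler_wiXn2l => //; apply: subset_leq_card.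
  exact/setDS/setUS.
have C10 : C1 :|: C0 = C by rewrite setUC -split_at.
have := tele C1 (subxx _); rewrite C10 => teleC.
apply: le_trans teleC.
have [ZP _] := Zf_delete_in adm vK vD.
apply: (@le_trans _ _ (expR (- ((1 + l) * ((1 - z) * deg * p ^+ k * U ^+ k + err))) *
   Zf K l z (v |: P) C0)).
  by rewrite ler_wpM2l ?expR_ge0.
rewrite ler_wpM2r ?Zf_ge0 //.
apply: (@le_trans _ _ (\prod_(e in C1) expR (- ((1 + l) * a e)))); last first.
  apply: ler_prod => e eC1; rewrite expR_ge0 /=; exact: expR_le_1B (ge0a e) (ap e eC1).
rewrite -expR_sum ler_expR sumrN lerN2 -mulr_sumr ler_wpM2l ?addr_ge0 //.
rewrite (bigID (fun e : {set T} => [disjoint e & D])) /=; apply: lerD.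
  rewrite (eq_bigr (fun=> (1 - z) * p ^+ k * U ^+ k)); last first.
    by move=> e /andP[_ eD]; rewrite /a eD.
  rewrite sumr_const -mulr_natl [(1 - z) * deg]mulrC -!mulrA.
  rewrite ler_wpM2r ?mulr_ge0 ?exprn_ge0 ?subr_ge0 // (le_trans _ (Hdeg _ vK)) // ler_nat.
  apply: subset_leq_card; apply/subsetP => e /andP[+ _].
  by rewrite !inE => /andP[eC ->]; rewrite (subsetP CE).
apply: le_trans (Herr _ _ DK Dr vK vD); rewrite [leLHS]big_mkcond [leRHS]big_mkcond.
apply: ler_sum => e _ /=; rewrite inE /a.
case: (boolP (e \in C)) => [eC|_] /=; last by case: ifP; rewrite ?exprn_ge0.
rewrite (subsetP CE _ eC); case: (boolP (v \in e)) => [ve|_] //=.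
case: (boolP [disjoint e & D]) => //= eD.
by rewrite good.
Qed.

(** Exactly what [ratio_ge_chain] needs in order to pin [e :\ v] after [v]: no other hyperedge is
    completed inside [e :|: D] by a vertex of [e :\ v]. *)
Definition clean D v e := [disjoint e & D] &&
  [forall e' in E, (e' != e) ==> (e' \subset e :|: D) ==> [disjoint e' & e :\ v]].

(** For an upper bound, a hyperedge may be restored at factor 1, so the unclean ones are simply
    ignored and at least [deg - b] hyperedges contribute. The factor [1 + l] is the deletion cost of
    [Zf_delete_in]. *)
Lemma ratio_le_step r L (deg b : R) : 0 <= L -> L <= 1 ->
  (forall v, v \in K -> deg <= (#|[set e in E | v \in e]|)%:R) ->
  (forall D v, D \subset K -> (#|D| <= r)%N -> v \in K -> v \notin D ->
     (#|[set e in E | (v \in e) && ~~ clean D v e]|)%:R <= b) ->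
  ratio_ge (r.+1 + k) L ->
  ratio_le r ((1 + l) * expR (- ((1 - z) * (deg - b) * p ^+ k * L ^+ k))).
Proof.
move=> L0 L1 Hdeg Hbad rL D P C v adm vK vD.
have [DK Dr PD CE DC] := adm.
have p0 := p_ge0; have p1 := ltW p_lt1.
pose a := (1 - z) * p ^+ k * L ^+ k.
pose C0 := [set e in C | v \notin e]; pose C1 := [set e in C | v \in e].
have a0 : 0 <= a by rewrite !mulr_ge0 ?exprn_ge0 ?subr_ge0.
have a1 : a <= 1.
  by rewrite !mulr_ile1 ?mulr_ge0 ?exprn_ge0 ?exprn_ile1 ?subr_ge0 // lerBlDr lerDl.
pose f e := if clean D v e then 1 - a else 1.
have f0 e : 0 <= f e by rewrite /f; case: ifP => _; rewrite ?subr_ge0.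
have tele F : F \subset C1 ->
    Zf K l z (v |: P) (F :|: C0) <= \prod_(e in F) f e * Zf K l z (v |: P) C0.
  move=> sF; apply: (@set_ind_sub _ F (fun F =>
    Zf K l z (v |: P) (F :|: C0) <= \prod_(e in F) f e * Zf K l z (v |: P) C0)).
    by rewrite big_set0 mul1r set0U.
  move=> e F' eF eF' sF' IH; rewrite big_setU1 //= -mulrA -setUA.
  have eC1 := subsetP sF _ eF; have [eC ve] : e \in C /\ v \in e by apply/andP; move: eC1; rewrite inE.
  have eE := subsetP CE _ eC.
  have adm' := admissible_delete adm vK (subset_trans sF' sF).
  apply: (@le_trans _ _ (f e * Zf K l z (v |: P) (F' :|: C0))); last exact: ler_wpM2l.
  rewrite /f; case: ifP => [/andP[eD /forall_inP ecl]|_]; last first.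
    by rewrite mul1r; apply: Zf_le => //; apply: subsetUr.
  rewrite Zf_addE ?EK //; last by rewrite !inE negb_or eF' ve andbF.
  rewrite [leRHS]mulrBl mul1r lerD2l lerN2.
  have [-> -> dev] := pinned_edge PD ve eD.
  have cev : #|e :\ v| = k by move: (Ek eE); rewrite (cardsD1 v) ve => -[].
  rewrite cev -!mulrA ler_wpM2l ?subr_ge0 // ler_wpM2l ?exprn_ge0 //.
  rewrite -[X in L ^+ X]cev; apply: (ratio_ge_chain L0 rL adm'); rewrite ?cev //.
    by apply: subset_trans (subD1set _ _) (EK eE).
  move=> e' e'C; rewrite setUA [e :\ v :|: _]setUC setD1K // => e'eD.
  have ne : e' != e.
    by apply: contraTneq e'C => ->; rewrite !inE negb_or eF' ve andbF.
  have e'E : e' \in E.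
    move: e'C; rewrite !inE => /orP[/(subsetP sF')/(subsetP sF)|].
      by rewrite inE => /andP[/(subsetP CE)].
    by case/andP => /(subsetP CE).
  by have /implyP/(_ ne)/implyP/(_ e'eD) := ecl _ e'E.
have C10 : C1 :|: C0 = C by rewrite setUC -split_at.
have := tele C1 (subxx _); rewrite C10 => teleC; apply: (le_trans teleC).
have [_ ZP] := Zf_delete_in adm vK vD.
rewrite [X in _ <= X * _]mulrC -[leRHS]mulrA; apply: ler_pM; rewrite ?Zf_ge0 ?prodr_ge0 //.
apply: (@le_trans _ _ (\prod_(e in C1 | clean D v e) expR (- a))).
  rewrite big_mkcondr; apply: ler_prod => e _; rewrite f0 /f /=.
  by case: ifP => // _; exact: expR_ge1Dx.
rewrite -expR_sum ler_expR sumr_const -mulr_natl mulrN lerN2.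
rewrite [(1 - z) * _]mulrC -!mulrA [p ^+ k * _]mulrC 2!mulrA -/a.
rewrite [X in _ <= X * _](_ : _ = #|[set e in E | (v \in e) && clean D v e]|%:R).
  rewrite (_ : _ * _ * _ = (deg - b) * a); last by rewrite /a -!mulrA [p ^+ k * _]mulrC.
  rewrite ler_wpM2r // lerBlDr; apply: le_trans (Hdeg _ vK) _.
  apply: le_trans (lerD (lexx _) (Hbad _ _ DK Dr vK vD)).
  rewrite -natrD ler_nat -cardsUI (leq_trans _ (leq_addr _ _)) //.
  apply: subset_leq_card; apply/subsetP => e; rewrite !inE => /andP[-> ->] /=.
  by case: (clean _ _ _).
congr (_%:R); apply: eq_card => e; rewrite [RHS]inE; apply/andP/andP.
  by rewrite inE => -[/andP[eC ->] ->]; rewrite (subsetP CE).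
by rewrite inE => -[eE /andP[-> ecl]]; rewrite DC //; case/andP: ecl.
Qed.
End OneStep.

(** * Sparse hypergraphs *)

Section Sparse.
Variables (R : realType) (T : finType).
Implicit Types (K D S e : {set T}) (E : {set {set T}}).

Definition codeg E S : nat := #|[set e in E | S \subset e]|.

(* The scale [q] is [Delta ^ (- 1 / k)]; all error terms are measured by [d]. *)
Definition sparse K E (k : nat) (q d : R) : Prop :=
  [/\ 0 < q, q <= d, forall v, v \in K -> (#|[set e in E | v \in e]|)%:R * q ^+ k = 1,
      forall S, S \subset K -> (2 <= #|S| <= k)%N -> (codeg E S)%:R * q ^+ (k.+1 - #|S|) <= d &
      forall v w, v \in K -> w \in K -> v != w ->
        (#|[set e in E | (v \in e) && (w |: e :\ v \in E)]|)%:R * q ^+ k <= d].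

Definition uniform K E (k : nat) := forall e, e \in E -> e \subset K /\ #|e| = k.+1.

Lemma leq_card_bigcup (I : finType) (P : pred I) (F : I -> {set {set T}}) :
  (#|\bigcup_(i | P i) F i| <= \sum_(i | P i) #|F i|)%N.
Proof.
elim/big_rec2: _ => [|i n A _ IH]; first by rewrite cards0.
by apply: leq_trans (leq_card_setU _ _) _; rewrite leq_add2l.
Qed.

Section Counting.
Variables (K : {set T}) (E : {set {set T}}) (k : nat) (q d : R).
Hypotheses (Hu : uniform K E k) (Hs : sparse K E k q d) (k_gt1 : (1 < k)%N) (d1 : d <= 1).

Let q_gt0 : 0 < q. Proof. by case: Hs. Qed.
Let q_le : q <= d. Proof. by case: Hs. Qed.
Let d_ge0 : 0 <= d. Proof. by rewrite (le_trans _ q_le) // ltW. Qed.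
Let codegP S : S \subset K -> (2 <= #|S| <= k)%N ->
  (codeg E S)%:R * q ^+ (k.+1 - #|S|) <= d.
Proof. by case: Hs => _ _ _ H _; apply: H. Qed.

(** Sort the hyperedges by [S = e :&: D], which is nonempty and has fewer than [k] elements. The
    codegree of [v |: S] is at most [d * q ^- (k - #|S|)], which cancels the powers of [q] in
    [p ^+ (k - #|S|)], and there are at most [2 ^ r] sets [S]. *)
Lemma partial_overlap_sum r (B p : R) D v : 0 <= p -> p <= B * q -> 1 <= B ->
  D \subset K -> (#|D| <= r)%N -> v \in K -> v \notin D ->
  \sum_(e in E | [&& v \in e, ~~ [disjoint e & D] & ~~ (e \subset v |: D)])
     p ^+ #|e :\: (v |: D)| <= (2 ^ r)%:R * (d * B ^+ k).
Proof.
move=> p0 pB B1 DK Dr vK vD; have B0 : 0 <= B by apply: le_trans B1.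
apply: (@le_trans _ _ (\sum_(e in E) \sum_(S in powerset D | (0 < #|S| < k)%N)
   (p ^+ (k - #|S|)) *+ (v |: S \subset e))).
  rewrite big_mkcondr /=; apply: ler_sum => e eE.
  case: ifP => [/and3P[ve eD evD]|_]; last first.
    by apply: sumr_ge0 => S _; rewrite mulrn_wge0 ?exprn_ge0.
  have [eK ek] := Hu eE.
  have cE : (#|e :\: (v |: D)| + #|e :&: D| = k)%N.
    have := cardsD1 v e; rewrite ve ek add1n => -[->].
    rewrite -(cardsID D (e :\ v)) addnC; congr (_ + _)%N.
      apply: eq_card => x; rewrite !inE.
      by case: eqP => [->|]; rewrite ?(negPf vD) ?andbF.
    by apply: eq_card => x; rewrite !inE negb_or; case: eqP; rewrite ?andbF.
  rewrite (bigD1 (e :&: D)) /=; last first.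
    rewrite powersetE subsetIr /= card_gt0 setI_eq0 eD /= -cE -[X in (X < _)%N]add0n ltn_add2r.
    by rewrite card_gt0 setD_eq0.
  rewrite subUset sub1set ve subsetIl mulr1n.
  have -> : #|e :\: (v |: D)| = (k - #|e :&: D|)%N by rewrite -cE addnK.
  by rewrite lerDl sumr_ge0 // => S _; rewrite mulrn_wge0 ?exprn_ge0.
rewrite exchange_big /=.
apply: (@le_trans _ _ (\sum_(S in powerset D | (0 < #|S| < k)%N) d * B ^+ k)).
  apply: ler_sum => S /andP[]; rewrite powersetE => SD /andP[S0 Sk].
  have cvS : #|v |: S| = #|S|.+1.
    by rewrite cardsU1 (_ : v \notin S) // (contra _ vD) // => /(subsetP SD).
  under eq_bigr do rewrite mulrb.
  rewrite -big_mkcondr /= sumr_const.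
  have -> : #|[pred e in E | v |: S \subset e]| = codeg E (v |: S).
    by rewrite /codeg cardsE.
  have cS : (codeg E (v |: S))%:R * q ^+ (k - #|S|) <= d.
    rewrite -subSS -cvS; apply: codegP; last by rewrite cvS ltnS S0 Sk.
    by rewrite subUset sub1set vK (subset_trans SD).
  rewrite -mulr_natl.
  apply: (@le_trans _ _ ((codeg E (v |: S))%:R * (B ^+ k * q ^+ (k - #|S|)))).
    rewrite ler_wpM2l //; apply: (@le_trans _ _ ((B * q) ^+ (k - #|S|))).
      by apply: lerXn2r; rewrite ?nnegrE // (le_trans p0).
    rewrite exprMn ler_wpM2r ?exprn_ge0 ?(ltW q_gt0) //.
    by apply: ler_weXn2l => //; apply: leq_subr.
  by rewrite mulrCA mulrC ler_wpM2r ?exprn_ge0 ?(le_trans ler01).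
rewrite sumr_const -[leLHS]mulr_natl ler_wpM2r ?mulr_ge0 ?exprn_ge0 //.
rewrite ler_nat; apply: (@leq_trans #|powerset D|).
  by apply: subset_leq_card; apply/subsetP=> S /andP[].
by rewrite card_powerset leq_pexp2l.
Qed.

(** A two-level count: choose [e'] through [S], then [e] through [G e']. Each choice is a codegree
    and yields a factor [d]; the two exponents of [q] add up to [k]. *)
Lemma codeg_mulq_le (X : {set {set T}}) (G : {set T} -> {set T}) S (m : nat) :
  S \subset K -> (2 <= #|S| <= k)%N -> (m <= k)%N ->
  (forall e', e' \in X -> G e' \subset K /\ (#|G e'| = m.+1)%N) -> (0 < m < k)%N ->
  X \subset [set e in E | S \subset e] -> (k.+1 - #|S| + (k - m) = k)%N ->
  (#|\bigcup_(e' in X) [set e in E | G e' \subset e]|)%:R * q ^+ k <= d ^+ 2.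
Proof.
move=> SK Sk mk HG m0k XS ek.
apply: (@le_trans _ _ (\sum_(e' in X) (codeg E (G e'))%:R * q ^+ k)).
  rewrite -mulr_suml ler_wpM2r ?exprn_ge0 ?(ltW q_gt0) // -natr_sum ler_nat.
  exact: leq_card_bigcup.
apply: (@le_trans _ _ (\sum_(e' in X) q ^+ (k.+1 - #|S|) * d)).
  apply: ler_sum => e' e'X; have [GK Gm] := HG _ e'X.
  rewrite -{1}ek exprD mulrCA ler_wpM2l ?exprn_ge0 ?(ltW q_gt0) //.
  by have := codegP GK; rewrite Gm subSS; apply; case/andP: m0k => *; apply/andP.
rewrite sumr_const -mulr_natl mulrA expr2 ler_wpM2r //.
apply: le_trans (codegP SK Sk); rewrite ler_wpM2r ?exprn_ge0 ?(ltW q_gt0) // ler_nat.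
exact: subset_leq_card.
Qed.

(** With [S = e' :&: D] for the offending [e'], there are four cases: [e] meets [D] ([B1]); [v] is
    in [e'] ([B3]); [v] is not in [e'] and [S] has at least two elements ([B4]); [v] is not in [e']
    and [S = [set w]] ([B2]). In the last case no codegree bound applies to [S], but [e'] must be
    [w |: e :\ v], which is what the last condition of [sparse] counts. *)
Lemma unclean_count r D v : D \subset K -> (#|D| <= r)%N -> v \in K -> v \notin D ->
  (#|[set e in E | (v \in e) && ~~ clean E D v e]|)%:R * q ^+ k <= (2 ^ r)%:R * (4 * d).
Proof.
move=> DK Dr vK vD.
pose B1 := \bigcup_(w in D) [set e in E | [set v; w] \subset e].
pose B2 := \bigcup_(w in D) [set e in E | (v \in e) && (w |: e :\ v \in E)].
pose X3 S := [set e' in E | v |: S \subset e'].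
pose X4 S := [set e' in E | (S \subset e') && (v \notin e')].
pose B3 S := \bigcup_(e' in X3 S) [set e in E | e' :\: S \subset e].
pose B4 S := \bigcup_(e' in X4 S) [set e in E | v |: e' :\: S \subset e].
have cov : [set e in E | (v \in e) && ~~ clean E D v e] \subset
   (B1 :|: B2) :|: ((\bigcup_(S in powerset D | (0 < #|S| < k)%N) B3 S) :|:
   (\bigcup_(S in powerset D | (1 < #|S| <= k)%N) B4 S)).
  apply/subsetP=> e; rewrite inE => /and3P[eE ve].
  have [eK ek] := Hu eE.
  rewrite negb_and => /orP[/pred0Pn[w /= /andP[we wD]]|].
    rewrite ?in_setU -!orbA; apply/or4P; apply: Or41; apply/bigcupP; exists w => //.
    by rewrite inE eE subUset !sub1set ve we.
  case: (boolP [disjoint e & D]) => [eD|]; last first.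
    move=> /pred0Pn[w /= /andP[we wD]] _.
    rewrite ?in_setU -!orbA; apply/or4P; apply: Or41; apply/bigcupP; exists w => //.
    by rewrite inE eE subUset !sub1set ve we.
  move=> /forall_inPn[e' e'E]; rewrite !negb_imply => /and3P[ne e'eD].
  move=> /pred0Pn[u /= /andP[ue']]; rewrite !inE => /andP[uv ue].
  have [e'K ek'] := Hu e'E.
  pose S := e' :&: D.
  have SD : S \subset D by apply: subsetIr.
  have Se' : S \subset e' by apply: subsetIl.
  have dSe : e' :\: S \subset e.
    apply/subsetP => x; rewrite !inE negb_and => /andP[/orP[/negP//|xD] xe'].
    by move: (subsetP e'eD _ xe'); rewrite inE (negPf xD) orbF.
  have cS : (#|e' :\: S| = k.+1 - #|S|)%N by rewrite cardsDS // ek'.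
  have S0 : (0 < #|S|)%N.
    rewrite card_gt0; apply: contra ne => /eqP S0; rewrite S0 setD0 in dSe.
    by rewrite eqEcard dSe ek ek' /=.
  have uS : u \notin S by move/disjointP: eD => /(_ u ue) uD; rewrite inE ue' /=; apply/negP.
  have vS : v \notin S by rewrite inE (negPf vD) andbF.
  case: (boolP (v \in e')) => ve'.
    rewrite ?in_setU -!orbA; apply/or4P; apply: Or43; apply/bigcupP; exists S.
      rewrite powersetE SD S0 /=.
      suff : (2 <= #|e' :\: S|)%N by rewrite cS ltn_subRL addn1 ltnS.
      have <- : #|[set u; v]| = 2%N by rewrite cards2 uv.
      by apply: subset_leq_card; rewrite subUset !sub1set !in_setD uS ue' vS ve'.
    apply/bigcupP; exists e'; rewrite !inE ?e'E ?eE //=.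
    by rewrite subUset sub1set ve'.
  case: (ltnP 1 #|S|) => S1.
    rewrite ?in_setU -!orbA; apply/or4P; apply: Or44; apply/bigcupP; exists S.
      rewrite powersetE SD S1 /=.
      suff : (0 < #|e' :\: S|)%N by rewrite cS subn_gt0 ltnS.
      by apply/card_gt0P; exists u; rewrite in_setD uS.
    apply/bigcupP; exists e'; rewrite !inE ?e'E ?eE ?Se' ?ve' //=.
    by rewrite subUset sub1set ve.
  have /cards1P[w Sw] : #|S| == 1%N by rewrite eqn_leq S1.
  have wD : w \in D by apply: (subsetP SD); rewrite Sw set11.
  rewrite ?in_setU -!orbA; apply/or4P; apply: Or42; apply/bigcupP; exists w => //.
  rewrite inE eE ve /=.
  have -> : w |: e :\ v = e' => //; apply/eqP; rewrite eq_sym eqEcard; apply/andP; split.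
    apply/subsetP => x xe'; rewrite in_setU1 in_setD1.
    case: (boolP (x \in S)) => xS; first by move: xS; rewrite Sw inE => ->.
    rewrite (subsetP dSe) ?in_setD ?xS // andbT orbC.
    by apply/orP; left; apply: contraNneq ve' => <-.
  have := cardsD1 v e; rewrite ve ek add1n => -[ek1].
  by rewrite ek' cardsU1 -ek1 -add1n leq_add2r leq_b1.
apply: (@le_trans _ _ ((#|B1| + #|B2| + (\sum_(S in powerset D | (0 < #|S| < k)%N) #|B3 S| +
   \sum_(S in powerset D | (1 < #|S| <= k)%N) #|B4 S|))%:R * q ^+ k)).
  rewrite ler_wpM2r ?exprn_ge0 ?(ltW q_gt0) // ler_nat.
  apply: leq_trans (subset_leq_card cov) _.
  apply: leq_trans (leq_card_setU _ _) _; apply: leq_add.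
    exact: leq_card_setU.
  by apply: leq_trans (leq_card_setU _ _) _; apply: leq_add; apply: leq_card_bigcup.
have cP (P : pred {set T}) : (\sum_(S in powerset D | P S) d ^+ 2) <= (2 ^ r)%:R * d.
  rewrite sumr_const -[leLHS]mulr_natl; apply: ler_pM; rewrite ?exprn_ge0 //; last first.
    by rewrite expr2 ler_piMl.
  rewrite ler_nat (@leq_trans #|powerset D|) //; last by rewrite card_powerset leq_pexp2l.
  by apply: subset_leq_card; apply/subsetP=> S /andP[].
have cD : \sum_(w in D) d <= (2 ^ r)%:R * d.
  rewrite sumr_const -[leLHS]mulr_natl ler_wpM2r // ler_nat (leq_trans Dr) //.
  by rewrite ltnW // ltn_expl.
have -> : (2 ^ r)%:R * (4 * d) = (2 ^ r)%:R * d + (2 ^ r)%:R * d + ((2 ^ r)%:R * d + (2 ^ r)%:R * d).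
  by ring.
rewrite !natrD !mulrDl; apply: lerD; apply: lerD.
- apply: le_trans cD; apply: (@le_trans _ _ (\sum_(w in D) (codeg E [set v; w])%:R * q ^+ k)).
    by rewrite -mulr_suml ler_wpM2r ?exprn_ge0 ?(ltW q_gt0) // -natr_sum ler_nat leq_card_bigcup.
  apply: ler_sum => w wD.
  have c2 : #|[set v; w]| = 2%N by rewrite cards2; case: eqP wD vD => [->|//] ->.
  have := @codegP [set v; w]; rewrite c2 subSS => H.
  apply: le_trans (H _ _); rewrite ?subUset ?sub1set ?vK ?(subsetP DK) ?k_gt1 //.
  rewrite ler_wpM2l //; apply: ler_wiXn2l; rewrite ?(ltW q_gt0) ?leq_subr //.
  exact: le_trans q_le d1.
- apply: le_trans cD; apply: (@le_trans _ _ (\sum_(w in D)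
    (#|[set e in E | (v \in e) && (w |: e :\ v \in E)]|)%:R * q ^+ k)).
    by rewrite -mulr_suml ler_wpM2r ?exprn_ge0 ?(ltW q_gt0) // -natr_sum ler_nat leq_card_bigcup.
  apply: ler_sum => w wD; case: Hs => _ _ _ _; apply=> //; first exact: (subsetP DK).
  by apply: contraNneq vD => ->.
- apply: le_trans (cP _); rewrite natr_sum mulr_suml; apply: ler_sum => S /andP[].
  rewrite powersetE => SD /andP[S0 Sk].
  have cvS : #|v |: S| = #|S|.+1.
    by rewrite cardsU1 (_ : v \notin S) // (contra _ vD) // => /(subsetP SD).
  apply: (@codeg_mulq_le _ _ (v |: S) (k - #|S|)) => //.
  - by rewrite subUset sub1set vK (subset_trans SD).
  - by rewrite cvS ltnS S0.
  - exact: leq_subr.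
  - move=> e'; rewrite inE => /andP[/Hu[eK ek]]; rewrite subUset => /andP[_ Se].
    by rewrite cardsDS // ek subSn ?(ltnW Sk) // (subset_trans (subsetDl _ _)).
  - by rewrite subn_gt0 Sk ltn_subrL S0 (leq_trans S0 (ltnW Sk)).
  - by rewrite cvS subSS subKn ?subnK // ltnW.
apply: le_trans (cP _); rewrite natr_sum mulr_suml; apply: ler_sum => S /andP[].
rewrite powersetE => SD /andP[S0 Sk].
apply: (@codeg_mulq_le _ _ S (k.+1 - #|S|)) => //.
- by rewrite (subset_trans SD).
- by rewrite S0.
- by rewrite leq_subLR -add1n leq_add2r ltnW.
- move=> e'; rewrite inE => /and3P[/Hu[eK ek] Se ve].
  rewrite subUset sub1set vK (subset_trans (subsetDl _ _)) //; split=> //.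
  by rewrite cardsU1 !inE negb_and ve orbT cardsDS // ek.
- by rewrite subn_gt0 ltnS Sk ltn_subLR ?leqW // -[k.+1]add1n ltn_add2r.
- by apply/subsetP=> e'; rewrite !inE => /and3P[-> ->].
- by rewrite subnKC // leq_subLR -add1n leq_add2r ltnW.
Qed.

End Counting.
End Sparse.

(** * One-step bounds at the scale [q] *)

Section ScaledSteps.
Variables (R : realType) (k : nat).
Hypothesis k_gt1 : (1 < k)%N.
Implicit Types (T : finType) (B s q d z e : R).

Lemma sparse_le T (K : {set T}) (E : {set {set T}}) q d d' : d <= d' ->
  sparse K E k q d -> sparse K E k q d'.
Proof.
move=> dd' [q0 qd deg cod lnk]; split=> //; first exact: le_trans qd dd'.
- by move=> S SK cS; apply: le_trans (cod S SK cS) dd'.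
- by move=> v w vK wK vw; apply: le_trans (lnk v w vK wK vw) dd'.
Qed.

Lemma ratio_le_ler T (K : {set T}) (E : {set {set T}}) (l z U U' : R) r :
  0 <= l -> 0 <= z -> U <= U' -> ratio_le K E l z r U -> ratio_le K E l z r U'.
Proof.
move=> l0 z0 UU' H D P C v adm vK vD; apply: le_trans (H D P C v adm vK vD) _.
by rewrite ler_wpM2r ?Zf_ge0.
Qed.

Lemma ratio_ge_ler T (K : {set T}) (E : {set {set T}}) (l z L L' : R) r :
  0 <= l -> 0 <= z -> L' <= L -> ratio_ge K E l z r L -> ratio_ge K E l z r L'.
Proof.
move=> l0 z0 LL' H D P C v adm vK vD good; apply: le_trans (H D P C v adm vK vD good).
by rewrite ler_wpM2r ?Zf_ge0.
Qed.

Lemma ratio_le1 T (K : {set T}) (E : {set {set T}}) (l z : R) r :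
  0 <= l -> 0 <= z -> z <= 1 -> ratio_le K E l z r 1.
Proof.
by move=> l0 z0 z1 D P C v adm vK vD; rewrite mul1r; apply: Zf_le => //; apply: subsetUr.
Qed.

(** The degree is [q ^- k] and [p <= s * q], so the main term is at most
    [(1 - z) * s ^+ k * U ^+ k]. The threshold [d] is chosen before the hypergraph, [s], [z] and
    [U], so one [d] serves them all. *)
Lemma scaled_ratio_ge B r e : 1 <= B -> 0 < e -> exists2 d, 0 < d &
  forall T (K : {set T}) (E : {set {set T}}) q, uniform K E k -> sparse K E k q d ->
  forall s z U : R, 0 <= s <= B -> 0 <= z <= 1 -> 0 <= U <= 1 ->
  ratio_le K E (s * q) z (r.+1 + k) U ->
  ratio_ge K E (s * q) z r (expR (- ((1 - z) * s ^+ k * U ^+ k + e))).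
Proof.
move=> B1 e0; have B0 : 0 < B by apply: lt_le_trans B1.
(* The factor [1 + s * q] costs [B * d * B ^+ k] on the main term, and at most doubles the overlap
   error [2 ^ r * (d * B ^+ k)] because [s * q <= 1]. *)
pose c := B ^+ k * (B + 2 * (2 ^ r)%:R).
have c0 : 0 < c by rewrite mulr_gt0 ?exprn_gt0 // addr_gt0 // mulr_gt0 // ltr0n expn_gt0.
exists (Num.min B^-1 (e / c)); first by rewrite lt_min invr_gt0 B0 divr_gt0.
move=> T K E q Hu Hs s z U /andP[s0 sB] /andP[z0 z1] /andP[U0 U1] rU.
have [q0 qd deg cod lnk] := Hs; set d := Num.min _ _ in Hs qd cod lnk.
have dB : d <= B^-1 by rewrite /d ge_min lexx.
have dc : d * c <= e by rewrite -ler_pdivlMr // /d ge_min lexx orbT.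
have d0 : 0 <= d by apply: le_trans qd; apply: ltW.
have lB : s * q <= B * d by apply: ler_pM => //; apply: ltW.
have l0 : 0 <= s * q by rewrite mulr_ge0 // ltW.
have l1 : s * q <= 1 by apply: le_trans lB _; rewrite mulrC -ler_pdivlMr // mul1r.
have Uk : 0 <= U ^+ k <= 1 by rewrite exprn_ge0 // exprn_ile1.
have p0 := p_ge0 l0.
have pl : s * q / (1 + s * q) <= s * q.
  by rewrite ler_pdivrMr ?ltr_pwDl // mulrDr mulr1 lerDl mulr_ge0.
have Bk : 0 <= B ^+ k by rewrite exprn_ge0 // ltW.
apply: (@ratio_ge_ler _ _ _ _ _ (expR (- ((1 + s * q) *
   ((1 - z) * q ^- k * (s * q / (1 + s * q)) ^+ k * U ^+ k + (2 ^ r)%:R * (d * B ^+ k))))));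
  rewrite ?ler_expR ?lerN2 //; last first.
  apply: (@ratio_ge_step R T K E k (s * q) z _ _ _ _ _ _ r U) => //.
  - by move=> ? /Hu[].
  - by move=> ? /Hu[].
  - exact: ltnW.
  - move=> v vK; by rewrite -[leRHS]mul1r ler_pdivlMr ?exprn_gt0 // (deg v vK).
  - move=> D v DK Dr vK vD; apply: (partial_overlap_sum Hu Hs) => //.
      by apply: le_trans pl _; rewrite ler_wpM2r // ltW.
set A := (1 - z) * _ * U ^+ k.
have sk : s ^+ k <= B ^+ k by apply: lerXn2r; rewrite ?nnegrE ?(ltW B0).
have AB : A <= B ^+ k.
  rewrite /A -[leRHS]mulr1; apply: ler_pM; rewrite ?mulr_ge0 ?exprn_ge0 ?subr_ge0 //.
    rewrite -[leRHS]mul1r; apply: ler_pM; rewrite ?exprn_ge0 ?subr_ge0 //.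
    by rewrite lerBlDr lerDl.
  by case/andP: Uk.
have A0 : 0 <= A by rewrite /A !mulr_ge0 ?exprn_ge0 ?subr_ge0.
apply: (@le_trans _ _ ((1 + s * q) * (A + (2 ^ r)%:R * (d * B ^+ k)))).
  rewrite ler_wpM2l ?addr_ge0 // lerD2r /A ler_wpM2r //; first by case/andP: Uk.
  rewrite -mulrA ler_wpM2l ?subr_ge0 // mulrC ler_pdivrMr ?exprn_gt0 // -exprMn.
  by apply: lerXn2r; rewrite ?nnegrE.
apply: (@le_trans _ _ (A + d * c)); last by rewrite lerD2l.
have h2 : 0 <= (2 ^ r)%:R * (d * B ^+ k) by rewrite !mulr_ge0.
have : s * q * A <= B * d * B ^+ k by apply: ler_pM.
have : s * q * ((2 ^ r)%:R * (d * B ^+ k)) <= 1 * ((2 ^ r)%:R * (d * B ^+ k)) by rewrite ler_wpM2r.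
move=> h3 h4; have -> : d * c = B * d * B ^+ k + 2 * ((2 ^ r)%:R * (d * B ^+ k)).
  by rewrite /c; ring.
rewrite mulrDl mul1r mulrDr; move: h2 h3 h4.
set x := (2 ^ r)%:R * (d * B ^+ k); rewrite mul1r.
move: (s * q * x) (s * q * A) (B * d * B ^+ k) => u w y; lra.
Qed.

Lemma scaled_ratio_le B r e : 1 <= B -> 0 < e -> exists2 d, 0 < d &
  forall T (K : {set T}) (E : {set {set T}}) q, uniform K E k -> sparse K E k q d ->
  forall s z L : R, 0 <= s <= B -> 0 <= z <= 1 -> 0 <= L <= 1 ->
  ratio_ge K E (s * q) z (r.+1 + k) L ->
  ratio_le K E (s * q) z r (expR (- ((1 - z) * s ^+ k * L ^+ k - e))).
Proof.
move=> B1 e0; have B0 : 0 < B by apply: lt_le_trans B1.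
have t0 : 0 < (2 ^ r)%:R :> R by rewrite ltr0n expn_gt0.
(* Three losses, in units of [d]: [B] from [1 + l <= expR l], [2 ^ r * 4] from the unclean
   hyperedges, and [k * B] from [(1 + l) ^- k >= 1 - k * l]; the last two multiply a main term of at
   most [B ^+ k]. *)
pose c := B + B ^+ k * ((2 ^ r)%:R * 4 + k%:R * B).
have c0 : 0 < c.
  by rewrite addr_gt0 // mulr_gt0 ?exprn_gt0 // addr_gt0 // mulr_gt0 ?ltr0n // (ltn_trans _ k_gt1).
exists (Num.min 1 (Num.min ((2 ^ r)%:R * 4)^-1 (e / c))).
  by rewrite !lt_min ltr01 invr_gt0 mulr_gt0 // divr_gt0.
move=> T K E q Hu Hs s z L /andP[s0 sB] /andP[z0 z1] /andP[L0 L1] rL.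
have [q0 qd deg cod lnk] := Hs; set d := Num.min _ _ in Hs qd cod lnk.
have d1 : d <= 1 by rewrite /d ge_min lexx.
have dB : d <= ((2 ^ r)%:R * 4)^-1 by rewrite /d !ge_min lexx orbT.
have dc : d * c <= e by rewrite -ler_pdivlMr // /d !ge_min lexx !orbT.
have d0 : 0 <= d by apply: le_trans qd; apply: ltW.
have lB : s * q <= B * d by apply: ler_pM => //; apply: ltW.
have l0 : 0 <= s * q by rewrite mulr_ge0 // ltW.
have Lk : 0 <= L ^+ k <= 1 by rewrite exprn_ge0 // exprn_ile1.
pose be := (2 ^ r)%:R * (4 * d).
have be0 : 0 <= be by rewrite !mulr_ge0.
have be1 : be <= 1 by rewrite /be mulrA mulrC -ler_pdivlMr ?mulr_gt0 // mul1r.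
have qk : 0 < q ^+ k by rewrite exprn_gt0.
apply: (@ratio_le_ler _ _ _ _ _ ((1 + s * q) *
  expR (- ((1 - z) * (q ^- k - be / q ^+ k) * (s * q / (1 + s * q)) ^+ k * L ^+ k)))) => //;
  last first.
  apply: (@ratio_le_step R T K E k (s * q) z _ _ _ _ _ r L) => //.
  - by move=> ? /Hu[].
  - by move=> ? /Hu[].
  - by move=> v vK; rewrite -[leLHS]mul1r ler_pdivrMr // (deg v vK).
  - move=> D v DK Dr vK vD; rewrite ler_pdivlMr //.
    exact: (unclean_count Hu Hs).
apply: (@le_trans _ _ (expR (s * q) * 
  expR (- ((1 - z) * (q ^- k - be / q ^+ k) * (s * q / (1 + s * q)) ^+ k * L ^+ k)))).
  by rewrite ler_wpM2r ?expR_ge0 ?expR_ge1Dx.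
rewrite -expRD ler_expR.
have -> : (1 - z) * (q ^- k - be / q ^+ k) * (s * q / (1 + s * q)) ^+ k * L ^+ k =
   ((1 - z) * s ^+ k * L ^+ k) * ((1 - be) * (1 + s * q) ^- k).
  rewrite expr_div_n exprMn; field; rewrite ?gt_eqF //.
  by rewrite exprn_gt0 // ltr_pwDl.
set A := (1 - z) * _ * _.
have sk : s ^+ k <= B ^+ k by apply: lerXn2r; rewrite ?nnegrE ?(ltW B0).
have AB : A <= B ^+ k.
  rewrite /A -[leRHS]mulr1; apply: ler_pM; rewrite ?mulr_ge0 ?exprn_ge0 ?subr_ge0 //.
    rewrite -[leRHS]mul1r; apply: ler_pM; rewrite ?exprn_ge0 ?subr_ge0 //.
    by rewrite lerBlDr lerDl.
  by case/andP: Lk.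
have A0 : 0 <= A by rewrite /A !mulr_ge0 ?exprn_ge0 ?subr_ge0.
have lk : 1 - k%:R * (s * q) <= (1 + s * q) ^- k.
  apply: (@le_trans _ _ (expR (- (k%:R * (s * q))))); first exact: expR_ge1Dx.
  rewrite expRN lef_pV2 ?posrE ?exprn_gt0 ?expR_gt0 ?ltr_pwDl //.
  rewrite expRM_natl; apply: lerXn2r; rewrite ?nnegrE ?addr_ge0 ?expR_ge0 //.
  exact: expR_ge1Dx.
have key : 1 - be - k%:R * (s * q) <= (1 - be) * (1 + s * q) ^- k.
  apply: (@le_trans _ _ ((1 - be) * (1 - k%:R * (s * q)))); last first.
    by rewrite ler_wpM2l // subr_ge0.
  have : 0 <= be * (k%:R * (s * q)) by rewrite !mulr_ge0 // ltW.
  move: (k%:R * (s * q)) => w; nra.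
have h1 : A * (1 - be - k%:R * (s * q)) <= A * ((1 - be) * (1 + s * q) ^- k) by rewrite ler_wpM2l.
have h2 : A * (be + k%:R * (s * q)) <= B ^+ k * (be + k%:R * (B * d)).
  have w0 : 0 <= k%:R * (s * q) by rewrite mulr_ge0.
  by apply: ler_pM => //; rewrite ?lerD2l ?ler_wpM2l // addr_ge0.
have h3 : d * c = B * d + B ^+ k * (be + k%:R * (B * d)) by rewrite /c /be; ring.
move: h1 h2; rewrite h3 in dc; lra.
Qed.

End ScaledSteps.

(** * Convergence of the pinning ratios *)

Section PointwiseDerivatives.
Variable R : realType.
Implicit Types (f g : R -> R) (x a b : R).

(** The rules below are stated for functions in applied form, so that the derivative of a formula is
    a single term following its syntax, brought into the desired shape by this lemma. *)
Lemma isder_eq f x a b : is_derive x 1 f a -> a = b -> is_derive x 1 f b.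
Proof. by move=> + <-. Qed.

Lemma isder_id x : is_derive x 1 (fun y : R => y) 1.
Proof. exact: is_derive_id. Qed.

Lemma isder_cst x a : is_derive x 1 (fun _ : R => a) 0.
Proof. exact: is_derive_cst. Qed.

Lemma isder_add f g x a b : is_derive x 1 f a -> is_derive x 1 g b ->
  is_derive x 1 (fun y => f y + g y) (a + b).
Proof. by move=> df dg; exact: is_deriveD. Qed.

Lemma isder_mul f g x a b : is_derive x 1 f a -> is_derive x 1 g b ->
  is_derive x 1 (fun y => f y * g y) (a * g x + f x * b).
Proof.
move=> df dg; rewrite addrC; apply: isder_eq (is_deriveM df dg) _.
by rewrite [g x *: a]mulrC.
Qed.

Lemma isder_scale f x a c : is_derive x 1 f a -> is_derive x 1 (fun y => c * f y) (c * a).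
Proof. by move=> df; apply: isder_eq (isder_mul (isder_cst x c) df) _; rewrite mul0r add0r. Qed.

Lemma isder_sub f g x a b : is_derive x 1 f a -> is_derive x 1 g b ->
  is_derive x 1 (fun y => f y - g y) (a - b).
Proof. by move=> df dg; exact: is_deriveB. Qed.

Lemma isder_pow f x a n : is_derive x 1 f a ->
  is_derive x 1 (fun y => f y ^+ n) (n%:R * f x ^+ n.-1 * a).
Proof.
move=> df; elim: n => [|n IH].
  by rewrite 2!mul0r; under eq_fun do rewrite expr0; exact: isder_cst.
under eq_fun do rewrite exprS; apply: isder_eq (isder_mul df IH) _.
case: n {IH} => [|n] /=; rewrite ?expr0 ?exprS -?[n.+2]addn1 -?[n.+1]addn1 ?natrD; ring.
Qed.

Lemma isder_exp f x a : is_derive x 1 f a ->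
  is_derive x 1 (fun y => expR (f y)) (expR (f x) * a).
Proof. by move=> df; exact: is_derive1_comp. Qed.

Lemma isder_ln f x a : 0 < f x -> is_derive x 1 f a ->
  is_derive x 1 (fun y => ln (f y)) (a / f x).
Proof.
move=> f0 df; rewrite mulrC.
exact: (@is_derive1_comp _ _ _ _ _ _ (is_derive1_ln f0) df).
Qed.

Lemma isder_sum (I : Type) (r : seq I) (P : pred I) (F : I -> R -> R) x (d : I -> R) :
  (forall i, P i -> is_derive x 1 (F i) (d i)) ->
  is_derive x 1 (fun y => \sum_(i <- r | P i) F i y) (\sum_(i <- r | P i) d i).
Proof.
move=> H; elim: r => [|i r IH].
  by under eq_fun do rewrite big_nil; rewrite big_nil; exact: isder_cst.
under eq_fun do rewrite big_cons; rewrite big_cons.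
by case: ifP => // /H Hi; exact: isder_add.
Qed.

Lemma derive_continuous_within f a b (df : R -> R) : (forall x, a <= x <= b -> is_derive x 1 f (df x)) ->
  {within `[a, b], continuous f}%classic.
Proof.
move=> H; apply: derivable_within_continuous => x; rewrite in_itv /= => xab.
by have [] := H x xab.
Qed.

Lemma mean_value f (df : R -> R) a b : a <= b ->
  (forall x, a <= x <= b -> is_derive x 1 f (df x)) ->
  exists2 c, a <= c <= b & f b - f a = df c * (b - a).
Proof.
move=> ab H; have [|c cab e] := @MVT_segment R f df a b ab _ (derive_continuous_within H).
  by move=> x; rewrite in_itv /= => /andP[ax xb]; apply: H; rewrite !ltW.
by exists c => //; move: cab; rewrite in_itv.
Qed.
End PointwiseDerivatives.

Lemma exists_exprn_le (R : realType) (a C e : R) : 0 <= a -> a < 1 -> 0 <= C -> 0 < e ->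
  exists n, a ^+ n * C <= e.
Proof.
move=> a0 a1 C0 e0; have C1 : 0 < C + 1 by rewrite ltr_wpDl.
have na : `|a| < 1 by rewrite ger0_norm.
have [N _ HN] := cvgr0_norm_le _ (cvg_expr na) _ (divr_gt0 e0 C1).
exists N; have := HN N (leqnn N); rewrite /= ger0_norm ?exprn_ge0 // ler_pdivlMr // => h.
by apply: le_trans h; rewrite ler_wpM2l ?exprn_ge0 // lerDl.
Qed.

(** With [t = w * expR d], the derivative in [d] of [1 - expR (- (w * (expR d - 1)))] is
    [expR w * (t * expR (- t))], and [t * expR (- t) <= expR (- 1)]. The resulting linear bound
    holds for every [d >= 0], not just near 0, which is what allows the iteration to start from the
    trivial ratio bound. *)
Lemma two_step_contraction (R : realType) (w d : R) : 0 <= w -> 0 <= d ->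
  w * (1 - expR (- (w * (expR d - 1)))) <= w * expR (w - 1) * d.
Proof.
move=> w0 d0.
pose F (y : R) := expR (w - 1) * y + expR (- 1 * (w * (expR y - 1))).
pose dF (y : R) := expR (w - 1) - w * expR y * expR (- (w * (expR y - 1))).
have FD y : 0 <= y <= d -> is_derive y 1 F (dF y).
  move=> _; apply: isder_eq (isder_add (isder_scale _ (isder_id y))
    (isder_exp (isder_scale _ (isder_scale _ (isder_sub (isder_exp (isder_id y)) (isder_cst y _)))))) _.
  by rewrite /dF mulN1r; ring.
have [y _ Fy] := mean_value d0 FD.
have dF0 : 0 <= dF y.
  rewrite /dF subr_ge0 (_ : - (w * (expR y - 1)) = w - w * expR y); last by ring.
  have := expR_ge1Dx (w * expR y - 1); rewrite subrKC.
  set t := w * expR y => ht; rewrite !expRD mulrCA ler_wpM2l ?expR_ge0 //.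
  rewrite [expR (- t)]expRN ler_pdivrMr ?expR_gt0 // -expRD addrC; exact: ht.
have : 0 <= F d - F 0 by rewrite Fy mulr_ge0 // subr0.
rewrite /F expR0 subrr !mulr0 expR0 add0r !mulN1r => h.
rewrite -mulrA ler_wpM2l //; lra.
Qed.

Section RatioLimit.
Variables (R : realType) (k : nat).
Hypothesis k_gt1 : (1 < k)%N.
Implicit Types (T : finType).

(* [fug z x] is the intensity [c] whose density fixed point
   [x exp ((1 - z) x ^ k) = c] is [x], so that [x = x_star (c, 1 - z)]. *)
Definition fug (z x : R) : R := x * expR ((1 - z) * x ^+ k).

Lemma fug_ge0 z x : 0 <= x -> 0 <= fug z x.
Proof. by move=> x0; rewrite mulr_ge0 ?expR_ge0. Qed.

Lemma fug_gt0 z x : 0 < x -> 0 < fug z x.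
Proof. by move=> x0; rewrite mulr_gt0 ?expR_gt0. Qed.

Lemma fug_le z x y : z <= 1 -> 0 <= x -> x <= y -> fug z x <= fug z y.
Proof.
move=> z1 x0 xy; apply: ler_pM => //; rewrite ?expR_ge0 // ler_expR.
rewrite ler_wpM2l ?subr_ge0 //; apply: lerXn2r; rewrite ?nnegrE //.
exact: le_trans xy.
Qed.

Section Iteration.
Variables (z X : R).
Hypotheses (z0 : 0 <= z) (z1 : z <= 1) (X0 : 0 <= X) (HX : k%:R * (1 - z) * X ^+ k < 1).

Let y0 (x : R) := (1 - z) * x ^+ k.
Let W := k%:R * (1 - z) * X ^+ k.

(** Here [eta] is the error in the exponent. All [r] are quantified because each step uses a larger
    [r], and all [x] in [[0, X]] because the ratios are later integrated over [x]. *)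
Definition ratio_le_upto (eta : R) := forall r, exists2 d, 0 < d &
  forall T (K : {set T}) (E : {set {set T}}) q, uniform K E k -> sparse K E k q d ->
  forall x, 0 <= x <= X -> ratio_le K E (fug z x * q) z r (expR (- (y0 x - eta))).

Let y0_ge0 x : 0 <= x -> 0 <= y0 x.
Proof. by move=> x0; rewrite mulr_ge0 ?exprn_ge0 ?subr_ge0. Qed.

Let y0_le x : 0 <= x <= X -> y0 x <= y0 X.
Proof.
move=> /andP[x0 xX]; rewrite ler_wpM2l ?subr_ge0 //; apply: lerXn2r; rewrite ?nnegrE //.
Qed.

Let W0 : 0 <= W.
Proof. by rewrite !mulr_ge0 ?exprn_ge0 ?subr_ge0. Qed.

Let B := Num.max 1 (fug z X).

Let fugB x : 0 <= x <= X -> 0 <= fug z x <= B.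
Proof.
by move=> /andP[x0 xX]; rewrite fug_ge0 //= le_max; apply/orP; right; apply: fug_le.
Qed.

Let fix_eq x : (1 - z) * fug z x ^+ k = y0 x * expR (k%:R * y0 x).
Proof. by rewrite /fug exprMn expRM_natl mulrA. Qed.

(* With [u = 0] or [u = y0 x - eta], the larger one, this is one round trip through the two
   one-step bounds; [two_step_contraction] turns the error [eta] into [W exp (W - 1) eta]. *)
Lemma ratio_le_upto_step eta e : 0 <= eta -> 0 < e -> ratio_le_upto eta ->
  ratio_le_upto (W * expR (W - 1) * eta + (k%:R * (y0 X * expR W) + 1) * e).
Proof.
move=> eta0 e0 Q r.
have B1 : 1 <= B by rewrite le_max lexx.
have [d1 d10 H1] := scaled_ratio_le k_gt1 r B1 e0.
have [d2 d20 H2] := scaled_ratio_ge k_gt1 (r.+1 + k) B1 e0.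
have [d3 d30 H3] := Q ((r.+1 + k).+1 + k)%N.
exists (Num.min d1 (Num.min d2 d3)); first by rewrite !lt_min d10 d20 d30.
move=> T K E q Hu Hs x xX; have [x0 xX'] := andP xX.
have Hs1 : sparse K E k q d1 by apply: sparse_le Hs; rewrite ge_min lexx.
have Hs2 : sparse K E k q d2 by apply: sparse_le Hs; rewrite !ge_min lexx orbT.
have Hs3 : sparse K E k q d3 by apply: sparse_le Hs; rewrite !ge_min lexx !orbT.
have q0 : 0 < q by case: Hs.
have l0 : 0 <= fug z x * q by rewrite mulr_ge0 ?fug_ge0 // ltW.
have z01 : 0 <= z <= 1 by rewrite z0.
pose u := Num.max 0 (y0 x - eta).
have u0 : 0 <= u by rewrite le_max lexx.
have uy : u <= y0 x by rewrite /u ge_max y0_ge0 // gerBl.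
have ueta : y0 x - u <= eta by rewrite lerBlDl -lerBlDr /u le_max lexx orbT.
have rU : ratio_le K E (fug z x * q) z ((r.+1 + k).+1 + k) (expR (- u)).
  rewrite /u /Num.max; case: ifP => _; first exact: H3.
  by rewrite oppr0 expR0; apply: ratio_le1.
have U01 : 0 <= expR (- u) <= 1 by rewrite expR_ge0 expR_le1 oppr_le0.
have rL := H2 _ _ _ _ Hu Hs2 _ _ _ (fugB xX) z01 U01 rU.
set v := (1 - z) * _ * _ + e in rL.
have g0 : 0 <= (1 - z) * fug z x ^+ k by rewrite mulr_ge0 ?exprn_ge0 ?subr_ge0 ?fug_ge0.
have v0 : 0 <= v by rewrite addr_ge0 ?mulr_ge0 ?exprn_ge0 ?expR_ge0 ?subr_ge0 ?fug_ge0 // ltW.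
have L01 : 0 <= expR (- v) <= 1 by rewrite expR_ge0 expR_le1 oppr_le0.
apply: ratio_le_ler (H1 _ _ _ _ Hu Hs1 _ _ _ (fugB xX) z01 L01 rL) => //.
rewrite ler_expR lerN2.
pose w := k%:R * y0 x.
have w0 : 0 <= w by rewrite mulr_ge0 ?y0_ge0.
have wW : w <= W by rewrite /W -mulrA ler_wpM2l ?y0_le.
have w1 : w < 1 by apply: le_lt_trans wW HX.
have k0 : 0 < k%:R :> R by rewrite ltr0n (ltn_trans _ k_gt1).
pose D := k%:R * (y0 x - u).
have D0 : 0 <= D by rewrite mulr_ge0 // subr_ge0.
have vE : v = y0 x * expR D + e.
  rewrite /v fix_eq -expRM_natl -mulrA -expRD; congr (_ * expR _ + _).
  by rewrite /D; ring.
have gL : (1 - z) * fug z x ^+ k * expR (- v) ^+ k =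
    y0 x * expR (- (w * (expR D - 1))) * expR (- (k%:R * e)).
  rewrite fix_eq -expRM_natl vE -!mulrA -!expRD; congr (_ * (_ * expR _)).
  by rewrite /w /y0; ring.
rewrite gL.
have h1 : 1 - k%:R * e <= expR (- (k%:R * e)) by exact: expR_ge1Dx.
have h2 := two_step_contraction w0 D0.
set P := expR (- (w * (expR D - 1))) in h2 *.
have P0 : 0 <= P by apply: expR_ge0.
have P1 : P <= 1.
  rewrite /P expR_le1 oppr_le0 mulr_ge0 // subr_ge0 -[leLHS]expR0 ler_expR //.
have h3 : y0 x * P * (1 - k%:R * e) <= y0 x * P * expR (- (k%:R * e)).
  by rewrite ler_wpM2l // mulr_ge0 ?y0_ge0.
have h4 : y0 x - y0 x * P <= W * expR (W - 1) * eta.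
  rewrite -(ler_pM2l k0) (_ : k%:R * (_ - _) = w * (1 - P)); last by rewrite /w; ring.
  apply: le_trans h2 _; rewrite [leRHS]mulrCA; apply: ler_pM.
  - by rewrite mulr_ge0 ?expR_ge0.
  - exact: D0.
  - by apply: ler_pM; rewrite ?expR_ge0 // ler_expR lerD2r.
  - by rewrite /D ler_wpM2l // ltW.
have h5 : y0 x * P * (k%:R * e) <= k%:R * (y0 X * expR W) * e.
  rewrite [leRHS](_ : _ = y0 X * expR W * (k%:R * e)); last by ring.
  rewrite ler_wpM2r ?mulr_ge0 ?(ltW e0) //; apply: ler_pM; rewrite ?y0_ge0 ?y0_le //.
  by apply: le_trans P1 _; rewrite -[leLHS]expR0 ler_expR.
rewrite mulrDl mul1r; move: h3 h4 h5; rewrite mulrBr mulr1.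
lra.
Qed.

(** The trivial ratio bound 1 has error at most [y0 X]. Each round trip multiplies the error by
    [ka = W * expR (W - 1)], which is below 1 because [W < 1]. *)
Lemma ratio_le_upto_all e : 0 < e -> ratio_le_upto e.
Proof.
move=> e0; pose ka := W * expR (W - 1).
have ka0 : 0 <= ka by rewrite mulr_ge0 ?expR_ge0.
have ka1 : ka < 1.
  have -> : 1 = expR (- (1 - W)) * expR (1 - W) :> R by rewrite -expRD addNr expR0.
  rewrite /ka mulrC -opprB ltr_pM2l ?expR_gt0 //.
  apply: (@lt_le_trans _ _ 1); first exact: HX.
  by rewrite -[leLHS]expR0 ler_expR subr_ge0 ltW.
pose Cc := k%:R * (y0 X * expR W) + 1.
have yX0 := y0_ge0 X0.
have C0 : 0 < Cc by rewrite ltr_wpDl // mulr_ge0 // mulr_ge0 // expR_ge0.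
have ka'0 : 0 < 1 - ka by rewrite subr_gt0.
(* With this choice one step adds exactly [(1 - ka) * (e / 2)], so the error
   [ka ^+ n * y0 X + e / 2] keeps its second summand while the first decays. *)
pose e1 := e / 2 * (1 - ka) / Cc.
have e10 : 0 < e1 by rewrite !divr_gt0 // mulr_gt0 // divr_gt0.
have He1 : Cc * e1 = (1 - ka) * (e / 2).
  by rewrite /e1 mulrC divfK ?gt_eqF // mulrC.
have iter n : ratio_le_upto (ka ^+ n * y0 X + e / 2).
  elim: n => [|n IH].
    move=> r; exists 1 => // T K E q Hu [q0 _ _ _ _] x xX; have [x0 _] := andP xX.
    apply: ratio_le_ler (@ratio_le1 _ _ K E _ z r _ z0 z1) => //.
    - by rewrite mulr_ge0 ?fug_ge0 // ltW.
    - rewrite -[leLHS]expR0 ler_expR oppr_ge0 expr0 mul1r subr_le0.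
      by apply: le_trans (y0_le xX) _; rewrite lerDl divr_ge0 // ltW.
    - by rewrite mulr_ge0 ?fug_ge0 // ltW.
  have := ratio_le_upto_step _ e10 IH; rewrite -/Cc He1 -/ka.
  rewrite (_ : ka * _ + _ = ka ^+ n.+1 * y0 X + e / 2); last by rewrite exprS; ring.
  by apply; rewrite addr_ge0 ?divr_ge0 ?(ltW e0) // mulr_ge0 // exprn_ge0.
have [n Hn] : exists n, ka ^+ n * y0 X <= e / 2.
  by apply: exists_exprn_le => //; rewrite ?y0_ge0 // divr_gt0.
move=> r; have [d d0 H] := iter n r; exists d => // T K E q Hu Hs x xX.
have [x0 _] := andP xX.
apply: ratio_le_ler (H T K E q Hu Hs x xX) => //.
  by case: Hs => q0 _ _ _ _; rewrite mulr_ge0 ?fug_ge0 // ltW.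
by rewrite ler_expR lerN2 lerD2l lerN2; lra.
Qed.

(** The lower bound needs one more step, from the upper bound at [r = 1 + k] with nothing pinned.
    Its side condition is then trivial: a hyperedge has more than one vertex, so [v] alone completes
    none. *)
Lemma ratio_limit e : 0 < e -> exists2 d, 0 < d &
  forall T (K : {set T}) (E : {set {set T}}) q, uniform K E k -> sparse K E k q d ->
  forall x v, 0 <= x <= X -> v \in K ->
  expR (- ((1 - z) * x ^+ k) - e) * Zf K (fug z x * q) z set0 E <=
    Zf K (fug z x * q) z [set v] E <=
  expR (- ((1 - z) * x ^+ k) + e) * Zf K (fug z x * q) z set0 E.
Proof.
move=> e0.
(* The lower step inflates [y0 x] by at most [expR (k%:R * e1) <= 1 + 2 * (k%:R * e1)], valid as
   [k%:R * e1 <= 2^-1], and adds a further error [e1]. *)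
pose Cc := 2 * (k%:R * y0 X) + 1.
have yX0 := y0_ge0 X0.
have C0 : 0 < Cc by rewrite ltr_wpDl // mulr_ge0 // mulr_ge0.
have k0 : 0 < k%:R :> R by rewrite ltr0n (ltn_trans _ k_gt1).
pose e1 := Num.min ((2 * k%:R)^-1) (e / Cc).
have e10 : 0 < e1 by rewrite lt_min invr_gt0 mulr_gt0 // divr_gt0.
have e1k : k%:R * e1 <= 2^-1.
  have : e1 <= (2 * k%:R)^-1 by rewrite /e1 ge_min lexx.
  by rewrite invfM -ler_pdivrMr ?invr_gt0 // invrK mulrC.
have e1e : e1 * Cc <= e by rewrite -ler_pdivlMr // /e1 ge_min lexx orbT.
have e1le : e1 <= e.
  apply: le_trans e1e; rewrite ler_peMr ?(ltW e10) // lerDr mulr_ge0 // mulr_ge0 //.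
have B1 : 1 <= B by rewrite le_max lexx.
have [d1 d10 H1] := scaled_ratio_ge k_gt1 0 B1 e10.
have [d2 d20 H2] := ratio_le_upto_all e10 (1 + k)%N.
exists (Num.min d1 d2); first by rewrite lt_min d10.
move=> T K E q Hu Hs x v xX vK; have [x0 xX'] := andP xX.
have Hs1 : sparse K E k q d1 by apply: sparse_le Hs; rewrite ge_min lexx.
have Hs2 : sparse K E k q d2 by apply: sparse_le Hs; rewrite !ge_min lexx orbT.
have q0 : 0 < q by case: Hs.
have l0 : 0 <= fug z x * q by rewrite mulr_ge0 ?fug_ge0 // ltW.
have z01 : 0 <= z <= 1 by rewrite z0.
have adm r : admissible K E r set0 set0 E by split; rewrite ?sub0set ?cards0.
have v0 : v \notin set0 by rewrite inE.
have rU := H2 _ _ _ _ Hu Hs2 _ xX.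
have ZU := rU _ _ _ _ (adm _) vK v0.
rewrite setU0 in ZU.
apply/andP; split; last first.
  apply: le_trans ZU _; rewrite ler_wpM2r ?Zf_ge0 // ler_expR opprB addrC lerD2l.
  exact: e1le.
pose u := Num.max 0 (y0 x - e1).
have u0 : 0 <= u by rewrite le_max lexx.
have ueta : y0 x - u <= e1 by rewrite lerBlDl -lerBlDr /u le_max lexx orbT.
have rU' : ratio_le K E (fug z x * q) z (1 + k) (expR (- u)).
  rewrite /u /Num.max; case: ifP => _; first exact: rU.
  by rewrite oppr0 expR0; apply: ratio_le1.
have U01 : 0 <= expR (- u) <= 1 by rewrite expR_ge0 expR_le1 oppr_le0.
have rL := H1 _ _ _ _ Hu Hs1 _ _ _ (fugB xX) z01 U01 rU'.
have := rL _ _ _ _ (adm _) vK v0; rewrite setU0 => ZL.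
apply: (le_trans _ (ZL _)); last first.
  move=> e' e'E ve'; apply/negP => /subset_leq_card; rewrite cards1.
  by have [_ ->] := Hu _ e'E; rewrite ltnS leqNgt (ltn_trans _ k_gt1).
rewrite ler_wpM2r ?Zf_ge0 // ler_expR -opprD lerN2.
rewrite fix_eq -expRM_natl -mulrA -expRD.
rewrite [expR (_ + _)](_ : _ = expR (k%:R * (y0 x - u))); last by congr expR; ring.
have h1 : expR (k%:R * (y0 x - u)) <= 1 + 2 * (k%:R * e1).
  apply: (@le_trans _ _ (expR (k%:R * e1))); first by rewrite ler_expR ler_wpM2l // ltW.
  have t0 : 0 <= k%:R * e1 by rewrite mulr_ge0 // ltW.
  set t := k%:R * e1 in e1k t0 *; have E0 := expR_gt0 t.
  have := expR_ge1Dx (- t); rewrite expRN -[_^-1]mul1r ler_pdivlMr // => h.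
  have h' : (1 - t) * expR t <= (1 - t) * (1 + 2 * t) by apply: le_trans h _; nra.
  by rewrite ler_pM2l // in h'; lra.
have h2 : y0 x * expR (k%:R * (y0 x - u)) <= y0 x * (1 + 2 * (k%:R * e1)).
  by rewrite ler_wpM2l // y0_ge0.
have h3 : y0 x * (2 * (k%:R * e1)) <= y0 X * (2 * (k%:R * e1)).
  by rewrite ler_wpM2r ?y0_le // !mulr_ge0 // ltW.
move: e1e h2 h3; rewrite /Cc mulrDr mulr1 [y0 x * (1 + _)]mulrDr mulr1.
rewrite (_ : e1 * (2 * (k%:R * y0 X)) = y0 X * (2 * (k%:R * e1))); last by ring.
rewrite -/(y0 x); lra.
Qed.

End Iteration.
End RatioLimit.

(** * Free energy *)

Section FreeEnergy.
Variables (R : realType) (k : nat).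
Hypothesis k_gt1 : (1 < k)%N.
Implicit Types (T : finType) (x z : R).

(** The integral from 0 to [x] of [expR (- ((1 - z) * y ^+ k))], the limiting pinning ratio, against
    the differential of [fug k z y]; by [isder_Phi] the integrand simplifies to
    [1 + k%:R * (1 - z) * y ^+ k]. *)
Definition Phi (z x : R) : R := x + (1 - z) * x ^+ k.+1 * (k%:R / k.+1%:R).

Let dfug (z x : R) := expR ((1 - z) * x ^+ k) * (1 + k%:R * (1 - z) * x ^+ k).

Lemma isder_fug z x : is_derive x 1 (fug k z) (dfug z x).
Proof.
apply: isder_eq (isder_mul (isder_id x) (isder_exp (isder_scale (1 - z) (isder_pow k (isder_id x))))) _.
rewrite /dfug; have -> : x ^+ k = x * x ^+ k.-1 by rewrite -exprS prednK // ltnW.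
by ring.
Qed.

Lemma isder_Phi z x : is_derive x 1 (Phi z) (1 + k%:R * (1 - z) * x ^+ k).
Proof.
have E : Phi z = fun y => y + (1 - z) * (k%:R / k.+1%:R) * y ^+ k.+1.
  by apply/funext => y; rewrite /Phi mulrAC.
rewrite E; apply: isder_eq (isder_add (isder_id x) (isder_scale _ (isder_pow k.+1 (isder_id x)))) _.
have : k.+1%:R != 0 :> R by rewrite pnatr_eq0.
by rewrite /= mulr1; move: (k.+1%:R) => K1 K10; field.
Qed.

Lemma isder_Zf T (K : {set T}) (E : {set {set T}}) z (l : R -> R) x a :
  is_derive x 1 l a ->
  is_derive x 1 (fun y => Zf K (l y) z set0 E)
    ((\sum_(A : {set T} | A \subset K) #|A|%:R * l x ^+ #|A|.-1 * z ^+ ncov E (A :|: set0)) * a).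
Proof.
move=> dl; rewrite mulr_suml; apply: isder_sum => A _.
apply: isder_eq (isder_mul (isder_pow _ dl) (isder_cst x _)) _.
by rewrite mulr0 addr0 mulrAC.
Qed.

(** Both [ln Zf] and [#|K|%:R * q * Phi z x] vanish at [x = 0], so by the mean value theorem it
    suffices to compare derivatives. Their difference is [q * dfug z y] times the sum over [v] of
    the errors of the pinning ratios divided by [1 + l]. *)
Lemma free_energy z X e : 0 <= z -> z <= 1 -> 0 <= X -> k%:R * (1 - z) * X ^+ k < 1 -> 0 < e ->
  exists2 d, 0 < d &
  forall T (K : {set T}) (E : {set {set T}}) q, uniform K E k -> sparse K E k q d ->
  forall x, 0 <= x <= X ->
  `|ln (Zf K (fug k z x * q) z set0 E) - #|K|%:R * q * Phi z x| <= e * (#|K|%:R * q).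
Proof.
move=> z0 z1 X0 HX e0.
pose D := dfug z X.
have y0X : 0 <= (1 - z) * X ^+ k by rewrite mulr_ge0 ?exprn_ge0 ?subr_ge0.
have D0 : 0 < D.
  by rewrite mulr_gt0 ?expR_gt0 // ltr_pwDl // -mulrA mulr_ge0.
(* [X] is the length of the interval, [D] bounds [dfug], and [e1 * (3 + fug k z X)] bounds the error
   of each vertex. *)
pose M := X * D * (3 + fug k z X) + 1.
have M0 : 0 < M.
  by rewrite ltr_wpDl // mulr_ge0 ?addr_ge0 ?fug_ge0 // mulr_ge0 // ltW.
pose e1 := Num.min 2^-1 (e / M).
have e10 : 0 < e1 by rewrite lt_min invr_gt0 ltr0n divr_gt0.
have e1h : e1 <= 2^-1 by rewrite /e1 ge_min lexx.
have e1M : e1 * M <= e by rewrite -ler_pdivlMr // /e1 ge_min lexx orbT.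
have [d d0 H] := ratio_limit k_gt1 z0 z1 X0 HX e10.
exists (Num.min d e1); first by rewrite lt_min d0.
move=> T K E q Hu Hs x xX; have [x0 xX'] := andP xX.
have Hs1 : sparse K E k q d by apply: sparse_le Hs; rewrite ge_min lexx.
have [q0 qd _ _ _] := Hs.
have qe1 : q <= e1 by apply: le_trans qd _; rewrite ge_min lexx orbT.
pose N : R := #|K|%:R.
have Zpos y : 0 <= y -> 0 < Zf K (fug k z y * q) z set0 E.
  move=> y0; apply: Zf_gt0; rewrite ?mulr_ge0 ?fug_ge0 ?(ltW q0) // => f /Hu[_ fk].
  by rewrite subset0 -cards_eq0 fk.
pose dZ y := \sum_(A : {set T} | A \subset K)
   #|A|%:R * (fug k z y * q) ^+ #|A|.-1 * z ^+ ncov E (A :|: set0).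
pose F y := ln (Zf K (fug k z y * q) z set0 E) - N * q * Phi z y.
pose dF y := dZ y * (dfug z y * q) / Zf K (fug k z y * q) z set0 E
   - N * q * (1 + k%:R * (1 - z) * y ^+ k).
have FD y : 0 <= y <= x -> is_derive y 1 F (dF y).
  move=> /andP[y0 _]; apply: isder_eq (isder_sub (isder_ln (Zpos y y0) (isder_Zf K E z
    (isder_mul (isder_fug z y) (isder_cst y q)))) (isder_scale (N * q) (isder_Phi z y))) _.
  by rewrite mulr0 addr0.
have [y /andP[y0 yx] Fy] := mean_value x0 FD.
have F0 : F 0 = 0.
  rewrite /F /Phi /fug !mul0r exprS !mul0r mulr0 mul0r addr0 mulr0 subr0 /Zf /wsum.
  rewrite (bigD1 set0) ?sub0set //= big1 ?addr0; last first.
    by move=> A /andP[_ A0]; rewrite expr0n cards_eq0 (negPf A0) mul0r.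
  rewrite cards0 !expr0 mul1r set0U /ncov (_ : finset _ = set0) ?cards0 ?expr0 ?ln1 //.
  apply/setP=> f; rewrite !inE; apply/andP=> -[/Hu[_ fk]].
  by rewrite subset0 -cards_eq0 fk.
rewrite -/N -/(F x) -[F x]subr0 -F0 Fy subr0.
have yX : 0 <= y <= X by rewrite y0 (le_trans yx).
pose l := fug k z y * q.
have l0 : 0 <= l by rewrite mulr_ge0 ?fug_ge0 // ltW.
have lX : l <= fug k z X * e1 by apply: ler_pM; rewrite ?fug_ge0 ?(ltW q0) ?fug_le //; case/andP: yX.
pose Z0 := Zf K l z set0 E.
have Z00 : 0 < Z0 by apply: Zpos.
pose E0 := expR (- ((1 - z) * y ^+ k)).
have E01 : 0 < E0 <= 1.
  by rewrite expR_gt0 expR_le1 oppr_le0 mulr_ge0 ?exprn_ge0 ?subr_ge0.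
have Hv v : v \in K -> `|Zf K l z [set v] E / ((1 + l) * Z0) - E0| <= 2 * e1 + l.
  move=> vK; have /andP[lo up] := H T K E q Hu Hs1 y v yX vK.
  have E2 : expR e1 <= 1 + 2 * e1.
    have := expR_ge1Dx (- e1); rewrite expRN -[_^-1]mul1r ler_pdivlMr ?expR_gt0 // => h.
    have h' : (1 - e1) * expR e1 <= (1 - e1) * (1 + 2 * e1) by apply: le_trans h _; nra.
    by rewrite ler_pM2l // in h'; lra.
  have E3 := expR_ge1Dx (- e1).
  move: lo up; rewrite !expRD -/E0 -/l -/Z0 -(ler_pdivlMr _ _ Z00) -(ler_pdivrMr _ _ Z00).
  rewrite invfM mulrCA; set a := Zf _ _ _ _ _ / Z0 => lo up.
  have a1 : a <= 1.
    by rewrite ler_pdivrMr // mul1r; apply: Zf_le => //; apply: sub0set.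
  have a0 : 0 <= a by rewrite divr_ge0 ?Zf_ge0 // ltW.
  have l1 : 1 - l <= (1 + l)^-1 <= 1.
    rewrite invf_le1 ?ltr_pwDl // lerDl l0 andbT -[_^-1]mul1r ler_pdivlMr ?ltr_pwDl //.
    nra.
  case/andP: E01 l1 => E0p E01 /andP[l1 l2].
  rewrite ler_norml; apply/andP; split; first by nra.
  nra.
have dFE : dF y = q * dfug z y * (\sum_(v in K) (Zf K l z [set v] E / ((1 + l) * Z0) - E0)).
  rewrite /dF -/l -/Z0 /dZ -/l sumrB -mulr_suml.
  have := @sum_card_wsum _ _ K l (fun A => z ^+ ncov E (A :|: set0)) l0.
  set S := \sum_(A : {set T} | _) _ => HS.
  have -> : \sum_(v in K) Zf K l z [set v] E = (1 + l) * S.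
    rewrite HS; apply: eq_bigr => v _; apply: eq_wsum => A _; congr (_ ^+ ncov _ _).
    by rewrite setU0 setUC.
  rewrite sumr_const -[E0 *+ _]mulr_natl -/N invfM mulrACA divff ?mul1r; last first.
    by rewrite gt_eqF // ltr_pwDl.
  rewrite [RHS]mulrBr; congr (_ - _); first by rewrite [q * _]mulrC [RHS]mulrA [S * _]mulrC.
  by rewrite /dfug /E0 expRN; field; rewrite gt_eqF ?expR_gt0.
have dfD : 0 <= dfug z y <= D.
  have yk : (1 - z) * y ^+ k <= (1 - z) * X ^+ k.
    rewrite ler_wpM2l ?subr_ge0 //; apply: lerXn2r; rewrite ?nnegrE //.
    by case/andP: yX.
  have yk0 : 0 <= (1 - z) * y ^+ k by rewrite mulr_ge0 ?exprn_ge0 ?subr_ge0.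
  have p0 : 0 <= 1 + k%:R * (1 - z) * y ^+ k by rewrite addr_ge0 // -mulrA mulr_ge0.
  rewrite mulr_ge0 ?expR_ge0 //=; apply: ler_pM; rewrite ?expR_ge0 ?ler_expR //.
  by rewrite lerD2l -!mulrA ler_wpM2l.
rewrite dFE normrM normrM normrM (ger0_norm x0) (ger0_norm (ltW q0)) ger0_norm; last by case/andP: dfD.
have sumB : `|\sum_(v in K) (Zf K l z [set v] E / ((1 + l) * Z0) - E0)| <= N * (e1 * (3 + fug k z X)).
  apply: le_trans (ler_norm_sum _ _ _) _.
  apply: le_trans (ler_sum _ (fun v vK => Hv v vK)) _.
  rewrite sumr_const -[leLHS]mulr_natl ler_wpM2l //; nra.
apply: (@le_trans _ _ (q * D * (N * (e1 * (3 + fug k z X))) * X)).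
  case/andP: dfD => df0 dfD; have q0' := ltW q0.
  have h : q * dfug z y <= q * D by rewrite ler_wpM2l.
  have h0 : 0 <= q * dfug z y by rewrite mulr_ge0.
  apply: ler_pM => //; last exact: ler_pM.
  by rewrite mulr_ge0.
rewrite (_ : _ * X = e1 * (X * D * (3 + fug k z X)) * (N * q)); last by ring.
rewrite ler_wpM2r ?mulr_ge0 ?(ltW q0) //; apply: le_trans e1M.
by rewrite ler_wpM2l ?(ltW e10) // lerDl.
Qed.

End FreeEnergy.

(** * Concentration under the tilted measures *)

Lemma isder_continuity (R : realType) (f : R -> R) (x a e : R) : is_derive x 1 f a -> 0 < e ->
  exists2 d, 0 < d & forall y, `|y - x| < d -> `|f y - f x| < e.
Proof.
move=> [df _] e0; have /differentiable_continuous cf : differentiable f x by apply/derivable1_diffP.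
have /cvgrPdist_lt/(_ _ e0)/nbhs_ballP[d /= d0 H] := cf.
exists d => // y yx; rewrite distrC; apply: H.
by rewrite /ball /= distrC.
Qed.

(** Weighted AM-GM. In the induction, the difference of the two sides at [n.+1] is [y] times the one
    at [n] plus [n.+1%:R * x ^+ n * (x - y) ^+ 2]. *)
Lemma young_exprn (R : realFieldType) (n : nat) (x y : R) : 0 <= x -> 0 <= y ->
  n.+1%:R * (y * x ^+ n) <= y ^+ n.+1 + n%:R * x ^+ n.+1.
Proof.
move=> x0 y0; elim: n => [|n IH]; first by rewrite expr0 !expr1 mul0r mulr1 mul1r addr0.
have h : 0 <= n.+1%:R * x ^+ n * (x - y) ^+ 2 by rewrite mulr_ge0 ?sqr_ge0 // mulr_ge0 ?exprn_ge0.
have h' : 0 <= y * (y ^+ n.+1 + n%:R * x ^+ n.+1 - n.+1%:R * (y * x ^+ n)).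
  by rewrite mulr_ge0 // subr_ge0.
rewrite -subr_ge0; apply: le_trans (addr_ge0 h h') _; rewrite le_eqVlt; apply/orP; left.
rewrite -[n.+2%:R]natr1 -[n.+1%:R]natr1 !exprS; apply/eqP; ring.
Qed.

Lemma ln_diff_le (R : realType) (x y : R) : 0 < x -> 0 < y -> ln x - ln y <= (x - y) / y.
Proof.
move=> x0 y0; have := expR_ge1Dx (ln (x / y)); rewrite lnK ?posrE ?divr_gt0 //.
by rewrite ln_div ?posrE // mulrBl divff ?gt_eqF //; lra.
Qed.

Lemma ln_diff_ge (R : realType) (x y : R) : 0 < x -> 0 < y -> (y - x) / y <= ln y - ln x.
Proof.
by move=> x0 y0; rewrite -[leLHS]opprK -mulNr opprB lerNl opprB ln_diff_le.
Qed.

Section Concentration.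
Variables (R : realType) (k : nat).
Hypothesis k_gt1 : (1 < k)%N.
Variables (T : nat -> finType) (K : forall n, {set T n}) (E : forall n, {set {set T n}}).
Variable q : nat -> R.
Hypothesis Hu : forall n, uniform (K n) (E n) k.
Hypothesis Hs : forall d : R, 0 < d -> \forall n \near eventually, sparse (K n) (E n) k (q n) d.

Implicit Types (x y z l w e a : R).

Let M n : R := #|K n|%:R * q n.
Hypothesis HM : forall A, \forall n \near eventually, A <= M n.

Definition wt n (l z : R) (P : pred {set T n}) : R :=
  \sum_(A : {set T n} | (A \subset K n) && P A) l ^+ #|A| * z ^+ ncov (E n) A.

Definition Zn n (l z : R) : R := Zf (K n) l z set0 (E n).

Definition subcritical (z x : R) := [/\ 0 <= z, z <= 1, 0 < x & k%:R * (1 - z) * x ^+ k < 1].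

Lemma ZnE n l z : Zn n l z = wt l z (xpredT : pred {set T n}).
Proof. by apply: eq_big => [A|A _]; rewrite ?andbT ?setU0. Qed.

Lemma q_gt0 : \forall n \near eventually, 0 < q n.
Proof. by apply: filterS (Hs ltr01) => n []. Qed.

Lemma q_small e : 0 < e -> \forall n \near eventually, q n <= e.
Proof. by move=> e0; apply: filterS (Hs e0) => n []. Qed.

Lemma free_energy_seq z x e : subcritical z x -> 0 < e ->
  \forall n \near eventually, `|ln (Zn n (fug k z x * q n) z) - M n * Phi k z x| <= e * M n.
Proof.
move=> [z0 z1 x0 Hx] e0; have [d d0 H] := free_energy k_gt1 z0 z1 (ltW x0) Hx e0.
apply: filterS (Hs d0) => n sn.
by apply: H => //; rewrite (ltW x0) lexx.
Qed.

Lemma Zn_gt0 n l z : 0 <= l -> 0 <= z -> 0 < Zn n l z.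
Proof.
move=> l0 z0; apply: Zf_gt0 => // f /Hu[_ fk].
by rewrite subset0 -cards_eq0 fk.
Qed.

Lemma wt_tilt n (l z l' z' C : R) (P : pred {set T n}) : 0 <= l' -> 0 <= z' -> 0 <= C ->
  (forall A : {set T n}, A \subset K n -> P A ->
     l ^+ #|A| * z ^+ ncov (E n) A <= C * (l' ^+ #|A| * z' ^+ ncov (E n) A)) ->
  wt l z P <= C * Zn n l' z'.
Proof.
move=> l0 z0 C0 H; rewrite ZnE /wt mulr_sumr big_mkcond [leRHS]big_mkcond /=.
apply: ler_sum => A _; rewrite andbT; case: ifP => [/andP[AK PA]|_].
  by rewrite AK; apply: H.
by case: ifP => // _; rewrite !mulr_ge0 ?exprn_ge0.
Qed.

(** Exponential change of measure: on [P] the weights at [(z, x)] are dominated by [expR (M n * a)]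
    times those at [(z', x')], so a strict gap between [a + Phi k z' x'] and [Phi k z x] makes the
    event exponentially small. The constant 1/8 lets four such events together take at most half of
    the mass. *)
Lemma tail_small z x z' x' a (P : forall n, pred {set T n}) :
  subcritical z x -> subcritical z' x' -> a + Phi k z' x' < Phi k z x ->
  (\forall n \near eventually, forall A : {set T n}, A \subset K n -> P n A ->
     (fug k z x * q n) ^+ #|A| * z ^+ ncov (E n) A <=
       expR (M n * a) * ((fug k z' x' * q n) ^+ #|A| * z' ^+ ncov (E n) A)) ->
  \forall n \near eventually, wt (fug k z x * q n) z (P n) <= 8^-1 * Zn n (fug k z x * q n) z.
Proof.
move=> sx sx' gap H; pose g := Phi k z x - (a + Phi k z' x').
have g0 : 0 < g by rewrite subr_gt0.
have g4 : 0 < g / 4 by rewrite divr_gt0.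
have [z0 z1 x0 _] := sx; have [z'0 z'1 x'0 _] := sx'.
near=> n.
have qn : 0 < q n by near: n; exact: q_gt0.
have l0 : 0 <= fug k z x * q n by rewrite mulr_ge0 ?fug_ge0 // ltW.
have l'0 : 0 <= fug k z' x' * q n by rewrite mulr_ge0 ?fug_ge0 // ltW.
apply: le_trans (wt_tilt l'0 z'0 (expR_ge0 (M n * a)) _) _.
  by near: n.
have : `|ln (Zn n (fug k z x * q n) z) - M n * Phi k z x| <= g / 4 * M n.
  by near: n; exact: free_energy_seq.
have : `|ln (Zn n (fug k z' x' * q n) z') - M n * Phi k z' x'| <= g / 4 * M n.
  by near: n; exact: free_energy_seq.
have Z0 := Zn_gt0 n l0 z0; have Z'0 := Zn_gt0 n l'0 z'0.
rewrite !ler_norml => /andP[_ h1] /andP[h2 _].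
(* The two free energy errors take [g / 4 * M n] each; what is left of the gap is
   [g / 2 * M n >= 8], and [expR (- 8) <= 8^-1]. *)
have hM : 16 / g <= M n by near: n; exact: HM.
have {}hM : 16 <= M n * g by rewrite -ler_pdivrMr.
rewrite -[Zn n _ z' in leLHS]lnK ?posrE // -[Zn n _ z in leRHS]lnK ?posrE //.
have e8 : expR (- 8) <= 8^-1 :> R.
  rewrite expRN lef_pV2 ?posrE ?expR_gt0 //; apply: le_trans (expR_ge1Dx _).
  by rewrite lerDr.
apply: (@le_trans _ _ (expR (- 8) * expR (ln (Zn n (fug k z x * q n) z)))); last first.
  by rewrite ler_wpM2r ?expR_ge0.
rewrite -!expRD ler_expR; move: h1 h2 hM; rewrite /g; lra.
Unshelve. all: end_near.
Qed.

Definition lfug (z x : R) := ln x + (1 - z) * x ^+ k.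

Lemma fugE z x : 0 < x -> fug k z x = expR (lfug z x).
Proof. by move=> x0; rewrite expRD lnK. Qed.

Lemma fug_pow_tilt z x (z' x' qn : R) (a : nat) : 0 < x -> 0 < x' ->
  (fug k z x * qn) ^+ a = expR (a%:R * (lfug z x - lfug z' x')) * (fug k z' x' * qn) ^+ a.
Proof.
move=> x0 x'0; rewrite expRM_natl -exprMn; congr (_ ^+ _).
by rewrite !fugE // mulrA -expRD subrK.
Qed.

Lemma wt_le n (l z : R) (P Q : pred {set T n}) : 0 <= l -> 0 <= z ->
  (forall A : {set T n}, A \subset K n -> P A -> Q A) -> wt l z P <= wt l z Q.
Proof.
move=> l0 z0 PQ; rewrite /wt big_mkcond [leRHS]big_mkcond /=; apply: ler_sum => A _.
case: (boolP (A \subset K n)) => //= AK; case: ifP => [/(PQ _ AK) ->//|_].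
by case: ifP => // _; rewrite mulr_ge0 ?exprn_ge0.
Qed.

Lemma wt0 n (l z : R) (P : pred {set T n}) :
  (forall A : {set T n}, A \subset K n -> ~~ P A) -> wt l z P = 0.
Proof. by move=> H; rewrite /wt big1 // => A /andP[/H/negPf ->]. Qed.

Lemma wtU n (l z : R) (P Q : pred {set T n}) : 0 <= l -> 0 <= z ->
  wt l z (predU P Q) <= wt l z P + wt l z Q.
Proof.
move=> l0 z0; rewrite /wt big_mkcond [X in _ <= X + _]big_mkcond [X in _ <= _ + X]big_mkcond /=.
rewrite -big_split /=; apply: ler_sum => A _.
have h : 0 <= l ^+ #|A| * z ^+ ncov (E n) A by rewrite mulr_ge0 ?exprn_ge0.
by case: (A \subset K n); case: (P A); case: (Q A); rewrite /= ?addr0 ?add0r ?lerDl.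
Qed.

Lemma wtC n (l z : R) (P : pred {set T n}) : Zn n l z = wt l z P + wt l z (predC P).
Proof.
rewrite ZnE /wt (bigID P) /=; congr (_ + _); apply: eq_bigl => A; by rewrite andbT.
Qed.

Lemma M_ge0 : \forall n \near eventually, 0 <= M n.
Proof. exact: HM. Qed.

(** For positive [y] the right side is [y * ((y - x) / y + (1 - z) * (y ^+ k - x ^+ k))]: the
    density [y] times the quantity that bounds the change of [lfug] in the size tails. [young_exprn]
    is what replaces the powers [k.+1] by this product. *)
Lemma Phi_sub_le z x y : z <= 1 -> 0 <= x -> 0 <= y ->
  Phi k z y - Phi k z x <= (y - x) + (1 - z) * y * (y ^+ k - x ^+ k).
Proof.
move=> z1 x0 y0; rewrite /Phi.
have k1 : 0 < k.+1%:R :> R by rewrite ltr0n.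
have h : (y ^+ k.+1 - x ^+ k.+1) * (k%:R / k.+1%:R) <= y * (y ^+ k - x ^+ k).
  rewrite mulrA ler_pdivrMr // mulrBr -exprS.
  have := young_exprn k x0 y0; rewrite -[k.+1%:R]natr1.
  move: (y ^+ k.+1) (x ^+ k.+1) (y * x ^+ k) => u v w; nra.
have := ler_wpM2l (_ : 0 <= 1 - z) h; rewrite subr_ge0 => /(_ z1).
move: (k%:R / k.+1%:R) => r; nra.
Qed.

Lemma subcritical_right z x w : subcritical z x -> 0 < w ->
  exists2 y, x < y < x + w & subcritical z y.
Proof.
move=> [z0 z1 x0 Hx] w0; have gap : 0 < 1 - k%:R * (1 - z) * x ^+ k by rewrite subr_gt0.
have [d d0 H] := isder_continuity (isder_scale (k%:R * (1 - z)) (isder_pow k (isder_id x))) gap.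
pose t := Num.min d w / 2.
have t0 : 0 < t by rewrite divr_gt0 // lt_min d0.
have tm : t < Num.min d w by rewrite ltr_pdivrMr // ltr_pMr ?ltr1n // lt_min d0.
have [td tw] : t < d /\ t < w by apply/andP; rewrite -lt_min.
exists (x + t); first by rewrite ltrDl t0 ltrD2l.
split=> //; first exact: addr_gt0.
have := H (x + t); rewrite addrAC subrr add0r gtr0_norm // => /(_ td).
rewrite ltr_norml => /andP[_]; lra.
Qed.

Lemma subcritical_le z x y : subcritical z x -> 0 < y -> y <= x -> subcritical z y.
Proof.
move=> [z0 z1 x0 Hx] y0 yx; split=> //; apply: le_lt_trans Hx.
rewrite ler_wpM2l ?mulr_ge0 ?subr_ge0 //.
by apply: lerXn2r; rewrite ?nnegrE // ltW.
Qed.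

(** Compare with the fugacity of some [y] strictly between [x] and [x + w]. The change of measure
    gains [lfug z y - lfug z x] for each of more than [(x + w) * M n] elements, whereas the free
    energy grows by at most [y] times the lower estimate of that gain. *)
Lemma size_upper_tail z x w : subcritical z x -> 0 < w ->
  \forall n \near eventually,
    wt (fug k z x * q n) z (fun A : {set T n} => (x + w) * M n < #|A|%:R)
      <= 8^-1 * Zn n (fug k z x * q n) z.
Proof.
move=> sx w0; have [y /andP[xy yw] sy] := subcritical_right sx w0.
have [z0 z1 x0 _] := sx; have [_ _ y0 _] := sy.
have lxy : lfug z x - lfug z y <= - ((y - x) / y + (1 - z) * (y ^+ k - x ^+ k)).
  have := ln_diff_ge x0 y0; rewrite /lfug; lra.
have D0 : 0 <= (1 - z) * (y ^+ k - x ^+ k).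
  rewrite mulr_ge0 ?subr_ge0 //; apply: lerXn2r; rewrite ?nnegrE ?ltW //.
have c0 : 0 < (y - x) / y by rewrite divr_gt0 ?subr_gt0.
apply: (tail_small (x' := y) (a := (x + w) * (lfug z x - lfug z y)) sx sy).
  have := Phi_sub_le z1 (ltW x0) (ltW y0).
  have xw0 : 0 < x + w by rewrite addr_gt0.
  have h1 := ler_wpM2l (ltW xw0) lxy.
  have h2 : y * ((y - x) / y) = y - x by rewrite mulrC divfK // gt_eqF.
  have : 0 < (x + w - y) * ((y - x) / y) by rewrite mulr_gt0 // subr_gt0.
  have : 0 <= (x + w - y) * ((1 - z) * (y ^+ k - x ^+ k)) by rewrite mulr_ge0 // subr_ge0 ltW.
  move: h1 h2; move: ((y - x) / y) (y ^+ k - x ^+ k) => u v; nra.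
near=> n => A AK xwA.
have qn : 0 < q n by near: n; exact: q_gt0.
rewrite (@fug_pow_tilt z x z y) // -mulrA ler_wpM2r //.
  by rewrite mulr_ge0 ?exprn_ge0 ?mulr_ge0 ?fug_ge0 // ltW.
rewrite ler_expR mulrA [M n * _]mulrC; apply: ler_wnM2r; last exact: ltW.
by apply: le_trans lxy _; rewrite oppr_le0 addr_ge0 // ltW.
Unshelve. all: end_near.
Qed.

Lemma size_lower_tail z x w : subcritical z x -> 0 < w ->
  \forall n \near eventually,
    wt (fug k z x * q n) z (fun A : {set T n} => #|A|%:R < (x - w) * M n)
      <= 8^-1 * Zn n (fug k z x * q n) z.
Proof.
move=> sx w0; have [z0 z1 x0 _] := sx.
have [xw|xw] := leP x w.
  near=> n; have qn : 0 < q n by near: n; exact: q_gt0.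
  have Mn : 0 <= M n by near: n; exact: M_ge0.
  rewrite wt0; first by rewrite mulr_ge0 // ltW // Zn_gt0 // mulr_ge0 ?fug_ge0 // ltW.
  move=> A _; rewrite -leNgt; apply: le_trans (ler0n _ _).
  by rewrite mulr_le0_ge0 // subr_le0.
have [y yx yw] : exists2 y, y < x & x - w < y by exists (x - w / 2); lra.
have y0 : 0 < y by rewrite (lt_trans _ yw) // subr_gt0.
have sy : subcritical z y by apply: subcritical_le sx _ _ => //; exact: ltW.
have lxy : lfug z x - lfug z y <= (x - y) / y + (1 - z) * (x ^+ k - y ^+ k).
  have h := ln_diff_le x0 y0.
  rewrite /lfug; lra.
have D0 : 0 <= (1 - z) * (x ^+ k - y ^+ k).
  rewrite mulr_ge0 ?subr_ge0 //; apply: lerXn2r; rewrite ?nnegrE ?ltW //.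
have c0 : 0 < (x - y) / y by rewrite divr_gt0 ?subr_gt0.
have lxy0 : 0 <= lfug z x - lfug z y.
  rewrite /lfug; have : ln y <= ln x by rewrite ler_ln ?posrE // ltW.
  lra.
apply: (tail_small (x' := y) (a := (x - w) * (lfug z x - lfug z y)) sx sy).
  have := Phi_sub_le z1 (ltW x0) (ltW y0).
  have xw0 : 0 < x - w by rewrite subr_gt0.
  have h1 := ler_wpM2l (ltW xw0) lxy.
  have h2 : y * ((x - y) / y) = x - y by rewrite mulrC divfK // gt_eqF.
  have : 0 < (y - (x - w)) * ((x - y) / y) by rewrite mulr_gt0 // subr_gt0.
  have : 0 <= (y - (x - w)) * ((1 - z) * (x ^+ k - y ^+ k)) by rewrite mulr_ge0 // subr_ge0 ltW.
  move: h1 h2; move: ((x - y) / y) (x ^+ k) (y ^+ k) => u v v'; nra.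
near=> n => A AK xwA.
have qn : 0 < q n by near: n; exact: q_gt0.
rewrite (@fug_pow_tilt z x z y) // -mulrA ler_wpM2r //.
  by rewrite mulr_ge0 ?exprn_ge0 ?mulr_ge0 ?fug_ge0 // ltW.
rewrite ler_expR mulrA [M n * _]mulrC; apply: ler_wpM2r => //; exact: ltW.
Unshelve. all: end_near.
Qed.

(** Unlike [full_window] this also covers [z = 0], where the count is zero, and [z = 1], the
    untilted measure; the fixed-size model needs both. *)
Lemma size_window z x w : subcritical z x -> 0 < w ->
  \forall n \near eventually, 2^-1 * Zn n (fug k z x * q n) z <=
    wt (fug k z x * q n) z (fun A : {set T n} => (x - w) * M n <= #|A|%:R <= (x + w) * M n).
Proof.
move=> sx w0; have [z0 z1 x0 _] := sx; near=> n.
have qn : 0 < q n by near: n; exact: q_gt0.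
set l := fug k z x * q n; have l0 : 0 <= l by rewrite mulr_ge0 ?fug_ge0 // ltW.
set W := fun A => _.
have h1 : wt l z (fun A : {set T n} => (x + w) * M n < #|A|%:R) <= 8^-1 * Zn n l z.
  by rewrite /l; near: n; exact: size_upper_tail.
have h2 : wt l z (fun A : {set T n} => #|A|%:R < (x - w) * M n) <= 8^-1 * Zn n l z.
  by rewrite /l; near: n; exact: size_lower_tail.
have h3 : wt l z (predC W) <= wt l z (predU (fun A : {set T n} => (x + w) * M n < #|A|%:R)
    (fun A : {set T n} => #|A|%:R < (x - w) * M n)).
  by apply: wt_le => // A _; rewrite /= /W negb_and -!ltNge orbC.
have := wtU (fun A : {set T n} => (x + w) * M n < #|A|%:R)
    (fun A : {set T n} => #|A|%:R < (x - w) * M n) l0 z0.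
have := wtC l z W; have := Zn_gt0 n l0 z0; lra.
Unshelve. all: end_near.
Qed.

Lemma exprn_tilt (z z' : R) (a : nat) : 0 < z -> 0 < z' ->
  z ^+ a = expR (a%:R * (ln z - ln z')) * z' ^+ a.
Proof.
move=> z0 z'0; rewrite expRM_natl -exprMn; congr (_ ^+ _).
by rewrite expRB !lnK ?posrE // divfK // gt_eqF.
Qed.

(** The limit of the tilted mean of the count divided by [M n]: the value of [z] times the
    derivative in [z] of the free energy at fixed [l]. *)
Definition Xlim z x := z * (x ^+ k.+1 / k.+1%:R).

(** Moving [z] at fixed [x] also moves the fugacity, since
    [lfug z' x - lfug z x = (z - z') * x ^+ k]. The first term is that change times the density [x];
    the second is the contribution of the count. *)
Lemma Phi_subz z z' x : Phi k z' x - Phi k z x =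
  (z - z') * (x * x ^+ k) - (z - z') * (x ^+ k.+1 / k.+1%:R).
Proof.
rewrite /Phi -exprS; have k1 : k.+1%:R != 0 :> R by rewrite pnatr_eq0.
have -> : k%:R = k.+1%:R - 1 :> R by rewrite -natr1 addrK.
by move: (k.+1%:R) k1 => K1 K10; field.
Qed.

(** Compare with [z' = z + t] at the same [x]. The fugacity changes too, so the change of measure
    involves [#|A|] as well as the count; this is why the event also bounds the size, to precision
    [w']. *)
Lemma count_upper_tail z x w : subcritical z x -> 0 < z < 1 -> 0 < w ->
  exists2 w', 0 < w' & \forall n \near eventually,
    wt (fug k z x * q n) z (fun A : {set T n} =>
        (#|A|%:R <= (x + w') * M n) && ((Xlim z x + w) * M n < (ncov (E n) A)%:R))
      <= 8^-1 * Zn n (fug k z x * q n) z.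
Proof.
move=> sx /andP[zp z1'] w0; have [z0 z1 x0 Hx] := sx.
pose S := x ^+ k.+1 / k.+1%:R; pose w' := w / (4 * (x ^+ k + 1)).
have xk0 : 0 < x ^+ k by rewrite exprn_gt0.
have S0 : 0 < S by rewrite divr_gt0 ?exprn_gt0.
have w'0 : 0 < w' by rewrite divr_gt0 // mulr_gt0 // addr_gt0.
exists w' => //.
have w'x : w' * x ^+ k <= w / 4.
  rewrite /w' invfM mulrA -mulrA ler_piMr ?divr_ge0 ?(ltW w0) //.
  by rewrite ler_pdivrMl ?addr_gt0 // mulr1 lerDl.
(* [t <= 1 - z] keeps [z' <= 1]. The bound on [t * S] controls the second-order loss from the
   estimate [ln z' - ln z >= t / z'], which has [z'] and not [z] in the denominator. *)
have [t t0 [tz tS]] : exists2 t, 0 < t & t <= 1 - z /\ t * S <= w / 4.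
  exists (Num.min (1 - z) (w / 4 / S)); first by rewrite lt_min subr_gt0 z1' divr_gt0 // divr_gt0.
  split; first by rewrite ge_min lexx.
  by rewrite -ler_pdivlMr // ge_min lexx orbT.
pose z' := z + t.
have z'0 : 0 < z' by rewrite addr_gt0.
have z'1 : z' <= 1 by rewrite /z'; lra.
have sx' : subcritical z' x.
  split=> //; first exact: ltW.
  apply: le_lt_trans Hx; rewrite ler_wpM2r ?(ltW xk0) // ler_wpM2l // /z'; lra.
have lz : t / z' <= ln z' - ln z.
  by have := ln_diff_ge zp z'0; rewrite /z' [z + t - z]addrAC subrr add0r.
have Ld : lfug z x - lfug z' x = t * x ^+ k by rewrite /lfug /z'; ring.
pose a := (x + w') * (t * x ^+ k) - (Xlim z x + w) * (ln z' - ln z).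
have X0 : 0 < Xlim z x by rewrite mulr_gt0.
apply: (tail_small (z' := z') (x' := x) (a := a) sx sx').
  have := Phi_subz z z' x; rewrite -/S => hP.
  have h1 : (Xlim z x + w) * (t / z') <= (Xlim z x + w) * (ln z' - ln z).
    by rewrite ler_wpM2l // addr_ge0 // ltW.
  have h2 : t * (S + w' * x ^+ k) < (Xlim z x + w) * (t / z').
    rewrite mulrCA ltr_pM2l // ltr_pdivlMr // /Xlim -/S.
    have : z' * (w' * x ^+ k) <= 1 * (w' * x ^+ k) by rewrite ler_wpM2r // mulr_ge0 // ltW.
    have -> : (S + w' * x ^+ k) * z' = z * S + t * S + z' * (w' * x ^+ k) by rewrite /z'; ring.
    lra.
  move: hP h1 h2; rewrite /a /z'; lra.
near=> n => A AK /andP[sA xA].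
have qn : 0 < q n by near: n; exact: q_gt0.
rewrite (@fug_pow_tilt z x z' x) // (@exprn_tilt z z') // mulrACA -expRD ler_wpM2r //.
  by rewrite mulr_ge0 ?exprn_ge0 ?mulr_ge0 ?fug_ge0 // ltW.
rewrite ler_expR Ld /a [M n * _]mulrBr; apply: lerD.
  by rewrite [leRHS]mulrA [M n * _]mulrC ler_wpM2r // mulr_ge0 // ltW.
rewrite -[ln z - ln z']opprB mulrN lerN2 mulrA [M n * _]mulrC ler_wpM2r ?(ltW xA) //.
by apply: le_trans lz; rewrite divr_ge0 // ltW.
Unshelve. all: end_near.
Qed.

Lemma count_lower_tail z x w : subcritical z x -> 0 < z < 1 -> 0 < w ->
  exists2 w', 0 < w' & \forall n \near eventually,
    wt (fug k z x * q n) z (fun A : {set T n} =>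
        ((x - w') * M n <= #|A|%:R) && ((ncov (E n) A)%:R < (Xlim z x - w) * M n))
      <= 8^-1 * Zn n (fug k z x * q n) z.
Proof.
move=> sx /andP[zp z1'] w0; have [z0 z1 x0 Hx] := sx.
pose S := x ^+ k.+1 / k.+1%:R; pose w' := w / (4 * (x ^+ k + 1)).
have xk0 : 0 < x ^+ k by rewrite exprn_gt0.
have S0 : 0 < S by rewrite divr_gt0 ?exprn_gt0.
have w'0 : 0 < w' by rewrite divr_gt0 // mulr_gt0 // addr_gt0.
exists w' => //.
have [mw|mw] := ltP (Xlim z x) w.
  near=> n; have qn : 0 < q n by near: n; exact: q_gt0.
  have Mn : 0 <= M n by near: n; exact: M_ge0.
  rewrite wt0; first by rewrite mulr_ge0 // ltW // Zn_gt0 // mulr_ge0 ?fug_ge0 // ltW.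
  move=> A _; rewrite negb_and -!leNgt; apply/orP; right; apply: le_trans (ler0n _ _).
  by rewrite mulr_le0_ge0 // subr_le0 ltW.
have w'x : w' * x ^+ k <= w / 4.
  rewrite /w' invfM mulrA -mulrA ler_piMr ?divr_ge0 ?(ltW w0) //.
  by rewrite ler_pdivrMl ?addr_gt0 // mulr1 lerDl.
pose gap := 1 - k%:R * (1 - z) * x ^+ k; have gap0 : 0 < gap by rewrite subr_gt0.
have kx0 : 0 <= k%:R * x ^+ k by rewrite mulr_ge0 // ltW.
(* Lowering [z] increases [k%:R * (1 - z) * x ^+ k], so besides keeping [z'] positive and the
   second-order loss small, [t] must preserve subcriticality: hence the bound by [gap]. *)
have [t t0 [tz tS tg]] : exists2 t, 0 < t & [/\ t <= z / 2, t * S <= w / 4 & t * (k%:R * x ^+ k) < gap].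
  exists (Num.min (z / 2) (Num.min (w / 4 / S) (gap / (k%:R * x ^+ k + 1)))).
    have w40 : 0 < w / 4 by rewrite divr_gt0.
    have z20 : 0 < z / 2 by rewrite divr_gt0.
    have g1 : 0 < gap / (k%:R * x ^+ k + 1) by rewrite divr_gt0 // ltr_wpDl.
    by rewrite !lt_min z20 g1 divr_gt0.
  split; first by rewrite ge_min lexx.
    by rewrite -ler_pdivlMr // !ge_min lexx !orbT.
  apply: (@le_lt_trans _ _ (gap / (k%:R * x ^+ k + 1) * (k%:R * x ^+ k))).
    by rewrite ler_wpM2r // !ge_min lexx !orbT.
  by rewrite mulrAC ltr_pdivrMr ?ltr_wpDl // ltr_pM2l // ltrDl.
pose z' := z - t.
have z'0 : 0 < z' by rewrite /z'; lra.
have z'1 : z' <= 1 by rewrite /z'; lra.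
have sx' : subcritical z' x.
  split=> //; first exact: ltW.
  move: tg; rewrite /gap /z'; lra.
have lz : ln z - ln z' <= t / z'.
  have := ln_diff_le zp z'0; rewrite (_ : z - z' = t) // /z'; lra.
have lz0 : 0 <= ln z - ln z' by rewrite subr_ge0 ler_ln ?posrE // /z'; lra.
have Ld : lfug z x - lfug z' x = - (t * x ^+ k) by rewrite /lfug /z'; ring.
pose a := (x - w') * (- (t * x ^+ k)) + (Xlim z x - w) * (ln z - ln z').
apply: (tail_small (z' := z') (x' := x) (a := a) sx sx').
  have := Phi_subz z z' x; rewrite -/S => hP.
  have h1 : (Xlim z x - w) * (ln z - ln z') <= (Xlim z x - w) * (t / z').
    by rewrite ler_wpM2l // subr_ge0.
  have h2 : (Xlim z x - w) * (t / z') < t * (S - w' * x ^+ k).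
    rewrite mulrCA ltr_pM2l // ltr_pdivrMr // /Xlim -/S.
    have : z' * (w' * x ^+ k) <= 1 * (w' * x ^+ k) by rewrite ler_wpM2r // mulr_ge0 // ltW.
    have -> : (S - w' * x ^+ k) * z' = z * S - t * S - z' * (w' * x ^+ k) by rewrite /z'; ring.
    lra.
  move: hP h1 h2; rewrite /a /z'; lra.
near=> n => A AK /andP[sA xA].
have qn : 0 < q n by near: n; exact: q_gt0.
rewrite (@fug_pow_tilt z x z' x) // (@exprn_tilt z z') // mulrACA -expRD ler_wpM2r //.
  by rewrite mulr_ge0 ?exprn_ge0 ?mulr_ge0 ?fug_ge0 // ltW.
rewrite ler_expR Ld /a [M n * _]mulrDr; apply: lerD.
  rewrite [leRHS]mulrA [M n * _]mulrC; apply: ler_wnM2r => //.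
  by rewrite oppr_le0 mulr_ge0 // ltW.
by rewrite [leRHS]mulrA [M n * _]mulrC ler_wpM2r // ltW.
Unshelve. all: end_near.
Qed.

(** The complement is covered by four tails of mass at most 1/8 each. The size tails are taken at
    the smaller width [v], so that outside them the size restrictions in both count tails are
    met. *)
Lemma full_window z x w : subcritical z x -> 0 < z < 1 -> 0 < w ->
  \forall n \near eventually, 2^-1 * Zn n (fug k z x * q n) z <=
    wt (fug k z x * q n) z (fun A : {set T n} =>
      ((x - w) * M n <= #|A|%:R <= (x + w) * M n) &&
      ((Xlim z x - w) * M n <= (ncov (E n) A)%:R <= (Xlim z x + w) * M n)).
Proof.
move=> sx z01 w0; have [z0 z1 x0 _] := sx.
have [wu wu0 Hu'] := count_upper_tail sx z01 w0.
have [wl wl0 Hl'] := count_lower_tail sx z01 w0.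
pose v := Num.min w (Num.min wu wl).
have v0 : 0 < v by rewrite !lt_min w0 wu0 wl0.
have vw : v <= w by rewrite ge_min lexx.
have vu : v <= wu by rewrite !ge_min lexx orbT.
have vl : v <= wl by rewrite !ge_min lexx !orbT.
near=> n.
have qn : 0 < q n by near: n; exact: q_gt0.
have Mn : 0 <= M n by near: n; exact: M_ge0.
set l := fug k z x * q n; have l0 : 0 <= l by rewrite mulr_ge0 ?fug_ge0 // ltW.
set W := fun A => _.
pose B1 := fun A : {set T n} => (x + v) * M n < #|A|%:R.
pose B2 := fun A : {set T n} => #|A|%:R < (x - v) * M n.
pose B3 := fun A : {set T n} =>
  (#|A|%:R <= (x + wu) * M n) && ((Xlim z x + w) * M n < (ncov (E n) A)%:R).
pose B4 := fun A : {set T n} =>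
  ((x - wl) * M n <= #|A|%:R) && ((ncov (E n) A)%:R < (Xlim z x - w) * M n).
have h1 : wt l z B1 <= 8^-1 * Zn n l z by rewrite /l /B1; near: n; exact: size_upper_tail.
have h2 : wt l z B2 <= 8^-1 * Zn n l z by rewrite /l /B2; near: n; exact: size_lower_tail.
have h3 : wt l z B3 <= 8^-1 * Zn n l z by rewrite /l /B3; near: n; exact: Hu'.
have h4 : wt l z B4 <= 8^-1 * Zn n l z by rewrite /l /B4; near: n; exact: Hl'.
have h5 : wt l z (predC W) <= wt l z (predU (predU B1 B2) (predU B3 B4)).
  apply: wt_le => // A _; rewrite /= /W /B1 /B2 /B3 /B4.
  case: (ltP ((x + v) * M n)) => //= a1; case: (ltP _ ((x - v) * M n)) => //= a2.
  have -> : #|A|%:R <= (x + wu) * M n by apply: le_trans a1 _; rewrite ler_wpM2r // lerD2l.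
  have -> : (x - wl) * M n <= #|A|%:R.
    by apply: le_trans a2; rewrite ler_wpM2r // lerD2l lerN2.
  have -> : (x - w) * M n <= #|A|%:R.
    by apply: le_trans a2; rewrite ler_wpM2r // lerD2l lerN2.
  have -> : #|A|%:R <= (x + w) * M n by apply: le_trans a1 _; rewrite ler_wpM2r // lerD2l.
  by rewrite /= negb_and -!ltNge orbC.
have := wtU (predU B1 B2) (predU B3 B4) l0 z0.
have := wtU B1 B2 l0 z0; have := wtU B3 B4 l0 z0.
have := wtC l z W; have := Zn_gt0 n l0 z0; lra.
Unshelve. all: end_near.
Qed.

End Concentration.

(** * Monotonicity in the number of edges *)

Section LevelSets.
Variables (R : realType) (T : finType) (K : {set T}) (D : pred {set T}).
Hypothesis D_down : forall A v, D (v |: A) -> D A.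

Definition level (m : nat) : nat := #|[set A : {set T} | [&& A \subset K, #|A| == m & D A]]|.

Definition frac (m : nat) : R := (level m)%:R / ('C(#|K|, m))%:R.

Lemma frac_ge0 m : 0 <= frac m.
Proof. exact: divr_ge0. Qed.

(* Double counting of the pairs [(A, v)] with [v] in [A], respectively [v] outside [A]. *)
Lemma level_succ m : (m.+1 * level m.+1 <= (#|K| - m) * level m)%N.
Proof.
pose S := \sum_(A in [set A : {set T} | [&& A \subset K, #|A| == m.+1 & D A]])
  \sum_(v in K) (v \in A : nat).
have -> : (m.+1 * level m.+1 = S)%N.
  rewrite /S /level (eq_bigr (fun=> m.+1)); first by rewrite sum_nat_const mulnC.
  move=> A; rewrite inE => /and3P[AK /eqP cA _]; rewrite -cA -sum1_card big_mkcond /=.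
  rewrite big_mkcond [RHS]big_mkcond /=; apply: eq_bigr => v _.
  by case: (boolP (v \in A)) => [vA|]; [rewrite (subsetP AK)|case: ifP].
have -> : S = \sum_(v in K) \sum_(A : {set T} | (A \subset K) && (v \in A))
    ((#|A| == m.+1) && D A : nat).
  rewrite /S exchange_big /=; apply: eq_bigr => v vK.
  rewrite big_mkcond [RHS]big_mkcond /=; apply: eq_bigr => A _; rewrite inE.
  by case: (A \subset K); case: (v \in A); case: (_ == _); case: (D A).
have -> : ((#|K| - m) * level m = \sum_(A in [set A : {set T} | [&& A \subset K, #|A| == m & D A]])
   \sum_(v in K) (v \notin A : nat))%N.
  rewrite /level (eq_bigr (fun=> (#|K| - m)%N)); first by rewrite sum_nat_const mulnC.
  move=> A; rewrite inE => /and3P[AK /eqP cA _]; rewrite -cA -cardsDS // -sum1_card.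
  rewrite big_mkcond [RHS]big_mkcond /=; apply: eq_bigr => v _; rewrite inE.
  by case: (v \in A); case: (v \in K).
rewrite [leqRHS]exchange_big /=; apply: leq_sum => v vK.
rewrite (_ : \sum_(A : {set T} | _) _ = \sum_(A : {set T} | (A \subset K) && (v \notin A))
   ((#|v |: A| == m.+1) && D (v |: A) : nat)); last first.
  rewrite (reindex_onto (fun A => v |: A) (fun A => A :\ v)) /=; last first.
    by move=> A /andP[_ vA]; rewrite setD1K.
  apply: eq_bigl => A; rewrite subUset sub1set vK setU11 andbT /=.
  case: (A \subset K) => //=; apply/eqP/idP => [<-|vA]; first by rewrite setD11.
  by rewrite setU1K.
rewrite big_mkcond [leqRHS]big_mkcond /=; apply: leq_sum => A _; rewrite inE.
case: (A \subset K) => //=; case: (boolP (v \in A)) => vA /=; first by case: ifP.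
rewrite cardsU1 vA add1n eqSS; case: (_ == _) => //=.
by case: (boolP (D (v |: A))) => // /D_down ->.
Qed.

Lemma frac_succ m : (m < #|K|)%N -> frac m.+1 <= frac m.
Proof.
move=> mK; have C0 : 0 < ('C(#|K|, m))%:R :> R by rewrite ltr0n bin_gt0 ltnW.
have C1 : 0 < ('C(#|K|, m.+1))%:R :> R by rewrite ltr0n bin_gt0.
have m1 : 0 < m.+1%:R :> R by [].
rewrite /frac ler_pdivrMr // mulrAC ler_pdivlMr // -(ler_pM2l m1) mulrA [leRHS]mulrCA.
rewrite -!natrM ler_nat mul_bin_left mulnA leq_mul2r; apply/orP; right.
by rewrite [leqRHS]mulnC; exact: level_succ.
Qed.

Lemma frac_le m m' : (m <= m')%N -> (m' <= #|K|)%N -> frac m' <= frac m.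
Proof.
move=> mm'; rewrite -(subnKC mm'); elim: (m' - m)%N => [|j IH]; first by rewrite addn0.
rewrite addnS => jK; apply: le_trans (frac_succ jK) (IH _); exact: ltnW.
Qed.

Definition gsum (l : R) (P : pred {set T}) : R :=
  \sum_(A : {set T} | (A \subset K) && P A) l ^+ #|A|.

Lemma gsum_level (l : R) (W : pred nat) :
  gsum l (fun A => W #|A| && D A) =
  \sum_(m < #|K|.+1 | W m) l ^+ m * (frac m * ('C(#|K|, m))%:R).
Proof.
rewrite /gsum (partition_big (fun A : {set T} => inord #|A| : 'I_(#|K|.+1)) (fun m => W m)) /=.
  apply: eq_bigr => m Wm.
  have -> : frac m * ('C(#|K|, m))%:R = (level m)%:R.
    by rewrite divfK // pnatr_eq0 -lt0n bin_gt0 -ltnS.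
  rewrite (eq_bigr (fun=> l ^+ m)); last first.
    move=> A /andP[/andP[AK _] /eqP <-].
    by rewrite inordK // ltnS subset_leq_card.
  rewrite sumr_const -[LHS]mulr_natr; congr (_ * _%:R); rewrite /level.
  apply: eq_card => A; rewrite [in RHS]inE; apply/andP/and3P.
    by case=> /andP[AK /andP[_ DA]] /eqP <-; rewrite inordK // ltnS subset_leq_card.
  case=> AK /eqP cA DA; rewrite AK cA Wm DA; split=> //; apply/eqP/val_inj.
  by rewrite /= inordK.
move=> A /and3P[AK WA _]; by rewrite inordK // ltnS subset_leq_card.
Qed.

End LevelSets.

Section LevelComparison.
Variables (R : realType) (T : finType) (K : {set T}) (D : pred {set T}).
Hypothesis D_down : forall A v, D (v |: A) -> D A.

Lemma gsum_size (l : R) (W : pred nat) : gsum K l (fun A => W #|A|) =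
  \sum_(m < #|K|.+1 | W m) l ^+ m * ('C(#|K|, m))%:R.
Proof.
have := gsum_level K xpredT l W.
rewrite (_ : gsum K l (fun A => W #|A| && true) = gsum K l (fun A => W #|A|)); last first.
  by apply: eq_bigl => A; rewrite andbT.
move=> ->; apply: eq_bigr => m _; congr (_ * _).
have mK : (m <= #|K|)%N by rewrite -ltnS.
rewrite divfK ?pnatr_eq0 -?lt0n ?bin_gt0 //; congr (_%:R).
rewrite -cards_draws /level; apply: eq_card => A; rewrite !inE andbT.
by [].
Qed.

Lemma gsum_le_frac (l : R) (W : pred nat) m : 0 <= l -> (forall j, W j -> (m <= j)%N) ->
  gsum K l (fun A => W #|A| && D A) <= frac R K D m * gsum K l (fun A => W #|A|).
Proof.
move=> l0 Wm; rewrite gsum_level gsum_size mulr_sumr; apply: ler_sum => j Wj.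
rewrite [leRHS]mulrCA ler_wpM2l ?exprn_ge0 // ler_wpM2r //; apply: frac_le => //; first exact: Wm.
by rewrite -ltnS.
Qed.

Lemma frac_le_gsum (l : R) (W : pred nat) m : 0 <= l -> (m <= #|K|)%N ->
  (forall j, W j -> (j <= m)%N) ->
  frac R K D m * gsum K l (fun A => W #|A|) <= gsum K l (fun A => W #|A| && D A).
Proof.
move=> l0 mK Wm; rewrite gsum_level gsum_size mulr_sumr; apply: ler_sum => j Wj.
rewrite mulrCA ler_wpM2l ?exprn_ge0 // ler_wpM2r //; apply: frac_le => //; exact: Wm.
Qed.

End LevelComparison.

(** * Lower tail rates *)

Section ExponentialRates.
Variables (R : realType) (M : nat -> R).
Hypothesis HM : forall A, \forall n \near eventually, A <= M n.
Implicit Types (f g : nat -> R) (L e : R).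

(** The upper limit of [f n / M n] is at most [L], written without division so that such bounds
    add. *)
Definition rate_le f L := forall e, 0 < e -> \forall n \near eventually, f n <= (L + e) * M n.
Definition rate_ge f L := forall e, 0 < e -> \forall n \near eventually, (L - e) * M n <= f n.

Lemma rate_leN f L : rate_ge f L -> rate_le (fun n => - f n) (- L).
Proof. by move=> H e e0; apply: filterS (H e e0) => n; rewrite !mulrDl !mulNr; lra. Qed.

Lemma rate_geN f L : rate_le f L -> rate_ge (fun n => - f n) (- L).
Proof. by move=> H e e0; apply: filterS (H e e0) => n; rewrite !mulrDl !mulNr; lra. Qed.

Lemma rate_leD f g L L' : rate_le f L -> rate_le g L' -> rate_le (fun n => f n + g n) (L + L').
Proof.
move=> Hf Hg e e0; have e2 : 0 < e / 2 by rewrite divr_gt0.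
by apply: filterS2 (Hf _ e2) (Hg _ e2) => n; rewrite !mulrDl; lra.
Qed.

Lemma rate_geD f g L L' : rate_ge f L -> rate_ge g L' -> rate_ge (fun n => f n + g n) (L + L').
Proof.
move=> Hf Hg e e0; have e2 : 0 < e / 2 by rewrite divr_gt0.
by apply: filterS2 (Hf _ e2) (Hg _ e2) => n; rewrite !mulrDl !mulNr; lra.
Qed.

Lemma rate_leZ a f L : 0 <= a -> rate_le f L -> rate_le (fun n => a * f n) (a * L).
Proof.
move=> a0 H e e0; have e2 : 0 < e / (a + 1) by rewrite divr_gt0 // ltr_wpDl.
apply: filterS2 (H _ e2) (HM 0) => n h M0.
apply: le_trans (ler_wpM2l a0 h) _; rewrite mulrA ler_wpM2r // mulrDr lerD2l mulrCA.
by rewrite ler_piMr ?(ltW e0) // ler_pdivrMr ?mul1r ?lerDl // ltr_wpDl.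
Qed.

Lemma rate_le_mono f g L : (\forall n \near eventually, f n <= g n) -> rate_le g L -> rate_le f L.
Proof. by move=> fg H e e0; apply: filterS2 fg (H e e0) => n; apply: le_trans. Qed.

Lemma rate_ge_mono f g L : (\forall n \near eventually, f n <= g n) -> rate_ge f L -> rate_ge g L.
Proof. by move=> fg H e e0; apply: filterS2 fg (H e e0) => n h1 h2; apply: le_trans h2 h1. Qed.

Lemma rate_le_approx f L : (forall e, 0 < e -> exists2 L', L' <= L + e & rate_le f L') -> rate_le f L.
Proof.
move=> H e e0; have e2 : 0 < e / 2 by rewrite divr_gt0.
have [L' LL' HL'] := H _ e2; apply: filterS2 (HL' _ e2) (HM 0) => n h M0.
by apply: le_trans h _; rewrite ler_wpM2r //; lra.
Qed.

Lemma rate_ge_approx f L : (forall e, 0 < e -> exists2 L', L - e <= L' & rate_ge f L') -> rate_ge f L.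
Proof.
move=> H e e0; have e2 : 0 < e / 2 by rewrite divr_gt0.
have [L' LL' HL'] := H _ e2; apply: filterS2 (HL' _ e2) (HM 0) => n h M0.
by apply: le_trans h; rewrite ler_wpM2r //; lra.
Qed.

Lemma rate_le_cst a : rate_le (fun=> a) 0.
Proof.
move=> e e0; apply: filterS (HM (a / e)) => n.
by rewrite ler_pdivrMr // add0r mulrC.
Qed.

Lemma rate_ge_cst a : rate_ge (fun=> a) 0.
Proof. by have := rate_geN (rate_le_cst (- a)); rewrite oppr0 opprK. Qed.

Lemma rate_le_scale a : rate_le (fun n => a * M n) a.
Proof. by move=> e e0; apply: filterS (HM 0) => n M0; rewrite ler_wpM2r // lerDl ltW. Qed.

Lemma rate_ge_scale a : rate_ge (fun n => a * M n) a.
Proof. by move=> e e0; apply: filterS (HM 0) => n M0; rewrite ler_wpM2r // gerBl ltW. Qed.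

Lemma rate_of_cvg f L : (f n / M n @[n --> eventually] --> L)%classic -> rate_le f L /\ rate_ge f L.
Proof.
move=> /cvgrPdist_le H; split=> e e0.
  apply: filterS2 (H _ e0) (HM 1) => n; rewrite ler_norml => /andP[h _] M1.
  have M0 : 0 < M n by apply: lt_le_trans M1.
  by rewrite -ler_pdivrMr //; lra.
apply: filterS2 (H _ e0) (HM 1) => n; rewrite ler_norml => /andP[_ h] M1.
have M0 : 0 < M n by apply: lt_le_trans M1.
by rewrite -ler_pdivlMr //; lra.
Qed.

Lemma cvg_of_rate f L : rate_le f L -> rate_ge f L -> ((M n)^-1 * f n @[n --> eventually] --> L)%classic.
Proof.
move=> Hl Hg; apply/cvgrPdist_le => e e0.
apply: filterS3 (Hl _ e0) (Hg _ e0) (HM 1) => n h1 h2 M1.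
have M0 : 0 < M n by apply: lt_le_trans M1.
rewrite -(ler_pdivrMr _ _ M0) in h1; rewrite -(ler_pdivlMr _ _ M0) in h2.
by rewrite mulrC ler_norml; apply/andP; split; lra.
Qed.

End ExponentialRates.

(** * Free energy rates and exponential tilting *)

Section LowerTail.
Variables (R : realType) (k : nat).
Hypothesis k_gt1 : (1 < k)%N.
Variables (T : nat -> finType) (K : forall n, {set T n}) (E : forall n, {set {set T n}}).
Variable q : nat -> R.
Hypothesis Hu : forall n, uniform (K n) (E n) k.
Hypothesis Hs : forall d : R, 0 < d -> \forall n \near eventually, sparse (K n) (E n) k (q n) d.
Implicit Types (x y z l w e a : R).

Let M n : R := #|K n|%:R * q n.
Hypothesis HM : forall A, \forall n \near eventually, A <= M n.

Local Notation Zn := (Zn K E).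
Local Notation wt := (wt K E).
Local Notation fug := (fug k).
Local Notation Phi := (Phi k).
Local Notation Xlim := (Xlim k).
Local Notation subcritical := (subcritical k).
Local Notation rate_le := (rate_le M).
Local Notation rate_ge := (rate_ge M).

Lemma Zn_le n (l l' z : R) : 0 <= l -> l <= l' -> 0 <= z -> Zn n l z <= Zn n l' z.
Proof.
move=> l0 ll' z0; apply: ler_sum => A _; rewrite ler_wpM2r ?exprn_ge0 //.
by apply: lerXn2r; rewrite ?nnegrE // (le_trans l0).
Qed.

Lemma ncov_set0 n : ncov (E n) set0 = 0%N.
Proof.
apply/eqP; rewrite cards_eq0; apply/eqP/setP=> f; rewrite !inE; apply/andP=> -[/Hu[_ fk]].
by rewrite subset0 -cards_eq0 fk.
Qed.

Lemma Zn_binomial n l : Zn n l 1 = (1 + l) ^+ #|K n|.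
Proof.
rewrite exprDn ZnE /wt; have := gsum_size (K n) l xpredT.
rewrite /gsum => H; transitivity (\sum_(A : {set T n} | (A \subset K n) && true) l ^+ #|A|).
  by apply: eq_bigr => A _; rewrite expr1n mulr1.
by rewrite H; apply: eq_bigr => i _; rewrite expr1n mul1r mulr_natr.
Qed.

Lemma rate_lnZ_exact z x : subcritical z x ->
  rate_le (fun n => ln (Zn n (fug z x * q n) z)) (Phi z x) /\
  rate_ge (fun n => ln (Zn n (fug z x * q n) z)) (Phi z x).
Proof.
move=> sx; split=> e e0; apply: filterS (free_energy_seq k_gt1 Hu Hs sx e0) => n;
  by rewrite ler_norml -/(M n) mulrDl ?mulNr => /andP[]; lra.
Qed.

Lemma Phi_near_right z x e : subcritical z x -> 0 < e ->
  exists y, [/\ x < y, subcritical z y & Phi z y <= Phi z x + e].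
Proof.
move=> sx e0; have [d d0 H] := isder_continuity (isder_Phi k z x) e0.
have [y /andP[xy yd] sy] := subcritical_right sx d0.
have xyd : `|y - x| < d by rewrite gtr0_norm ?subr_gt0 // ltrBlDl.
by exists y; split=> //; have := H y xyd; rewrite ltr_norml; lra.
Qed.

Lemma near_left x d : 0 < x -> 0 < d -> exists2 y, 0 < y < x & `|y - x| < d.
Proof.
move=> x0 d0; pose t := Num.min x d / 2.
have t0 : 0 < t by rewrite divr_gt0 // lt_min x0.
have tm : t < Num.min x d by rewrite ltr_pdivrMr // ltr_pMr ?ltr1n // lt_min x0.
have [tx td] : t < x /\ t < d by apply/andP; rewrite -lt_min.
exists (x - t); first by rewrite subr_gt0 tx ltrBlDr ltrDl.
by rewrite addrAC subrr add0r normrN gtr0_norm.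
Qed.

Lemma Phi_near_left z x e : subcritical z x -> 0 < e ->
  exists y, [/\ y < x, subcritical z y & Phi z x - e <= Phi z y].
Proof.
move=> sx e0; have [d d0 H] := isder_continuity (isder_Phi k z x) e0.
have [_ _ x0 _] := sx; have [y /andP[y0 yx] yd] := near_left x0 d0.
exists y; split=> //; first by apply: subcritical_le sx y0 _; exact: ltW.
have := H y yd; rewrite ltr_norml; lra.
Qed.

Lemma fug_lt z x y : z <= 1 -> 0 < x -> x < y -> fug z x < fug z y.
Proof.
move=> z1 x0 xy; apply: (@lt_le_trans _ _ (y * expR ((1 - z) * x ^+ k))).
  by rewrite ltr_pM2r ?expR_gt0.
rewrite ler_wpM2l ?(ltW (lt_trans x0 xy)) // ler_expR ler_wpM2l ?subr_ge0 //.
by apply: lerXn2r; rewrite ?nnegrE ltW // (lt_trans x0).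
Qed.

Lemma cvg_near_le (l : nat -> R) c c' : (l n / q n @[n --> eventually] --> c)%classic -> c < c' ->
  \forall n \near eventually, l n <= c' * q n.
Proof.
move=> /cvgrPdist_le H cc'; have e0 : 0 < c' - c by rewrite subr_gt0.
apply: filterS2 (H _ e0) (q_gt0 Hs) => n; rewrite ler_norml => /andP[h _] qn.
by rewrite -ler_pdivrMr //; lra.
Qed.

Lemma cvg_near_ge (l : nat -> R) c c' : (l n / q n @[n --> eventually] --> c)%classic -> c' < c ->
  \forall n \near eventually, c' * q n <= l n.
Proof.
move=> /cvgrPdist_le H cc'; have e0 : 0 < c - c' by rewrite subr_gt0.
apply: filterS2 (H _ e0) (q_gt0 Hs) => n; rewrite ler_norml => /andP[_ h] qn.
by rewrite -ler_pdivlMr //; lra.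
Qed.

Definition asymp (l : nat -> R) c :=
  (forall c', c < c' -> \forall n \near eventually, l n <= c' * q n) /\
  (forall c', c' < c -> \forall n \near eventually, c' * q n <= l n).

Lemma asymp_cvg (l : nat -> R) c : (l n / q n @[n --> eventually] --> c)%classic -> asymp l c.
Proof. by move=> H; split=> c' cc'; [exact: cvg_near_le H cc'|exact: cvg_near_ge H cc']. Qed.

(** The free energy is known at fugacities exactly [fug z x * q n]. For a fugacity only asymptotic
    to that, sandwich it between nearby values of [x], using that [Zn] is monotone in [l] and [Phi]
    is continuous. *)
Lemma rate_lnZ z x (l : nat -> R) : subcritical z x -> (forall n, 0 <= l n) ->
  asymp l (fug z x) ->
  rate_le (fun n => ln (Zn n (l n) z)) (Phi z x) /\
  rate_ge (fun n => ln (Zn n (l n) z)) (Phi z x).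
Proof.
move=> sx l0 [lup llo]; have [z0 z1 x0 _] := sx.
split.
  apply: (rate_le_approx HM) => e e0; have [y [xy sy Pe]] := Phi_near_right sx e0.
  exists (Phi z y) => //; have [Hle _] := rate_lnZ_exact sy.
  apply: rate_le_mono Hle; apply: filterS (lup _ (fug_lt z1 x0 xy)) => n h.
  have f0 : 0 <= fug z y * q n by apply: le_trans h.
  by rewrite ler_ln ?posrE; [exact: Zn_le|exact: (Zn_gt0 Hu)|exact: (Zn_gt0 Hu)].
apply: (rate_ge_approx HM) => e e0; have [y [xy sy Pe]] := Phi_near_left sx e0.
exists (Phi z y) => //; have [_ Hge] := rate_lnZ_exact sy; have [_ _ y0 _] := sy.
apply: rate_ge_mono Hge.
apply: filterS2 (llo _ (fug_lt z1 y0 xy)) (q_gt0 Hs) => n h qn.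
have f0 : 0 <= fug z y * q n by rewrite mulr_ge0 ?fug_ge0 // ltW.
by rewrite ler_ln ?posrE; [exact: Zn_le|exact: (Zn_gt0 Hu)|exact: (Zn_gt0 Hu)].
Qed.

(** The exponent of [z ^ a]. At [z = 0] it is applied only when the threshold is below 1, hence the
    count is 0 and [z ^+ 0 = 1]. *)
Definition lnw z a := if z == 0 then 0 else ln z * a.

(** Chernoff: where the count is at most [t], [z] to the power of the count is at least [z ^ t]. *)
Lemma wt_count_le n (l z t : R) (W : pred {set T n}) : 0 <= l -> 0 <= z -> z <= 1 -> 
  (z == 0 -> t < 1) ->
  wt l 1 (fun A : {set T n} => W A && ((ncov (E n) A)%:R <= t)) <= expR (- lnw z t) * wt l z W.
Proof.
move=> l0 z0 z1 zt; rewrite /wt mulr_sumr big_mkcond [leRHS]big_mkcond /=.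
apply: ler_sum => A _; rewrite andbA; case: (boolP ((A \subset K n) && W A)) => //= _.
have w0 : 0 <= expR (- lnw z t) * (l ^+ #|A| * z ^+ ncov (E n) A).
  by rewrite !mulr_ge0 ?expR_ge0 ?exprn_ge0.
case: ifP => // Xt; rewrite expr1n mulr1 mulrCA ler_peMr ?exprn_ge0 //.
rewrite /lnw; case: eqP => [z00|/eqP zn0].
  have t1 : t < 1 by apply: zt; rewrite z00.
  have : (ncov (E n) A < 1)%N by rewrite -(ltr_nat R); exact: le_lt_trans Xt t1.
  by rewrite oppr0 expR0 mul1r ltnS leqn0 => /eqP ->; rewrite expr0.
have zp : 0 < z by rewrite lt_neqAle eq_sym zn0.
rewrite -[z in z ^+ _]lnK ?posrE // -expRM_natl -expRD -[leLHS]expR0 ler_expR.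
rewrite addrC mulrC -mulrBr mulr_le0 ?ln_le0 // subr_le0 //.
Qed.

(** Reverse of Chernoff: where the count is at least [a], the tilting factor is at most [z ^ a].
    Together with [wt_count_le] this loses only the width of the window. *)
Lemma tilted_window_le n (l z a t t' : R) (W : pred {set T n}) : 0 <= l -> 0 < z -> z <= 1 -> t' <= t ->
  expR (- (ln z * a)) * wt l z (fun A : {set T n} => W A && (a <= (ncov (E n) A)%:R <= t')) <=
  wt l 1 (fun A : {set T n} => W A && ((ncov (E n) A)%:R <= t)).
Proof.
move=> l0 zp z1 tt'.
rewrite [leLHS]mulr_sumr [leLHS]big_mkcond /wt [leRHS]big_mkcond /=; apply: ler_sum => A _.
case: (A \subset K n) => //=; case: (W A) => //=; case: ifP => [/andP[Xl Xu]|_]; last first.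
  by case: ifP => // _; rewrite expr1n mulr1 exprn_ge0.
rewrite (le_trans Xu tt') expr1n mulr1 mulrCA ler_piMr ?exprn_ge0 //.
rewrite -[z in z ^+ _]lnK ?posrE // -expRM_natl -expRD -[leRHS]expR0 ler_expR.
have : ln z * ((ncov (E n) A)%:R - a) <= 0 by rewrite mulr_le0_ge0 ?ln_le0 // subr_ge0.
move: ((ncov (E n) A)%:R : R) => nA; lra.
Qed.

Lemma Xlim_lt z x y : 0 < z -> 0 <= x -> x < y -> Xlim z x < Xlim z y.
Proof.
move=> z0 x0 xy; rewrite /Xlim ltr_pM2l // ltr_pM2r ?invr_gt0 ?ltr0n //.
by apply: ltrXn2r.
Qed.

Lemma isder_Xlim z x : is_derive x 1 (Xlim z) (z * x ^+ k).
Proof.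
apply: isder_eq (isder_scale z (isder_mul (isder_pow k.+1 (isder_id x)) (isder_cst x _))) _.
have : k.+1%:R != 0 :> R by rewrite pnatr_eq0.
by rewrite /= mulr1; move: (k.+1%:R) => K1 K10; field.
Qed.

Lemma fug1 a : fug 1 a = a.
Proof. by rewrite /fug subrr mul0r expR0 mulr1. Qed.

Lemma Phi1 a : Phi 1 a = a.
Proof. by rewrite /Phi subrr !mul0r addr0. Qed.

Lemma subcritical1 a : 0 < a -> subcritical 1 a.
Proof. by move=> a0; split=> //; rewrite subrr mulr0 mul0r. Qed.

(** * The tail under the binomial measure *)

Section BinomialModel.
Variables (z x : R) (p t : nat -> R).
Hypotheses (sx : subcritical z x) (z_lt1 : z < 1).
Hypotheses (p0 : forall n, 0 <= p n) (p1 : forall n, p n <= 1).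
Hypothesis pc : (p n / q n @[n --> eventually] --> fug z x)%classic.
Hypotheses (t0 : forall n, 0 <= t n) (tz : z == 0 -> forall n, t n < 1).
Hypothesis tc : (t n / M n @[n --> eventually] --> Xlim z x)%classic.

Definition binomial_tail n : R :=
  \sum_(A : {set T n} | (A \subset K n) && ((ncov (E n) A)%:R <= t n))
    p n ^+ #|A| * (1 - p n) ^+ (#|K n| - #|A|).

Let l n := p n / (1 - p n).

Lemma p_lt1_near : \forall n \near eventually, p n < 1.
Proof.
have c0 : 0 < fug z x by rewrite fug_gt0 //; case: sx.
have cc : fug z x < fug z x + 1 by rewrite ltrDl.
have h : 0 < (fug z x + 2)^-1 by rewrite invr_gt0 addr_gt0.
apply: filterS2 (cvg_near_le pc cc) (q_small Hs h) => n pn qn.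
apply: le_lt_trans pn _; apply: (@le_lt_trans _ _ ((fug z x + 1) * (fug z x + 2)^-1)).
  by rewrite ler_wpM2l // addr_ge0 // ltW.
rewrite ltr_pdivrMr ?addr_gt0 //; lra.
Qed.

Lemma odds_asymp : asymp l (fug z x).
Proof.
have c0 : 0 < fug z x by rewrite fug_gt0 //; case: sx.
have [Hle Hge] := asymp_cvg pc; split=> c' cc'; last first.
  apply: filterS2 (Hge _ cc') p_lt1_near => n h pn; apply: le_trans h _.
  by rewrite ler_pdivlMr ?subr_gt0 // ler_piMr // lerBlDr lerDl.
pose c1 := (fug z x + c') / 2.
have cc1 : fug z x < c1 by rewrite /c1; lra.
have c1c' : c1 < c' by rewrite /c1; lra.
have c10 : 0 < c1 by apply: lt_trans cc1.
have c'0 : 0 < c' by apply: lt_trans c1c'.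
(* If [p n <= c1 * q n] and [q n] is below this constant, then [1 - p n >= c1 / c'], which turns the
   bound on [p n] into [l n <= c' * q n]. *)
have g0 : 0 < (1 - c1 / c') / c1 by rewrite divr_gt0 // subr_gt0 ltr_pdivrMr // mul1r.
apply: filterS3 (Hle _ cc1) (q_small Hs g0) p_lt1_near => n h qn pn.
have h' : p n <= 1 - c1 / c'.
  by apply: (le_trans h); rewrite mulrC -ler_pdivlMr.
have q0 : 0 <= q n by have := le_trans (p0 n) h; rewrite pmulr_rge0.
rewrite ler_pdivrMr ?subr_gt0 //; apply: (le_trans h).
rewrite [leRHS]mulrAC ler_wpM2r // [leRHS]mulrC -ler_pdivrMr //; lra.
Qed.

Let l0 n : 0 <= l n.
Proof. by rewrite divr_ge0 // subr_ge0. Qed.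

Lemma binomial_tailE : \forall n \near eventually, binomial_tail n =
  wt (l n) 1 (fun A : {set T n} => (ncov (E n) A)%:R <= t n) / Zn n (l n) 1.
Proof.
apply: filterS p_lt1_near => n pn; have q0 : 0 < 1 - p n by rewrite subr_gt0.
have ZE : Zn n (l n) 1 = (1 - p n) ^- #|K n|.
  rewrite Zn_binomial -exprVn; congr (_ ^+ _); rewrite /l; field; exact: lt0r_neq0.
rewrite ZE invrK /binomial_tail /wt mulr_suml; apply: eq_bigr => A /andP[AK _].
rewrite expr1n mulr1 /l expr_div_n -mulrA; congr (_ * _).
rewrite -[in RHS](subnK (subset_leq_card AK)) exprD mulrC mulfK //.
by rewrite expf_neq0 // gt_eqF.
Qed.

(** Chernoff gives the upper bound. For the lower bound, the tilt is taken at some [y < x], so that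
    the typical count falls strictly below [t n]; the window there lies in the event, and untilted
    weights increase with [l]. The term [- fug z x] is the normalization, as [Phi 1 a = a]. *)
Theorem binomial_tail_rate : ((M n)^-1 * ln (binomial_tail n) @[n --> eventually] -->
  Phi z x - lnw z (Xlim z x) - fug z x)%classic.
Proof.
have [z0 z1 x0 Hx] := sx.
have lc1 : asymp l (fug 1 (fug z x)) by rewrite fug1; exact: odds_asymp.
have [Zle Zge] := rate_lnZ (subcritical1 (fug_gt0 k z x0)) l0 lc1; rewrite Phi1 in Zle Zge.
have [zle zge] := rate_lnZ sx l0 odds_asymp.
have [tle tge] := rate_of_cvg HM tc.
pose Wt n := wt (l n) 1 (fun A : {set T n} => (ncov (E n) A)%:R <= t n).
have Wt0 n : 0 < Wt n.
  rewrite /Wt /wt (bigD1 set0) /=; last by rewrite sub0set ncov_set0 /=; exact: t0.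
  rewrite cards0 expr0 expr1n mulr1 ltr_pwDl //.
  by apply: sumr_ge0 => A _; rewrite expr1n mulr1 exprn_ge0.
have Wle : rate_le (fun n => ln (Wt n)) (- lnw z (Xlim z x) + Phi z x).
  have : rate_le (fun n => - lnw z (t n) + ln (Zn n (l n) z)) (- lnw z (Xlim z x) + Phi z x).
    apply: rate_leD => //; rewrite /lnw; case: eqP => [_|/eqP zn0].
      by have := @rate_le_cst _ _ HM 0; rewrite oppr0.
    have zp : 0 < z by rewrite lt_neqAle eq_sym zn0.
    have := rate_leZ HM (_ : 0 <= - ln z) tle; rewrite oppr_ge0 ln_le0 // => /(_ isT).
    rewrite mulNr => H e e0; apply: filterS (H e e0) => n; by rewrite mulNr.
  apply: rate_le_mono; apply: filterE => n.
  have Z0 := Zn_gt0 Hu n (l0 n) z0.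
  rewrite -ler_expR lnK ?posrE // expRD lnK ?posrE // ZnE.
  have := @wt_count_le n (l n) z (t n) xpredT (l0 n) z0 z1 (fun h => tz h n).
  by apply: le_trans; apply: wt_le.
have Wge : rate_ge (fun n => ln (Wt n)) (- lnw z (Xlim z x) + Phi z x).
  (* [Zn n (l n) 0] is the total weight of the sets without hyperedges, all of which satisfy the
     event. *)
  have [z00|zn0] := eqVneq z 0.
    rewrite /lnw z00 eqxx oppr0 add0r -z00.
    apply: rate_ge_mono zge; apply: filterE => n.
    rewrite ler_ln ?posrE ?(Zn_gt0 Hu) // ZnE /Wt /wt.
    rewrite big_mkcond [leRHS]big_mkcond /=; apply: ler_sum => A _; rewrite andbT.
    case: (A \subset K n) => //=; rewrite z00.
    case: ifP => [_|].
      by rewrite expr1n ler_wpM2l ?exprn_ge0 // expr0n lern1 leq_b1.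
    case: (ncov (E n) A) => [|m]; first by rewrite t0.
    by rewrite expr0n mulr0.
  have zp : 0 < z by rewrite lt_neqAle eq_sym zn0.
  have lz : ln z < 0 by rewrite ln_lt0 // zp.
  rewrite /lnw (negPf zn0); apply: (rate_ge_approx HM) => e e0.
  have e2 : 0 < e / 2 by rewrite divr_gt0.
  have [d1 d10 H1] := isder_continuity (isder_Phi k z x) e2.
  (* Lowering the count level from [Xlim z x] to [Xlim z y - w] then costs at most [- ln z * (2 * (e
     / (4 * - ln z))) = e / 2]; the other half of [e] pays for [Phi]. *)
  have e3 : 0 < e / (4 * - ln z) by rewrite divr_gt0 // mulr_gt0 // oppr_gt0.
  have [d2 d20 H2] := isder_continuity (isder_Xlim z x) e3.
  have dm : 0 < Num.min d1 d2 by rewrite lt_min d10.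
  have [y /andP[y0 yx]] := near_left x0 dm; rewrite lt_min => /andP[/H1 P1' /H2 X1].
  have sy : subcritical z y by apply: subcritical_le sx y0 _; exact: ltW.
  have XX : Xlim z y < Xlim z x by apply: Xlim_lt => //; exact: ltW.
  (* Half the gap, so [Xlim z y + w = Xlim z x - w]: the window ends where the lower bound on [t n]
     begins. *)
  pose w := (Xlim z x - Xlim z y) / 2.
  have w0 : 0 < w by rewrite divr_gt0 // subr_gt0.
  have [_ yge] := rate_lnZ_exact sy.
  exists (- (ln z * (Xlim z y - w)) + (0 + Phi z y)).
    move: P1' X1; rewrite !ltr_norml => /andP[P1' _] /andP[X1 _].
    have : - ln z * (Xlim z x - (Xlim z y - w)) <= e / 2.
      have -> : e / 2 = - ln z * (2 * (e / (4 * - ln z))).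
        by field; rewrite ?oppr_eq0 lt_eqF.
      rewrite ler_wpM2l ?oppr_ge0 ?(ltW lz) // /w; lra.
    lra.
  have := rate_geD (rate_ge_scale HM (- (ln z * (Xlim z y - w)))) (rate_geD (rate_ge_cst HM (ln 2^-1)) yge).
  apply: rate_ge_mono; near=> n.
  have qn : 0 < q n by near: n; exact: (q_gt0 Hs).
  have fy0 : 0 <= fug z y * q n by rewrite mulr_ge0 ?fug_ge0 // ltW.
  have ly : fug z y * q n <= l n.
    by near: n; apply: (proj2 odds_asymp); exact: fug_lt.
  have tn : (Xlim z x - w) * M n <= t n by near: n; exact: tge.
  have Z0 := Zn_gt0 Hu n fy0 z0.
  have win : 2^-1 * Zn n (fug z y * q n) z <= wt (fug z y * q n) z (fun A : {set T n} =>
      ((y - w) * M n <= #|A|%:R <= (y + w) * M n) &&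
      ((Xlim z y - w) * M n <= (ncov (E n) A)%:R <= (Xlim z y + w) * M n)).
    by near: n; apply: full_window => //; rewrite zp z_lt1.
  have {}win : expR (- (ln z * (Xlim z y - w)) * M n) * (2^-1 * Zn n (fug z y * q n) z) <= Wt n.
    apply: le_trans (ler_wpM2l (expR_ge0 _) win) _; rewrite mulNr -mulrA.
    have tt : (Xlim z y + w) * M n <= t n.
      by apply: le_trans tn; rewrite ler_wpM2r ?mulr_ge0 ?(ltW qn) // /w; lra.
    have tw := @tilted_window_le n _ z ((Xlim z y - w) * M n) _ _
      (fun A : {set T n} => (y - w) * M n <= #|A|%:R <= (y + w) * M n) fy0 zp (ltW z_lt1) tt.
    apply: (le_trans tw).
    apply: (@le_trans _ _ (wt (fug z y * q n) 1 (fun A : {set T n} => (ncov (E n) A)%:R <= t n))).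
      by apply: wt_le => // A _ /andP[].
    by apply: ler_sum => A _; rewrite expr1n !mulr1; apply: lerXn2r; rewrite ?nnegrE.
  rewrite -ler_expR (lnK (Wt0 n)); apply: le_trans win.
  by rewrite expRD expRD !lnK ?posrE.
have -> : Phi z x - lnw z (Xlim z x) - fug z x = - lnw z (Xlim z x) + Phi z x - fug z x by ring.
apply: (cvg_of_rate HM).
  apply: rate_le_mono (rate_leD Wle (rate_leN Zge)).
  apply: filterS binomial_tailE => n ->.
  by rewrite ln_div ?posrE ?(Zn_gt0 Hu) // -/(Wt n).
apply: rate_ge_mono (rate_geD Wge (rate_geN Zle)).
apply: filterS binomial_tailE => n ->.
by rewrite ln_div ?posrE ?(Zn_gt0 Hu) // -/(Wt n).
Unshelve. all: end_near.
Qed.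

End BinomialModel.

(** * The tail under the uniform measure on sets of fixed size *)

Section UniformModel.
Variables (z b : R) (m : nat -> nat) (t : nat -> R).
Hypotheses (sb : subcritical z b) (z_lt1 : z < 1).
Hypothesis mc : ((m n)%:R / M n @[n --> eventually] --> b)%classic.
Hypotheses (t0 : forall n, 0 <= t n) (tz : z == 0 -> forall n, t n < 1).
Hypothesis tc : (t n / M n @[n --> eventually] --> Xlim z b)%classic.

Definition uniform_tail n : R := frac R (K n) (fun A => (ncov (E n) A)%:R <= t n) (m n).

Let D n (A : {set T n}) := (ncov (E n) A)%:R <= t n.

Let D_down n (A : {set T n}) v : D (v |: A) -> D A.
Proof. by apply: le_trans; rewrite ler_nat; apply: ncov_le => //; exact: subsetUr. Qed.

Lemma wt1_gsum n l (P : pred {set T n}) : wt l 1 P = gsum (K n) l P.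
Proof. by apply: eq_bigr => A _; rewrite expr1n mulr1. Qed.

Lemma fug_split z' y qn (a : nat) :
  (fug z' y * qn) ^+ a = expR (a%:R * ((1 - z') * y ^+ k)) * (y * qn) ^+ a.
Proof. by rewrite expRM_natl -exprMn; congr (_ ^+ _); rewrite /fug; ring. Qed.

Lemma size_le_card : \forall n \near eventually, (m n <= #|K n|)%N.
Proof.
have [mle _] := rate_of_cvg HM mc; have [_ _ b0 _] := sb.
have h : 0 < (b + 1)^-1 by rewrite invr_gt0 addr_gt0.
apply: filterS2 (mle _ ltr01) (q_small Hs h) => n mn qn.
rewrite -(ler_nat R); apply: le_trans mn _; rewrite mulrCA ler_piMr //.
have b1 : 0 < b + 1 by rewrite addr_gt0.
by apply: le_trans (ler_wpM2l (ltW b1) qn) _; rewrite divff // gt_eqF.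
Qed.

(** Sizes near [y * M n] exceed [m n], so the fraction at [m n] is at least the share of the event
    in that size window. The numerator of the share is bounded below by the tilted window at
    [(z', y)], where the typical count stays below the threshold; at [z' = 0] the count vanishes on
    all sets of positive weight. *)
Lemma uniform_tail_lower z' y w : subcritical z' y -> z' < 1 ->
  (z' == 0) || (Xlim z' y + w < Xlim z b) -> 0 < w -> b < y - w ->
  \forall n \near eventually,
    expR (- lnw z' (Xlim z' y - w) * M n + (ln (Zn n (fug z' y * q n) z') +
      (- ((1 - z') * y ^+ k * (y + w)) * M n + (- ln 2 - ln (Zn n (y * q n) 1)))))
    <= uniform_tail n.
Proof.
move=> sy z'1 Xc w0 byw; have [z'0 _ y0 _] := sy.
have [mle _] := rate_of_cvg HM mc; have [_ tge] := rate_of_cvg HM tc.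
have e1 : 0 < y - w - b by rewrite subr_gt0.
have Hpos : z' != 0 -> 0 < z' < 1 /\ Xlim z' y + w < Xlim z b.
  move=> zn0; split; first by rewrite lt_neqAle eq_sym zn0 z'0.
  by move: Xc; rewrite (negPf zn0).
have Hwin : \forall n \near eventually, z' != 0 -> 2^-1 * Zn n (fug z' y * q n) z' <=
    wt (fug z' y * q n) z' (fun A : {set T n} => ((y - w) * M n <= #|A|%:R <= (y + w) * M n) &&
      ((Xlim z' y - w) * M n <= (ncov (E n) A)%:R <= (Xlim z' y + w) * M n)).
  have [z00|zn0] := eqVneq z' 0; first by apply: filterE.
  by apply: filterS (full_window k_gt1 Hu Hs HM sy (proj1 (Hpos zn0)) w0) => n h _.
have Ht : \forall n \near eventually, z' != 0 -> (Xlim z' y + w) * M n <= t n.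
  have [z00|zn0] := eqVneq z' 0; first by apply: filterE.
  have e2 : 0 < Xlim z b - (Xlim z' y + w) by rewrite subr_gt0; case: (Hpos zn0).
  by apply: filterS (tge _ e2) => n h _; rewrite subKr in h.
near=> n.
have qn : 0 < q n by near: n; exact: (q_gt0 Hs).
have M0 : 0 <= M n by near: n; exact: HM.
pose l := fug z' y * q n; have l0 : 0 <= l by rewrite mulr_ge0 ?fug_ge0 // ltW.
have m0 : 0 <= y * q n by rewrite mulr_ge0 // ltW.
pose W (j : nat) := (y - w) * M n <= j%:R <= (y + w) * M n.
have mn : (m n)%:R <= (y - w) * M n.
  have : (m n)%:R <= (b + (y - w - b)) * M n by near: n; exact: mle.
  by rewrite subrKC.
have Wm j : W j -> (m n <= j)%N.
  by move=> /andP[jw _]; rewrite -(ler_nat R); apply: le_trans mn jw.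
have h1 := gsum_le_frac (K n) (@D_down n) l0 Wm.
have h2 : expR (- lnw z' (Xlim z' y - w) * M n) * (2^-1 * Zn n l z') <=
    gsum (K n) l (fun A => W #|A| && D A).
  rewrite -wt1_gsum; have [z00|zn0] := eqVneq z' 0.
    have win : 2^-1 * Zn n l z' <= wt l z' (fun A : {set T n} => W #|A|).
      by rewrite /l /W; near: n; exact: size_window.
    rewrite /lnw z00 eqxx oppr0 mul0r expR0 mul1r -{1}z00; apply: le_trans win _.
    rewrite /wt big_mkcond [leRHS]big_mkcond /=; apply: ler_sum => A _.
    case: (A \subset K n) => //=; case: (W _) => //=; rewrite z00 /D.
    case: ifP => [_|].
      by rewrite expr1n ler_wpM2l ?exprn_ge0 // expr0n lern1 leq_b1.
    case: (ncov (E n) A) => [|m']; first by rewrite t0.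
    by rewrite expr0n mulr0.
  have [/andP[zp _] _] := Hpos zn0.
  have win : 2^-1 * Zn n l z' <= wt l z' (fun A : {set T n} => W #|A| &&
      ((Xlim z' y - w) * M n <= (ncov (E n) A)%:R <= (Xlim z' y + w) * M n)).
    by move: zn0; rewrite /l /W; near: n.
  rewrite /lnw (negPf zn0) mulNr -mulrA; apply: le_trans (ler_wpM2l (expR_ge0 _) win) _.
  have tt : (Xlim z' y + w) * M n <= t n by move: zn0; near: n.
  exact: (@tilted_window_le n _ z' _ _ _ (fun A : {set T n} => W #|A|) l0 zp (ltW z'1) tt).
(* The denominator uses the tilted fugacity without the tilt in the count. Going back to [y * q n]
   costs [expR ((1 - z') * y ^+ k)] per element, for at most [(y + w) * M n] elements. *)
have h3 : gsum (K n) l (fun A => W #|A|) <=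
    expR ((1 - z') * y ^+ k * (y + w) * M n) * Zn n (y * q n) 1.
  rewrite -wt1_gsum; apply: wt_tilt => //.
  move=> A AK /andP[_ sA]; rewrite !expr1n !mulr1 /l fug_split ler_wpM2r ?exprn_ge0 //.
  rewrite ler_expR mulrC -[leRHS]mulrA ler_wpM2l // mulr_ge0 ?subr_ge0 ?exprn_ge0 // ltW //.
have Z1 := Zn_gt0 Hu n m0 (@ler01 R); have Z2 := Zn_gt0 Hu n l0 z'0.
have f0 : 0 <= uniform_tail n by apply: frac_ge0.
have h4 : expR (- lnw z' (Xlim z' y - w) * M n) * (2^-1 * Zn n l z') <=
    uniform_tail n * (expR ((1 - z') * y ^+ k * (y + w) * M n) * Zn n (y * q n) 1).
  by apply: le_trans h2 (le_trans h1 _); rewrite ler_wpM2l.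
rewrite -ler_pdivrMr ?mulr_gt0 ?expR_gt0 // in h4.
apply: le_trans h4; rewrite !expRD [expR (- ((1 - z') * _ * _) * _)](_ : _ =
  (expR ((1 - z') * y ^+ k * (y + w) * M n))^-1); last by rewrite -expRN mulNr.
rewrite [expR (- ln 2)]expRN [expR (- ln _)]expRN !lnK ?posrE // -/l.
by rewrite invfM le_eqVlt; apply/orP; left; apply/eqP; ring.
Unshelve. all: end_near.
Qed.

(** The size must be pushed above [b] while the typical count must not rise, so for [z > 0] the tilt
    has to be strengthened at the same time. Both changes are small, and the rate is continuous
    along them. *)
Lemma uniform_tail_params e : 0 < e -> exists z' y, [/\ b < y, subcritical z' y, z' < 1,
   (z' == 0) || (Xlim z' y < Xlim z b) &
   - lnw z (Xlim z b) + (Phi z b - (1 - z) * b ^+ k * b - b) - e <=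
   - lnw z' (Xlim z' y) + (Phi z' y - (1 - z') * y ^+ k * y - y)].
Proof.
move=> e0; have [z0 z1 b0 Hb] := sb; have [z00|zn0] := eqVneq z 0.
  have HD := isder_sub (isder_sub (isder_Phi k z b) (isder_mul (isder_scale (1 - z)
    (isder_pow k (isder_id b))) (isder_id b))) (isder_id b).
  have [d d0 Hd] := isder_continuity HD e0.
  have [y /andP[yb yd] sy] := subcritical_right sb d0.
  have /Hd : `|y - b| < d by rewrite gtr0_norm ?subr_gt0 // ltrBlDl.
  rewrite ltr_norml => /andP[Hy _].
  exists z, y; split=> //; first by rewrite z00 eqxx.
  rewrite /lnw z00 eqxx -z00; lra.
have zp : 0 < z by rewrite lt_neqAle eq_sym zn0.
(* [Xlim z y] is proportional to [z * y ^+ k.+1], so along this curve it is multiplied by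
   [(1 - s) * (1 - s ^+ 2) ^+ k.+1 < 1]; this is why the exponent is [k.+2]. *)
pose zs (s : R) := z * (1 - s) ^+ k.+2; pose ys (s : R) := b * (1 + s).
have Dz := isder_scale z (isder_pow k.+2 (isder_sub (isder_cst 0 1) (isder_id 0))).
have Dy := isder_scale b (isder_add (isder_cst 0 1) (isder_id 0)).
have D1 := isder_sub (isder_cst 0 1) Dz.
have Dk := isder_scale k%:R (isder_mul D1 (isder_pow k Dy)).
have zs0 : zs 0 = z by rewrite /zs subr0 expr1n mulr1.
have ys0 : ys 0 = b by rewrite /ys addr0 mulr1.
have zpos : 0 < z * (1 - 0) ^+ k.+2 by rewrite -/(zs 0) zs0.
have Dln := @isder_ln _ (fun s : R => z * (1 - s) ^+ k.+2) 0 _ zpos Dz.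
have DX := isder_mul Dz (isder_mul (isder_pow k.+1 Dy) (isder_cst 0 k.+1%:R^-1)).
have DP := isder_mul (isder_mul D1 (isder_pow k.+1 Dy)) (isder_cst 0 (k%:R / k.+1%:R - 1)).
have gap : 0 < 1 - k%:R * (1 - z) * b ^+ k by rewrite subr_gt0.
have [d1 d10 H1] := isder_continuity Dk gap.
have [d2 d20 H2] := isder_continuity (isder_sub DP (isder_mul Dln DX)) e0.
pose s : R := Num.min 1 (Num.min d1 d2) / 2.
have m0 : 0 < Num.min 1 (Num.min d1 d2) by rewrite !lt_min ltr01 d10.
have s0 : 0 < s by rewrite divr_gt0.
have : s < Num.min 1 (Num.min d1 d2) by rewrite ltr_pdivrMr // ltr_pMr ?ltr1n.
rewrite !lt_min => /and3P[s1 sd1 sd2].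
have ns : `|s - 0| = s by rewrite subr0 gtr0_norm.
have {H1} := H1 s; rewrite ns => /(_ sd1); have {H2} := H2 s; rewrite ns => /(_ sd2).
rewrite -/(zs s) -/(ys s) -/(zs 0) -/(ys 0) zs0 ys0 !ltr_norml => /andP[G _] /andP[_ S].
have u0 : 0 < 1 - s by rewrite subr_gt0.
have u1 : 1 - s <= 1 by rewrite gerBl ltW.
have by' : b < ys s by rewrite /ys ltr_pMr // ltrDl.
have zsp : 0 < zs s by rewrite mulr_gt0 ?exprn_gt0.
have zsz : zs s <= z by rewrite ler_piMr // exprn_ile1 // ltW.
exists (zs s), (ys s); split=> //.
- split; [exact: ltW|exact: le_trans zsz z1|exact: lt_trans by'|].
  by move: S; rewrite -!mulrA; lra.
- exact: le_lt_trans zsz z_lt1.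
- apply/orP; right; rewrite /Xlim !mulrA ltr_pM2r ?invr_gt0 ?ltr0n //.
  have huv : (1 - s) ^+ k.+2 * (1 + s) ^+ k.+1 < 1.
    rewrite exprS -mulrA -exprMn; apply: (@le_lt_trans _ _ (1 - s)); last by rewrite gtrBl.
    by rewrite ler_piMr ?(ltW u0) // exprn_ile1 //; nra.
  rewrite (_ : zs s * _ = z * b ^+ k.+1 * ((1 - s) ^+ k.+2 * (1 + s) ^+ k.+1)).
    by rewrite gtr_pMr // mulr_gt0 ?exprn_gt0.
  by rewrite /zs /ys exprMn; ring.
have PE z' y : Phi z' y - (1 - z') * y ^+ k * y - y = (1 - z') * y ^+ k.+1 * (k%:R / k.+1%:R - 1).
  by rewrite /Phi exprSr; ring.
rewrite !PE /lnw (negPf zn0) (gt_eqF zsp) /Xlim; move: G; rewrite /=.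
move: (ln (zs s) * _) (ln z * _) ((1 - zs s) * _ * _) ((1 - z) * _ * _) => A1 A2 A3 A4; lra.
Qed.

Lemma uniform_tail_lower_params e : 0 < e -> exists z' y w, [/\ subcritical z' y, z' < 1,
   (z' == 0) || (Xlim z' y + w < Xlim z b), 0 < w & b < y - w /\
   - lnw z (Xlim z b) + (Phi z b - (1 - z) * b ^+ k * b - b) - e <=
   - lnw z' (Xlim z' y - w) + (Phi z' y - (1 - z') * y ^+ k * (y + w) - y)].
Proof.
move=> e0; have e2 : 0 < e / 2 by rewrite divr_gt0.
have [z' [y [yb sy z'1 Xc H]]] := uniform_tail_params e2.
have [z'0 z'1' y0 _] := sy.
(* The loss per unit of window width [w], from the count level and from the size, plus 1 to make it
   positive. *)
pose C := - lnw z' 1 + (1 - z') * y ^+ k + 1.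
have ln0 : 0 <= - lnw z' 1.
  by rewrite /lnw; case: ifP => _; rewrite ?oppr0 // mulr1 oppr_ge0 ln_le0.
have C0 : 0 < C.
  by rewrite ltr_wpDl // addr_ge0 // mulr_ge0 ?subr_ge0 ?exprn_ge0 // ltW.
have lnwB a w : lnw z' (a - w) = lnw z' a - lnw z' 1 * w.
  by rewrite /lnw; case: ifP => _; [rewrite mul0r subr0|ring].
have [w w0 [wy wX wC]] : exists2 w, 0 < w & [/\ w < y - b,
    (z' == 0) || (Xlim z' y + w < Xlim z b) & w * C <= e / 2].
  pose g := if z' == 0 then 1 else (Xlim z b - Xlim z' y) / 2.
  have g0 : 0 < g by rewrite /g; case: ifP Xc => //= _ h; rewrite divr_gt0 // subr_gt0.
  have yb2 : 0 < (y - b) / 2 by rewrite divr_gt0 // subr_gt0.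
  exists (Num.min ((y - b) / 2) (Num.min g (e / 2 / C))).
    by rewrite !lt_min yb2 g0 divr_gt0.
  split.
  - apply: (@le_lt_trans _ _ ((y - b) / 2)); first by rewrite ge_min lexx.
    by rewrite ltr_pdivrMr // ltr_pMr ?ltr1n // subr_gt0.
  - move: Xc; rewrite /g; case: eqP => //= _ Xc.
    apply: (@le_lt_trans _ _ (Xlim z' y + (Xlim z b - Xlim z' y) / 2)); last lra.
    by rewrite lerD2l !ge_min lexx orbT.
  - by rewrite -ler_pdivlMr // !ge_min lexx !orbT.
exists z', y, w; split=> //; split; first by rewrite ltrBrDr addrC -ltrBrDr.
rewrite lnwB; move: wC H; rewrite /C; lra.
Qed.

Lemma uniform_tail_gt0 : \forall n \near eventually, 0 < uniform_tail n.
Proof.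
have [z' [y [w [sy z'1 Xc w0 [byw _]]]]] := uniform_tail_lower_params ltr01.
by apply: filterS (uniform_tail_lower sy z'1 Xc w0 byw) => n; apply: lt_le_trans; exact: expR_gt0.
Qed.

Lemma rate_ge_uniform_tail :
  rate_ge (fun n => ln (uniform_tail n)) (- lnw z (Xlim z b) + (Phi z b - (1 - z) * b ^+ k * b - b)).
Proof.
apply: (rate_ge_approx HM) => e e0.
have [z' [y [w [sy z'1 Xc w0 [byw H]]]]] := uniform_tail_lower_params e0.
have [_ _ y0 _] := sy.
exists (- lnw z' (Xlim z' y - w) + (Phi z' y + (- ((1 - z') * y ^+ k * (y + w)) + (0 - y)))).
  by lra.
have [_ Zge] := rate_lnZ_exact sy; have [Zle _] := rate_lnZ_exact (subcritical1 y0).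
rewrite Phi1 in Zle.
have R1 := rate_geD (rate_ge_scale HM (- lnw z' (Xlim z' y - w))) (rate_geD Zge
  (rate_geD (rate_ge_scale HM (- ((1 - z') * y ^+ k * (y + w))))
  (rate_geD (rate_ge_cst HM (- ln 2)) (rate_geN Zle)))).
apply: rate_ge_mono R1; apply: filterS2 (uniform_tail_lower sy z'1 Xc w0 byw) uniform_tail_gt0 => n h f0.
by rewrite -ler_expR (lnK f0) fug1.
Qed.

(** Now the size window lies below [m n], around some [y < b], so the fraction at [m n] is at most
    the share of the event in it. Untilted concentration bounds the denominator of the share from
    below, and Chernoff bounds its numerator from above. *)
Lemma rate_le_uniform_tail :
  rate_le (fun n => ln (uniform_tail n)) (- lnw z (Xlim z b) + (Phi z b - (1 - z) * b ^+ k * b - b)).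
Proof.
have [z0 z1 b0 Hb] := sb.
pose H y := Phi z y - (1 - z) * y ^+ k * (y - (b - y) / 2) - y.
have [mle mge] := rate_of_cvg HM mc; have [tle tge] := rate_of_cvg HM tc.
have Gle : rate_le (fun n => - lnw z (t n)) (- lnw z (Xlim z b)).
  rewrite /lnw; case: eqP => [_|/eqP zn0].
    by have := @rate_le_cst _ _ HM 0; rewrite oppr0.
  have zp : 0 < z by rewrite lt_neqAle eq_sym zn0.
  have := rate_leZ HM (_ : 0 <= - ln z) tle; rewrite oppr_ge0 ln_le0 // => /(_ isT).
  by rewrite mulNr => h e e0; apply: filterS (h e e0) => n; rewrite mulNr.
apply: (rate_le_approx HM) => e e0.
have HD := isder_sub (isder_sub (isder_Phi k z b) (isder_mul (isder_scale (1 - z) (isder_pow k (isder_id b)))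
  (isder_sub (isder_id b) (isder_mul (isder_sub (isder_cst b b) (isder_id b)) (isder_cst b 2^-1))))) (isder_id b).
have [d d0 Hd] := isder_continuity HD e0.
have [y /andP[y0 yb] /Hd] := near_left b0 d0.
rewrite ltr_norml subrr mul0r subr0 => /andP[_ Hy].
have sy : subcritical z y by apply: subcritical_le sb y0 _; exact: ltW.
(* Half the gap, so [y + w = b - w]: the window ends where the lower bound on [m n] begins. *)
pose w := (b - y) / 2; have w0 : 0 < w by rewrite divr_gt0 // subr_gt0.
exists (- lnw z (Xlim z b) + (- ((1 - z) * y ^+ k * (y - w)) + (Phi z y + (ln 2 * 0 - y)))).
  rewrite mulr0 /w; lra.
have [Zle _] := rate_lnZ_exact sy; have [_ Zge] := rate_lnZ_exact (subcritical1 y0).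
rewrite Phi1 in Zge.
have R1 := rate_leD Gle (rate_leD (rate_le_scale HM (- ((1 - z) * y ^+ k * (y - w))))
  (rate_leD Zle (rate_leD (rate_leZ HM (ln_ge0 (ler1n R 2)) (rate_le_cst HM 1)) (rate_leN Zge)))).
apply: rate_le_mono R1; near=> n.
have qn : 0 < q n by near: n; exact: (q_gt0 Hs).
have fn0 : 0 < uniform_tail n by near: n; exact: uniform_tail_gt0.
have mK : (m n <= #|K n|)%N by near: n; exact: size_le_card.
have M0 : 0 <= M n by near: n; exact: HM.
pose l := y * q n; have l0 : 0 <= l by rewrite mulr_ge0 // ltW.
have l'0 : 0 <= fug z y * q n by rewrite mulr_ge0 ?fug_ge0 // ltW.
pose W (j : nat) := (y - w) * M n <= j%:R <= (y + w) * M n.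
have Wm j : W j -> (j <= m n)%N.
  move=> /andP[_ jw]; rewrite -(ler_nat R); apply: le_trans jw _.
  apply: le_trans (_ : (b - w) * M n <= _).
    by rewrite ler_wpM2r // /w; lra.
  by near: n; exact: mge.
have Z1 := Zn_gt0 Hu n l0 (@ler01 R).
have h1 := frac_le_gsum (@D_down n) l0 mK Wm.
have h2 : 2^-1 * Zn n l 1 <= gsum (K n) l (fun A => W #|A|).
  have : 2^-1 * Zn n (fug 1 y * q n) 1 <= wt (fug 1 y * q n) 1 (fun A : {set T n} => (y - w) * M n <= #|A|%:R <= (y + w) * M n).
    by near: n; apply: size_window => //; exact: subcritical1.
  by rewrite fug1 wt1_gsum.
have h3 : gsum (K n) l (fun A => W #|A| && D A) <= expR (- lnw z (t n)) * wt l z (fun A : {set T n} => W #|A|).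
  by rewrite -wt1_gsum; exact: (@wt_count_le n l z (t n) (fun A => W #|A|) l0 z0 z1 (fun h => tz h n)).
(* Raising the fugacity from [y * q n] to [fug z y * q n] gains [expR ((1 - z) * y ^+ k)] for each
   of at least [(y - w) * M n] elements. *)
have h4 : wt l z (fun A : {set T n} => W #|A|) <= expR (- ((1 - z) * y ^+ k * (y - w)) * M n) * Zn n (fug z y * q n) z.
  apply: wt_tilt => //.
  move=> A AK /andP[sA _]; rewrite fug_split !mulrA -expRD mulrC [leRHS]mulrC ler_wpM2l ?exprn_ge0 //.
  rewrite -[leLHS]mul1r ler_wpM2r ?exprn_ge0 // -[leLHS]expR0 ler_expR.
  have : 0 <= (#|A|%:R - (y - w) * M n) * ((1 - z) * y ^+ k).
    by rewrite mulr_ge0 ?subr_ge0 // mulr_ge0 ?subr_ge0 // exprn_ge0 // ltW.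
  rewrite /M; lra.
have Zz := Zn_gt0 Hu n l'0 z0.
have h5 : uniform_tail n * (2^-1 * Zn n l 1) <= expR (- lnw z (t n)) *
   (expR (- ((1 - z) * y ^+ k * (y - w)) * M n) * Zn n (fug z y * q n) z).
  apply: (@le_trans _ _ (uniform_tail n * gsum (K n) l (fun A => W #|A|))).
    by rewrite ler_wpM2l // ltW.
  apply: le_trans h1 _; apply: le_trans h3 _; rewrite ler_wpM2l ?expR_ge0 //.
rewrite -ler_expR (lnK fn0) mulr1 !expRD [expR (- ln _)]expRN !lnK ?posrE ?fug1 //.
apply: (@le_trans _ _ (expR (- lnw z (t n)) * (expR (- ((1 - z) * y ^+ k * (y - w)) * M n) *
  Zn n (fug z y * q n) z) / (2^-1 * Zn n l 1))); first by rewrite ler_pdivlMr // mulr_gt0 // invr_gt0.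
by rewrite invfM invrK -/l !mulrA.
Unshelve. all: end_near.
Qed.

Theorem uniform_tail_rate : ((M n)^-1 * ln (uniform_tail n) @[n --> eventually] -->
  - lnw z (Xlim z b) + (Phi z b - (1 - z) * b ^+ k * b - b))%classic.
Proof. exact: (cvg_of_rate HM) rate_le_uniform_tail rate_ge_uniform_tail. Qed.

End UniformModel.
End LowerTail.

(** * Copies of a graph *)

Section Copies.
Variables (h : nat) (EH : {set {set 'I_h}}).

Definition cp n (f : {ffun 'I_h -> 'I_n}) : {set {set 'I_n}} :=
  [set f @: (e : {set 'I_h}) | e in EH].

Definition embeddings n := [set f : {ffun 'I_h -> 'I_n} | injectiveb f].

(** A copy is recorded by its edge set alone; once [EH] covers all vertices, the edge set determines
    the vertex set too. *)
Definition copies n : {set {set {set 'I_n}}} := [set cp f | f in embeddings n].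

Lemma embeddingsP n (f : {ffun 'I_h -> 'I_n}) : reflect (injective f) (f \in embeddings n).
Proof. by rewrite inE; exact: injectiveP. Qed.

Lemma card_cp n (f : {ffun 'I_h -> 'I_n}) : injective f -> #|cp f| = #|EH|.
Proof. by move=> fi; rewrite card_imset //; exact: imset_inj. Qed.

Lemma mem_cp n (f : {ffun 'I_h -> 'I_n}) (e : {set 'I_h}) : injective f -> (f @: e \in cp f) = (e \in EH).
Proof. by move=> fi; rewrite mem_imset //; exact: imset_inj. Qed.

Lemma cp_subset n (f : {ffun 'I_h -> 'I_n}) (G : {set {set 'I_n}}) :
  (cp f \subset G) = [forall e : {set 'I_h} in EH, f @: e \in G].
Proof.
apply/subsetP/forall_inP => [H e eE|H c /imsetP[e eE ->]]; last exact: H.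
by apply: H; apply: imset_f.
Qed.

Lemma uniform_copies n k : is_graph h EH -> #|EH| = k.+1 -> uniform (Kn n) (copies n) k.
Proof.
move=> /forall_inP gH cE c /imsetP[f /embeddingsP fi ->]; rewrite card_cp //; split=> //.
by apply/subsetP => v /imsetP[e eE ->]; rewrite inE card_imset // gH.
Qed.

Lemma card_embeddings n : #|embeddings n| = (n ^_ h)%N.
Proof. by rewrite /embeddings card_inj_ffuns !card_ord. Qed.

Hypothesis covE : cover EH = [set: 'I_h].

Lemma cover_cp n (f : {ffun 'I_h -> 'I_n}) : cover (cp f) = f @: [set: 'I_h].
Proof.
apply/setP => x; apply/bigcupP/imsetP => [[c /imsetP[e eE ->] /imsetP[y ye ->]]|[y _ ->]].
  by exists y.
have /bigcupP[e eE ye] : y \in cover EH by rewrite covE inE.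
by exists (f @: e); apply: imset_f.
Qed.

Definition automorphisms := [set s : {ffun 'I_h -> 'I_h} | injectiveb s &&
       [forall e : {set 'I_h}, (e \in EH) == (s @: e \in EH)]].

Lemma automorphisms_gt0 : (0 < #|automorphisms|)%N.
Proof.
apply/card_gt0P; exists [ffun x => x]; rewrite /automorphisms inE; apply/andP; split.
  by apply/injectiveP => x y; rewrite !ffunE.
apply/forallP => e; apply/eqP; congr (_ \in EH); rewrite -[LHS]imset_id.
by apply: eq_imset => x; rewrite ffunE.
Qed.

(** Embeddings with the same image have the same range, because [EH] covers all vertices; hence they
    differ by a permutation of the vertices, which must preserve [EH]. *)
Lemma card_fiber n c : c \in copies n ->
  #|[set f in embeddings n | cp f == c]| = #|automorphisms|.
Proof.
move=> /imsetP[f0 /embeddingsP f0i ->{c}].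
have <- : (fun s : {ffun 'I_h -> 'I_h} => [ffun x => f0 (s x)]) @: automorphisms =
    [set f in embeddings n | cp f == cp f0].
  apply/setP => f; apply/imsetP/idP => [[s]|].
    rewrite /automorphisms inE => /andP[/injectiveP si /forallP sE] ->.
    have fi : injective [ffun x => f0 (s x)] by move=> x y; rewrite !ffunE => /f0i/si.
    rewrite inE; apply/andP; split; first exact/embeddingsP.
    rewrite eqEcard !card_cp // leqnn andbT; apply/subsetP => c /imsetP[e eE ->].
    have -> : [ffun x => f0 (s x)] @: e = f0 @: (s @: e).
      by rewrite -imset_comp; apply: eq_imset => x; rewrite ffunE.
    by rewrite mem_cp // -(eqP (sE e)).
  rewrite inE => /andP[/embeddingsP fi /eqP ff0].
  have H x : exists y, f0 y == f x.
    have : f x \in cover (cp f) by rewrite cover_cp imset_f.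
    by rewrite ff0 cover_cp => /imsetP[y _ ->]; exists y.
  pose s := [ffun x => xchoose (H x)].
  have sP x : f0 (s x) = f x by rewrite ffunE; exact: (eqP (xchooseP (H x))).
  have fE (e : {set 'I_h}) : f @: e = f0 @: (s @: e).
    by rewrite -imset_comp; apply: eq_imset => x; rewrite /= sP.
  exists s; last by apply/ffunP => x; rewrite ffunE sP.
  rewrite /automorphisms inE; apply/andP; split.
    by apply/injectiveP => x y e; apply: fi; rewrite -!sP e.
  by apply/forallP => e; rewrite -(mem_cp _ fi) ff0 fE mem_cp.
rewrite card_in_imset // => s s' _ _ e; apply/ffunP => x; apply: f0i.
by have := congr1 (fun g : {ffun 'I_h -> 'I_n} => g x) e; rewrite !ffunE.
Qed.

Lemma card_embeddings_in n (P : pred {set {set 'I_n}}) :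
  #|[set f in embeddings n | P (cp f)]| = (#|[set c in copies n | P c]| * #|automorphisms|)%N.
Proof.
rewrite -sum1_card (partition_big (@cp n) (fun c => (c \in copies n) && P c)) /=.
  rewrite (eq_bigr (fun=> #|automorphisms|)).
    by rewrite sum_nat_const; congr (_ * _)%N; apply: eq_card => c; rewrite [RHS]inE.
  move=> c /andP[cc Pc]; rewrite -(card_fiber cc) -sum1_card; apply: eq_bigl => f.
  by rewrite !inE; case: eqP => [->|]; rewrite ?Pc ?andbT ?andbF.
by move=> f; rewrite inE => /andP[fe ->]; rewrite imset_f.
Qed.

Lemma XH_ncov (R : realType) n (G : {set {set 'I_n}}) :
  XH R h n EH G = (ncov (copies n) G)%:R.
Proof.
have a0 : (autH h EH)%:R != 0 :> R by rewrite pnatr_eq0 -lt0n automorphisms_gt0.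
have -> : XH R h n EH G = (#|[set f in embeddings n | cp f \subset G]|)%:R / (autH h EH)%:R.
  congr (_%:R / _); apply: eq_card => f; rewrite [RHS]inE [LHS]inE inE; congr (_ && _).
  by rewrite cp_subset.
by rewrite (card_embeddings_in (fun c => c \subset G)) natrM mulfK.
Qed.

Lemma card_copies n : (#|copies n| * #|automorphisms| = n ^_ h)%N.
Proof.
have := @card_embeddings_in n xpredT; rewrite -card_embeddings.
have -> : [set f in embeddings n | true] = embeddings n by apply/setP=> f; rewrite !inE andbT.
by have -> : [set c in copies n | true] = copies n by apply/setP=> c; rewrite !inE andbT.
Qed.

Definition dg n (v : {set 'I_n}) := #|[set c in copies n | v \in c]|.

(** A product of two transpositions of the vertices of [K_n] carries [v] to [w] and maps copies to
    copies injectively. *)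
Lemma dg_le n (v w : {set 'I_n}) : v \in Kn n -> w \in Kn n -> (dg v <= dg w)%N.
Proof.
rewrite 2!inE => /cards2P[a [b [ab ->]]] /cards2P[c [d [cd ->]]].
pose p1 := tperm a c; pose p2 := tperm (p1 b) d.
have p1bc : p1 b != c.
  by rewrite -[X in _ != X](tpermL a c) (inj_eq perm_inj) eq_sym.
pose p x := p2 (p1 x).
have pi : injective p by move=> x y /perm_inj/perm_inj.
have pE : p @: [set a; b] = [set c; d].
  rewrite imsetU1 imset_set1 /p /p1 tpermL /p2 tpermL tpermD // eq_sym //.
have Pi := imset_inj (imset_inj pi).
rewrite /dg -(card_imset _ Pi); apply: subset_leq_card; apply/subsetP => C /imsetP[C'].
rewrite inE => /andP[/imsetP[f /embeddingsP fi ->] vC] ->; rewrite inE; apply/andP; split.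
  apply/imsetP; exists [ffun x => p (f x)].
    by apply/embeddingsP => x y; rewrite !ffunE => /pi/fi.
  rewrite /cp -imset_comp; apply: eq_imset => e /=; rewrite -imset_comp.
  by apply: eq_imset => x; rewrite ffunE.
by rewrite -pE imset_f.
Qed.

Lemma card_Kn n : #|Kn n| = 'C(n, 2).
Proof.
have := card_draws 'I_n 2; rewrite card_ord => <-; apply: eq_card => e.
by rewrite !inE.
Qed.

(** Count the pairs of an edge of [K_n] and a copy through it; all degrees agree by [dg_le] in both
    directions. *)
Lemma dg_eq k n (v : {set 'I_n}) : is_graph h EH -> #|EH| = k.+1 -> v \in Kn n ->
  ('C(n, 2) * dg v = k.+1 * #|copies n|)%N.
Proof.
move=> gH cE vK; rewrite -card_Kn -sum_nat_const.
have -> : (\sum_(w in Kn n) dg v = \sum_(w in Kn n) \sum_(c in copies n) (w \in c))%N.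
  apply: eq_bigr => w wK; have -> : dg v = dg w by apply/eqP; rewrite eqn_leq !dg_le.
  rewrite /dg -sum1_card big_mkcond [RHS]big_mkcond /=; apply: eq_bigr => c _.
  by rewrite inE; case: (c \in copies n) => //=; case: (w \in c).
rewrite exchange_big /= mulnC -sum_nat_const; apply: eq_bigr => c cc.
have [cK ck] := uniform_copies gH cE cc.
rewrite -big_mkcondr sum1_card -ck; apply: eq_card => w; rewrite [LHS]inE.
by apply/andP/idP => [[]//|wc]; split=> //; exact: (subsetP cK).
Qed.

End Copies.

(** * Strictly 2-balanced graphs *)

Section BalancedGraph.
Variables (h k : nat) (EH : {set {set 'I_h}}).
Hypotheses (gH : is_graph h EH) (cE : #|EH| = k.+1) (k_gt1 : (1 < k)%N) (h_gt2 : (2 < h)%N).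
Hypothesis bal : forall (VF : {set 'I_h}) (F : {set {set 'I_h}}), is_subgraph h EH VF F ->
  (2 < #|VF|)%N -> (VF, F) != ([set: 'I_h], EH) -> ((#|F| - 1) * (h - 2) < k * (#|VF| - 2))%N.

Let edge2 (e : {set 'I_h}) : e \in EH -> #|e| = 2%N.
Proof. by move=> eE; apply/eqP; move/forall_inP: gH; apply. Qed.

Lemma edge_pair_bound e e' : e \in EH -> e' \in EH -> e != e' -> (2 < #|e :|: e'|)%N ->
  (h - 2 < k * (#|e :|: e'| - 2))%N.
Proof.
move=> eE e'E ee' c; have c2 : #|[set e; e']| = 2%N by rewrite cards2 ee'.
have := @bal (e :|: e') [set e; e']; rewrite c2 mul1n; apply=> //.
  apply/andP; split; first by rewrite subUset !sub1set eE.
  by apply/forall_inP => f; rewrite !inE => /orP[]/eqP ->; rewrite ?subsetUl ?subsetUr.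
by apply/eqP => -[_ E2]; move: c2; rewrite E2 cE => -[k1]; move: k_gt1; rewrite k1.
Qed.

(** Two edges sharing a vertex span three vertices, and balancedness gives [h - 2 < k]. If no two
    edges met, a pair would give [h - 2 < 2 * k], whereas [k.+1] disjoint edges need [2 * k.+1]
    vertices. *)
Lemma balanced_size : (h <= k.+1)%N.
Proof.
case: (boolP (trivIset EH)) => [tE|].
  have [e [e' [eE e'E ee']]] : exists e e', [/\ e \in EH, e' \in EH & e != e'].
    have /card_gt0P[e eE] : (0 < #|EH|)%N by rewrite cE.
    have /card_gt0P[e'] : (0 < #|EH :\ e|)%N.
      by have := cardsD1 e EH; rewrite eE cE add1n => -[<-]; exact: ltnW.
    by rewrite !inE eq_sym => /andP[ne e'E]; exists e, e'.
  have d : [disjoint e & e'] by move/trivIsetP: tE; apply.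
  have c4 : #|e :|: e'| = 4%N by rewrite cardsU disjoint_setI0 // cards0 !edge2.
  have := edge_pair_bound eE e'E ee'; rewrite c4 => /(_ isT) H.
  have : (#|cover EH| <= h)%N by rewrite -[leqRHS]card_ord max_card.
  have -> : #|cover EH| = (k.+1 * 2)%N.
    have /eqP <- := tE; rewrite (eq_bigr (fun=> 2%N)); last by move=> f /edge2.
    by rewrite sum_nat_const cE.
  by move: H; rewrite mulSn ltn_subLR ?(ltnW h_gt2) // => h1 h2; move: (leq_trans h1 h2); rewrite ltnn.
move=> /trivIsetP nt.
have [e [e' [eE e'E ee' nd]]] : exists e e', [/\ e \in EH, e' \in EH, e != e' & ~~ [disjoint e & e']].
  apply: contrapT => H; apply: nt => e e' eE e'E ee'; apply/negPn/negP => nd.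
  by apply: H; exists e, e'.
have c3 : #|e :|: e'| = 3%N.
  have i0 : (0 < #|e :&: e'|)%N by rewrite card_gt0 setI_eq0.
  have i1 : (#|e :&: e'| < 2)%N.
    rewrite ltnNge; apply: contra ee' => i2; rewrite eqEcard !edge2 // andbT.
    have : e :&: e' = e by apply/eqP; rewrite eqEcard subsetIl edge2.
    by move/setIidPl.
  have i2 : #|e :&: e'| = 1%N by apply/eqP; rewrite eqn_leq i0 andbT.
  by rewrite cardsU i2 !edge2.
have := edge_pair_bound eE e'E ee'; rewrite c3 muln1 => /(_ isT).
by rewrite ltn_subLR ?(ltnW h_gt2) // addSn add1n ltnS.
Qed.

(** At least [k] edges on [h - 1] vertices would give [(k - 1) * (h - 2) < k * (h - 3)], that is
    [h > k + 2], against [balanced_size]. Consequently every vertex of [H] has degree at least 2. *)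
Lemma edges_avoiding (x : 'I_h) (F : {set {set 'I_h}}) : F \subset EH ->
  (forall e, e \in F -> x \notin e) -> (#|F| < k)%N.
Proof.
move=> FE Fx; have cT : #|[set~ x]| = h.-1 by rewrite cardsC1 card_ord.
(* For [h = 3] the remaining two vertices are too few for the balancedness hypothesis, but they
   carry at most one edge. *)
case: (ltnP 3 h) => h3; last first.
  have h3' : h = 3%N by apply/eqP; rewrite eqn_leq h3.
  have h1 : h.-1 = 2%N by rewrite h3'.
  apply: leq_ltn_trans k_gt1; rewrite -(cards1 [set~ x]); apply: subset_leq_card.
  apply/subsetP => e eF; rewrite inE eqEcard cT h1 edge2 ?(subsetP FE) // andbT.
  by apply/subsetP => y ye; rewrite !inE; apply: contraTneq ye => ->; exact: Fx.
have := @bal [set~ x] F; rewrite cT => H.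
have {}H : ((#|F| - 1) * (h - 2) < k * (h.-1 - 2))%N.
  apply: H; last first.
  - by apply/eqP => -[E1 _]; have := in_setT x; rewrite -E1 !inE eqxx.
  - by rewrite -ltnS prednK // (ltn_trans _ h_gt2).
  apply/andP; split=> //; apply/forall_inP => e eF; apply/subsetP => y ye.
  by rewrite !inE; apply: contraTneq ye => ->; exact: Fx.
rewrite ltnNge; apply/negP => kF.
have hk := balanced_size.
have e1 : (h.-1 - 2 = h - 3)%N by rewrite -subn1 -subnDA.
have e2 : (h - 2 = (h - 3).+1)%N by rewrite -subSn // subSS.
move: H; rewrite e1 e2 => H.
have : ((k - 1) * (h - 3).+1 < k * (h - 3))%N.
  by apply: leq_ltn_trans H; rewrite leq_mul2r leq_sub2r ?orbT.
have : (h - 3 <= k - 2)%N by rewrite leq_subLR (leq_trans hk) // addnBA // addnC -addnBA.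
have : (0 < k)%N by apply: ltnW.
case: k k_gt1 => // k' _ _; rewrite !subSS subn0 mulnS mulSn.
move: (h - 3)%N => g gk; rewrite addnC [(g + _)%N]addnC ltn_add2l => gk'.
by move: (leq_trans gk' gk); rewrite ltnNge leq_subr.
Qed.

Lemma balanced_cover : cover EH = [set: 'I_h].
Proof.
apply/eqP; rewrite eqEsubset subsetT; apply/subsetP => x _; apply/negPn/negP => nx.
have := @edges_avoiding x EH (subxx _) _; rewrite cE ltnNge leqnSn => H.
suff : false by []; apply: H => e eE; apply: contra nx => xe; apply/bigcupP; by exists e.
Qed.

Lemma balanced_min_degree (e : {set 'I_h}) x : e \in EH -> x \in e ->
  exists2 e', e' \in EH & (e' != e) && (x \in e').
Proof.
move=> eE xe; apply: contrapT => H.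
have := @edges_avoiding x (EH :\ e) (subD1set _ _) _.
have := cardsD1 e EH; rewrite eE cE add1n => -[<-]; rewrite ltnn => H'.
suff : false by []; apply: H' => e'; rewrite !inE => /andP[ne e'E].
by apply/negP => xe'; apply: H; exists e'; rewrite ?ne.
Qed.

Lemma card_maps_into n (V : {set 'I_h}) (B : {set 'I_n}) :
  #|[set f : {ffun 'I_h -> 'I_n} | [forall x in V, f x \in B]]| =
  (#|B| ^ #|V| * n ^ (h - #|V|))%N.
Proof.
pose F x : {set 'I_n} := if x \in V then B else [set: 'I_n].
transitivity #|[set f : {ffun 'I_h -> 'I_n} | f \in family (fun x => mem (F x))]|.
  apply: eq_card => f; rewrite !inE; apply/forall_inP/familyP => H x.
    by rewrite /F; case: ifP => [xV|_]; [exact: H|exact: in_setT].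
  by move=> xV; have := H x; rewrite /F xV.
rewrite cardsE card_family foldrE big_map big_enum /= (bigID (mem V)) /=.
rewrite (eq_bigr (fun=> #|B|)); last by move=> x xV; rewrite /F xV.
rewrite [X in (_ * X)%N](eq_bigr (fun=> n)); last first.
  by move=> x /negPf xV; rewrite /F xV -[RHS]card_ord -[RHS]cardsT.
rewrite !prod_nat_const; congr (_ ^ _ * _ ^ _)%N.
apply: (@addnI #|V|); rewrite subnKC; last by rewrite -[leqRHS]card_ord max_card.
by rewrite -[RHS]card_ord -[RHS](cardC (mem V)).
Qed.

(** If a copy contains [S], some [F] in [EH] with [#|S|] edges is mapped onto [S], hence [cover F]
    onto [cover S]. There are at most [h ^ h] ways to map these vertices and [n] ways for each of
    the others. *)
Lemma codeg_copies n (S : {set {set 'I_n}}) :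
  (codeg (copies EH n) S <= \sum_(F in powerset EH | #|F| == #|S|) h ^ h * n ^ (h - #|cover F|))%N.
Proof.
pose A (F : {set {set 'I_h}}) := [set f in embeddings h n | cp F f == S].
have sub : [set c in copies EH n | S \subset c] \subset
    \bigcup_(F in powerset EH | #|F| == #|S|) @cp _ EH n @: A F.
  apply/subsetP => c; rewrite inE => /andP[/imsetP[f fe ->] Sc].
  have fi := elimT (embeddingsP f) fe.
  pose F := [set e in EH | f @: (e : {set 'I_h}) \in S].
  have FS : cp F f = S.
    apply/setP => v; apply/imsetP/idP => [[e]|vS]; first by rewrite inE => /andP[_ ?] ->.
    have /imsetP[e eE ve] := subsetP Sc _ vS; exists e => //.
    by rewrite inE eE -ve.
  apply/bigcupP; exists F; last by apply/imsetP; exists f; rewrite // inE fe FS /=.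
  rewrite powersetE -FS card_cp // eqxx andbT.
  by apply/subsetP => e; rewrite inE => /andP[].
apply: leq_trans (subset_leq_card sub) _; apply: leq_trans (leq_card_bigcup _ _) _.
apply: leq_sum => F _; apply: leq_trans (leq_imset_card _ _) _.
case: (set_0Vmem (A F)) => [->|[f0]]; first by rewrite cards0.
rewrite inE => /andP[/embeddingsP f0i /eqP f0S].
have cov f : cp F f = S -> f @: cover F = cover S.
  move=> <-; apply/setP => y; apply/imsetP/bigcupP => [[x /bigcupP[e eF xe] ->]|[v /imsetP[e eF ->]]].
    by exists (f @: e); apply: imset_f.
  by case/imsetP => x xe ->; exists x => //; apply/bigcupP; exists e.
have cS : #|cover S| = #|cover F| by rewrite -(cov _ f0S) card_imset.
have cF : (#|cover F| <= h)%N by rewrite -[leqRHS]card_ord max_card.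
apply: (@leq_trans (#|cover S| ^ #|cover F| * n ^ (h - #|cover F|))).
  rewrite -card_maps_into; apply: subset_leq_card; apply/subsetP => f.
  rewrite !inE => /andP[_ /eqP fS]; apply/forall_inP => x xF.
  by rewrite -(cov _ fS) imset_f.
rewrite leq_mul2r; apply/orP; right; rewrite cS.
apply: (@leq_trans (h ^ #|cover F|)%N); first by case: (#|cover F|) cF => [|m mh] //; rewrite leq_exp2r.
by rewrite leq_pexp2l // (ltn_trans _ h_gt2).
Qed.

(** In the second copy each end of [w] lies on another edge, by minimum degree 2, and that edge
    belongs to [c]. So the vertices of [c] include [v :|: w], which has at least three elements, and
    copies through three given vertices number [O(n ^ (h - 3))]. *)
Lemma link_copies n (v w : {set 'I_n}) : v \in Kn n -> w \in Kn n -> v != w ->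
  (#|[set c in copies EH n | (v \in c) && (w |: c :\ v \in copies EH n)]|
     <= 2 ^ h * (3 ^ 3 * n ^ (h - 3)))%N.
Proof.
rewrite 2!inE => /eqP v2 /eqP w2 vw.
have [B Bvw B3] : exists2 B : {set 'I_n}, B \subset v :|: w & #|B| = 3%N.
  have [x xw] : exists x, x \in w :\: v.
    apply/set0Pn; rewrite setD_eq0; apply: contra vw => wv.
    by rewrite eq_sym eqEcard wv v2 w2.
  move: xw; rewrite inE => /andP[xv xw]; exists (x |: v); last by rewrite cardsU1 xv v2.
  by rewrite subUset sub1set inE xw orbT subsetUl.
pose A (V : {set 'I_h}) := [set f : {ffun 'I_h -> 'I_n} | [forall x in V, f x \in B]].
have sub : [set c in copies EH n | (v \in c) && (w |: c :\ v \in copies EH n)] \subset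
    \bigcup_(V : {set 'I_h} | #|V| == 3%N) @cp _ EH n @: A V.
  apply/subsetP => c; rewrite inE => /and3P[/imsetP[f /embeddingsP fi ->] vc wc].
  have rng y : y \in B -> y \in f @: [set: 'I_h].
    move=> /(subsetP Bvw); rewrite inE -(cover_cp balanced_cover) => /orP[yv|yw].
      by apply/bigcupP; exists v.
    case/imsetP: wc => g /embeddingsP gi gE.
    have : w \in cp EH g by rewrite -gE setU11.
    case/imsetP => e eE we; move: yw; rewrite we => /imsetP[x xe yx].
    have [e' e'E /andP[ne xe']] := balanced_min_degree eE xe.
    have : g @: e' \in cp EH g by apply: imset_f.
    rewrite -gE !inE => /orP[/eqP ge'|/andP[_ ge']].
      by move: ne; rewrite -(inj_eq (imset_inj gi)) ge' we eqxx.
    by apply/bigcupP; exists (g @: e') => //; rewrite yx imset_f.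
  have c3 : #|f @^-1: B| = 3%N.
    rewrite -B3 -(card_imset _ fi); apply: eq_card => y; apply/imsetP/idP.
      by case=> x; rewrite inE => xB ->.
    by move=> yB; have /imsetP[x _ yx] := rng _ yB; exists x => //; rewrite inE -yx.
  apply/bigcupP; exists (f @^-1: B); first by rewrite c3.
  apply: imset_f; rewrite inE; apply/forall_inP => x; by rewrite inE.
apply: leq_trans (subset_leq_card sub) _; apply: leq_trans (leq_card_bigcup _ _) _.
apply: (@leq_trans (\sum_(V : {set 'I_h} | #|V| == 3%N) 3 ^ 3 * n ^ (h - 3))).
  apply: leq_sum => V /eqP V3; apply: leq_trans (leq_imset_card _ _) _.
  by rewrite card_maps_into V3 B3.
rewrite sum_nat_const leq_mul2r; apply/orP; right.
by apply: leq_trans (max_card _) _; rewrite -cardsT -powersetT card_powerset cardsT card_ord.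
Qed.

End BalancedGraph.

(** * Asymptotics of [DeltaH] and sparsity of the copies *)

Lemma leq_ffact_exp n m : (n ^_ m <= n ^ m)%N.
Proof.
elim: m n => [|m IH] n; first by rewrite ffactn0.
rewrite ffactnS expnS leq_mul2l; apply/orP; right; apply: leq_trans (IH _) _.
by case: m {IH} => [|m]; rewrite ?expn0 // leq_exp2r // leq_pred.
Qed.

Lemma exp_leq_ffact n m : ((n - m) ^ m <= n ^_ m)%N.
Proof.
elim: m n => [|m IH] n; first by rewrite ffactn0.
rewrite ffactnS expnS; apply: leq_mul; first exact: leq_subr.
by apply: leq_trans (IH n.-1); rewrite -subn1 -subnDA add1n.
Qed.

Lemma near_natr_ge (R : realType) (A : R) : \forall n \near eventually, A <= n%:R.
Proof. exact: nbhs_infty_ger. Qed.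

Section Asymptotics.
Variables (R : realType) (h k : nat) (EH : {set {set 'I_h}}).
Hypotheses (gH : is_graph h EH) (cE : #|EH| = k.+1) (k_gt1 : (1 < k)%N) (h_gt2 : (2 < h)%N).
Hypothesis bal : forall (VF : {set 'I_h}) (F : {set {set 'I_h}}), is_subgraph h EH VF F ->
  (2 < #|VF|)%N -> (VF, F) != ([set: 'I_h], EH) -> ((#|F| - 1) * (h - 2) < k * (#|VF| - 2))%N.

Let cov := balanced_cover gH cE k_gt1 h_gt2 bal.
Let aut := #|automorphisms EH|.
Let aut0 : (0 < aut)%N := automorphisms_gt0 EH.
Let Dl n : R := DeltaH R h EH n.

Definition qn n : R := (powR (Dl n) k%:R^-1)^-1.

(** Combine [dg_eq] with [card_copies] and cancel [n * n.-1]. The degree condition of [sparse] thus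
    becomes an exact identity at the scale [qn]. *)
Lemma degree_DeltaH n (v : {set 'I_n}) : v \in Kn n -> (dg EH v)%:R = Dl n.
Proof.
move=> vK; have n2 : (1 < n)%N.
  by move: vK; rewrite inE => /eqP <-; rewrite -[leqRHS]card_ord max_card.
have H1 := dg_eq gH cE vK; have H2 := card_copies cov n; rewrite -/aut in H2.
have H3 := bin_ffact n 2.
have E4 : (n ^_ h = n * n.-1 * (n - 2) ^_ (h - 2))%N.
  rewrite -{1}(subnKC (ltnW h_gt2)) !addSn add0n !ffactnS mulnA; congr (_ * _ ^_ _)%N.
  by rewrite -subn2.
have H5 : (aut * dg EH v = 2 * k.+1 * (n - 2) ^_ (h - 2))%N.
  have p : (0 < n * n.-1)%N by rewrite muln_gt0 (ltn_trans _ n2) // -ltnS prednK // (ltn_trans _ n2).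
  apply/eqP; rewrite -(eqn_pmul2l p); apply/eqP.
  have F2 : (n * n.-1 = 'C(n, 2) * 2)%N by move: H3; rewrite !ffactnS ffactn0 muln1 => <-.
  transitivity (2 * aut * ('C(n, 2) * dg EH v))%N; first by rewrite F2; ring.
  rewrite H1; transitivity (2 * k.+1 * (#|copies EH n| * aut))%N; first by ring.
  by rewrite H2 E4; ring.
rewrite /Dl /DeltaH cE -H5 natrM mulrC mulKf // pnatr_eq0 -lt0n //.
Qed.

(** Each of the [h - 2] factors of the falling factorial in [DeltaH] is at least [n / 2] once
    [2 * h <= n]; [aut] clears the denominator. *)
Let C0 : R := aut%:R * (2 ^ (h - 2))%:R.

Let C0_ge1 : 1 <= C0.
Proof. by rewrite /C0 -natrM ler1n muln_gt0 aut0 expn_gt0. Qed.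

Lemma DeltaH_ge n : (2 * h <= n)%N -> n%:R ^+ (h - 2) <= C0 * Dl n.
Proof.
move=> hn; have a0 : aut%:R != 0 :> R by rewrite pnatr_eq0 -lt0n.
have -> : C0 * Dl n = (2 ^ (h - 2))%:R * (2 * #|EH| * (n - 2) ^_ (h - 2))%:R.
  rewrite /C0 /Dl /DeltaH -[autH h EH]/aut.
  by rewrite [aut%:R * _]mulrC -mulrA [aut%:R * _]mulrC divfK.
rewrite -natrM -natrX ler_nat.
apply: (@leq_trans (2 ^ (h - 2) * (n - 2) ^_ (h - 2))).
  apply: (@leq_trans (2 ^ (h - 2) * (n - h) ^ (h - 2))).
    rewrite -expnMn; case: (h - 2)%N => // m; rewrite leq_exp2r //.
    rewrite mulnBr leq_subRL; first by rewrite [leqRHS]mul2n -addnn leq_add2r.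
    by rewrite leq_mul2l (leq_trans _ hn) // leq_pmull.
  rewrite leq_mul2l; apply/orP; right.
  have h0 : (0 < h)%N by apply: ltn_trans h_gt2.
  have n2 : (2 <= n)%N by apply: leq_trans hn; rewrite leq_pmulr.
  by have := exp_leq_ffact (n - 2) (h - 2); rewrite subnBA ?(ltnW h_gt2) // subnK.
rewrite leq_mul2l leq_pmull ?orbT // muln_gt0 /= cE //.
Qed.

Lemma DeltaH_le n : Dl n <= (2 * k.+1)%:R * n%:R ^+ (h - 2).
Proof.
have a0 : 0 < aut%:R :> R by rewrite ltr0n.
rewrite /Dl /DeltaH -[autH h EH]/aut ler_pdivrMr // cE -natrX -!natrM ler_nat.
apply: (@leq_trans (2 * k.+1 * n ^ (h - 2))%N); last by rewrite leq_pmulr.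
rewrite leq_mul2l; apply/orP; right; apply: leq_trans (leq_ffact_exp _ _) _.
by case: (h - 2)%N => // m; rewrite leq_exp2r // leq_subr.
Qed.

Lemma DeltaH_gt0 n : (2 * h <= n)%N -> 0 < Dl n.
Proof.
move=> hn; have C00 : 0 < C0 by apply: lt_le_trans C0_ge1.
rewrite -(pmulr_rgt0 _ C00); apply: lt_le_trans (DeltaH_ge hn).
rewrite exprn_gt0 // ltr0n (leq_trans _ hn) // muln_gt0 /= (ltn_trans _ h_gt2) //.
Qed.

Lemma qn_gt0 n : (2 * h <= n)%N -> 0 < qn n.
Proof. by move=> hn; rewrite invr_gt0 powR_gt0 // DeltaH_gt0. Qed.

Lemma qn_exp n : (2 * h <= n)%N -> qn n ^+ k = (Dl n)^-1.
Proof.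
move=> hn; have D0 := DeltaH_gt0 hn.
rewrite exprVn -powR_mulrn ?powR_ge0 // -powRrM mulVf ?powRr1 ?ltW //.
by rewrite pnatr_eq0 -lt0n ltnW.
Qed.

Lemma DeltaH_inv_le n : (2 * h <= n)%N -> (Dl n)^-1 <= C0 / n%:R ^+ (h - 2).
Proof.
move=> hn; have n0 : 0 < n%:R :> R.
  by rewrite ltr0n (leq_trans _ hn) // muln_gt0 /= (ltn_trans _ h_gt2).
by rewrite ler_pdivlMr ?exprn_gt0 // mulrC ler_pdivrMr ?DeltaH_gt0 ?DeltaH_ge.
Qed.

Lemma card_cover_gt2 (F : {set {set 'I_h}}) : F \subset EH -> (1 < #|F|)%N -> (2 < #|cover F|)%N.
Proof.
move=> FE F1.
have e2 e : e \in F -> #|e| = 2%N by move=> /(subsetP FE) eE; apply/eqP; move/forall_inP: gH; apply.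
have /card_gt0P[e eF] : (0 < #|F|)%N by apply: ltnW.
rewrite ltnNge; apply/negP => c2.
have H f : f \in F -> f = cover F.
  move=> fF; apply/eqP; rewrite eqEcard (e2 _ fF) c2 andbT.
  by apply/subsetP => x xf; apply/bigcupP; exists f.
move: F1; rewrite ltnNge -(cards1 (cover F)) => /negP; apply; apply: subset_leq_card.
by apply/subsetP => f /H ->; rewrite inE.
Qed.

(** This is where strictness counts. After raising to the power [k], the exponents of [n] are
    integers, so the strict inequality reads [k * (h - #|cover F|) + 1 <= (h - 2) * (k.+1 - #|F|)]
    and leaves a whole factor [n] to absorb the constants. *)
Lemma copies_term_small d (F : {set {set 'I_h}}) n : 0 < d -> F \subset EH -> (1 < #|F| <= k)%N ->
  (2 * h <= n)%N -> C0 ^+ k / d ^+ k <= n%:R ->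
  (n ^ (h - #|cover F|))%:R * qn n ^+ (k.+1 - #|F|) <= d.
Proof.
move=> d0 FE /andP[F1 Fk] hn nd; have q0 := ltW (qn_gt0 hn).
have n0 : 0 < n%:R :> R.
  by rewrite ltr0n (leq_trans _ hn) // muln_gt0 /= (ltn_trans _ h_gt2).
have c3 := card_cover_gt2 FE F1.
have ch : (#|cover F| <= h)%N by rewrite -[leqRHS]card_ord max_card.
have B : ((#|F| - 1) * (h - 2) < k * (#|cover F| - 2))%N.
  apply: bal => //.
    rewrite /is_subgraph FE; apply/forall_inP => e eF; apply/subsetP => x xe.
    by apply/bigcupP; exists e.
  by apply/eqP => -[_ E]; move: Fk; rewrite E cE ltnn.
set j := (k.+1 - #|F|)%N; set a := (h - #|cover F|)%N.
have ex : (k * a + 1 <= (h - 2) * j)%N.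
  have e1 : (a + (#|cover F| - 2) = h - 2)%N.
    by rewrite /a addnBA ?subnK // (ltn_trans _ c3).
  have e2 : (j + (#|F| - 1) = k)%N.
    by rewrite /j addnBA ?subnK ?subn1 // ?(leqW Fk) // ltnW.
  have e3 : ((h - 2) * j + (h - 2) * (#|F| - 1) = (h - 2) * k)%N by rewrite -mulnDr e2.
  have e4 : (k * a + k * (#|cover F| - 2) = k * (h - 2))%N by rewrite -mulnDr e1.
  move: B; rewrite mulnC => B; rewrite -(leq_add2r ((h - 2) * (#|F| - 1))) e3 [leqRHS]mulnC -e4.
  by rewrite -addnA leq_add2l add1n.
have k0 : (0 < k)%N by apply: ltnW.
rewrite -(ler_pXn2r k0) ?nnegrE ?mulr_ge0 ?exprn_ge0 ?(ltW d0) //.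
rewrite exprMn -exprM mulnC exprM qn_exp // natrX -exprM [(a * k)%N]mulnC.
apply: (@le_trans _ _ (n%:R ^+ (k * a) * (C0 / n%:R ^+ (h - 2)) ^+ j)).
  rewrite ler_wpM2l ?exprn_ge0 //; apply: lerXn2r; rewrite ?nnegrE ?invr_ge0 ?(ltW (DeltaH_gt0 hn)) //.
    by rewrite divr_ge0 ?exprn_ge0 // (le_trans ler01).
  exact: DeltaH_inv_le.
rewrite expr_div_n -exprM mulrA ler_pdivrMr ?exprn_gt0 //.
apply: (@le_trans _ _ (n%:R ^+ (k * a) * (d ^+ k * n%:R))).
  rewrite ler_wpM2l ?exprn_ge0 //; apply: (@le_trans _ _ (C0 ^+ k)).
    by apply: ler_weXn2l => //; rewrite /j leq_subLR addnC -[k.+1]addn1 leq_add2l ltnW.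
  by rewrite mulrC -ler_pdivrMr ?exprn_gt0.
rewrite mulrCA ler_wpM2l ?exprn_ge0 ?(ltW d0) // -exprSr; apply: ler_weXn2l.
  by rewrite ler1n -(ltr0n R).
by rewrite -addn1.
Qed.

Lemma sparse_copies d : 0 < d -> \forall n \near eventually, sparse (Kn n) (copies EH n) k (qn n) d.
Proof.
move=> d0; have C00 : 0 < C0 by apply: lt_le_trans C0_ge1.
(* [B] accounts for the [2 ^ k.+1] choices of [F] and the factor [h ^ h] of [codeg_copies]; [C2] is
   the constant of [link_copies], whose [n ^ (h - 3)] is smaller than the degree by a factor of
   order [n]. *)
pose B : R := (2 ^ k.+1)%:R * (h ^ h)%:R; pose C2 : R := (2 ^ h * 3 ^ 3)%:R.
have B0 : 0 < B by rewrite mulr_gt0 // ltr0n expn_gt0 // (ltn_trans _ h_gt2).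
have dB : 0 < d / B by rewrite divr_gt0.
near=> n.
have hn : (2 * h <= n)%N by near: n; exact: nbhs_infty_ge.
have n1 : C0 / d ^+ k <= n%:R by near: n; exact: near_natr_ge.
have n2 : C0 ^+ k / (d / B) ^+ k <= n%:R by near: n; exact: near_natr_ge.
have n3 : C2 * C0 / d <= n%:R by near: n; exact: near_natr_ge.
have n0 : 0 < n%:R :> R.
  by rewrite ltr0n (leq_trans _ hn) // muln_gt0 /= (ltn_trans _ h_gt2).
have nge1 : 1 <= n%:R :> R by rewrite ler1n -(ltr0n R).
have k0 : (0 < k)%N by apply: ltnW.
have q0 := qn_gt0 hn.
split=> //.
- rewrite -(ler_pXn2r k0) ?nnegrE ?(ltW q0) ?(ltW d0) // qn_exp //.
  apply: le_trans (DeltaH_inv_le hn) _; rewrite ler_pdivrMr ?exprn_gt0 //.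
  apply: (@le_trans _ _ (d ^+ k * n%:R)).
    by rewrite mulrC -ler_pdivrMr ?exprn_gt0.
  rewrite ler_wpM2l ?exprn_ge0 ?(ltW d0) // -[leLHS]expr1; apply: ler_weXn2l => //.
  by rewrite subn_gt0.
- move=> v vK; rewrite -[#|_|]/(dg EH v) degree_DeltaH // qn_exp // divff // gt_eqF //.
  exact: DeltaH_gt0.
- move=> S SK /andP[S1 Sk].
  have := codeg_copies EH h_gt2 S; rewrite -(ler_nat R) => /ler_wpM2r -/(_ _ (ltW (exprn_gt0 (k.+1 - #|S|) q0))) H.
  apply: le_trans H _; rewrite natr_sum mulr_suml.
  apply: (@le_trans _ _ (\sum_(F in powerset EH | #|F| == #|S|) (h ^ h)%:R * (d / B))).
    apply: ler_sum => F /andP[]; rewrite powersetE => FE /eqP FS.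
    rewrite natrM -mulrA ler_wpM2l // -FS; apply: copies_term_small => //.
    by rewrite FS S1.
  rewrite sumr_const -[leLHS]mulr_natl mulrA.
  apply: (@le_trans _ _ (B * (d / B))); last by rewrite mulrC divfK // gt_eqF.
  rewrite ler_wpM2r ?(ltW dB) // ler_wpM2r // ler_nat.
  apply: (@leq_trans #|powerset EH|); last by rewrite card_powerset cE.
  by apply: subset_leq_card; apply/subsetP => F /andP[].
- move=> v w vK wK vw; rewrite qn_exp //.
  have := link_copies gH cE k_gt1 h_gt2 bal vK wK vw; rewrite -(ler_nat R) => H.
  apply: (@le_trans _ _ (C2 * n%:R ^+ (h - 3) * (C0 / n%:R ^+ (h - 2)))).
    apply: ler_pM => //; first by rewrite invr_ge0 (ltW (DeltaH_gt0 hn)).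
      by apply: le_trans H _; rewrite mulnA natrM natrX.
    exact: DeltaH_inv_le.
  rewrite (_ : (h - 2 = (h - 3).+1)%N); last by rewrite -subSn // subSS.
  rewrite exprS invfM mulrACA.
  rewrite (_ : _ * _ = C2 * C0 / n%:R); last by field; rewrite gt_eqF //= gt_eqF ?exprn_gt0.
  by rewrite ler_pdivrMr // [leRHS]mulrC -ler_pdivrMr.
Unshelve. all: end_near.
Qed.

(** [(#|Kn n|%:R * qn n) ^+ k] has order [n ^ (2 * k) / n ^ (h - 2)], which is at least of order [n]
    because [h <= k.+1]. *)
Lemma scale_unbounded (A : R) : \forall n \near eventually, A <= #|Kn n|%:R * qn n.
Proof.
have k0 : (0 < k)%N by apply: ltnW.
near=> n.
have hn : (2 * h <= n)%N by near: n; exact: nbhs_infty_ge.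
have nA : `|A| ^+ k * ((4 ^ k)%:R * (2 * k.+1)%:R) <= n%:R by near: n; exact: near_natr_ge.
have n0 : 0 < n%:R :> R.
  by rewrite ltr0n (leq_trans _ hn) // muln_gt0 /= (ltn_trans _ h_gt2).
have nge1 : 1 <= n%:R :> R by rewrite ler1n -(ltr0n R).
have D0 := DeltaH_gt0 hn; have q0 := qn_gt0 hn.
apply: le_trans (ler_norm _) _.
rewrite -(ler_pXn2r k0) ?nnegrE ?mulr_ge0 ?(ltW q0) // exprMn qn_exp // ler_pdivlMr //.
have hk := balanced_size gH cE k_gt1 h_gt2 bal.
have cK : n%:R ^+ 2 <= 4%:R * #|Kn n|%:R :> R.
  rewrite card_Kn -natrX -natrM ler_nat.
  have E2 : ('C(n, 2) * 2 = n * n.-1)%N.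
    by have := bin_ffact n 2; rewrite !ffactnS ffactn0 muln1 => <-.
  rewrite (_ : 4 * _ = 2 * (n * n.-1))%N; last by rewrite -E2; ring.
  rewrite expnS expn1 mulnCA leq_mul2l; apply/orP; right.
  have : (1 < n)%N by rewrite (leq_trans _ hn) // leq_pmulr // (ltn_trans _ h_gt2).
  by case: (n) => // n' n1; rewrite /= mul2n -addnn -addn1 leq_add2l.
apply: (@le_trans _ _ (`|A| ^+ k * ((2 * k.+1)%:R * n%:R ^+ (h - 2)))).
  by rewrite ler_wpM2l ?exprn_ge0 // DeltaH_le.
have c4 : 0 < (4 ^ k)%:R :> R by rewrite ltr0n expn_gt0.
rewrite -(ler_pM2l c4).
apply: (@le_trans _ _ (n%:R * n%:R ^+ (h - 2))).
  rewrite [leLHS]mulrCA [X in _ * X <= _]mulrA [leLHS]mulrA.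
  by rewrite ler_wpM2r ?exprn_ge0.
apply: (@le_trans _ _ ((n%:R ^+ 2) ^+ k)).
  rewrite -exprS -exprM; apply: ler_weXn2l => //.
  rewrite -subSn ?(ltnW h_gt2) // leq_subLR (leq_trans (_ : _ <= k.+2)%N) // addnC.
  by rewrite mul2n -addnn -addnA -[k.+2]addn2 leq_add2l leq_addl.
rewrite natrX -exprMn; apply: lerXn2r; rewrite ?nnegrE ?exprn_ge0 ?mulr_ge0 //.
Unshelve. all: end_near.
Qed.

End Asymptotics.

(** * The Lambert W parametrization *)

Section LambertParametrization.
Variables (R : realType) (k : nat).
Hypothesis k_gt1 : (1 < k)%N.
Implicit Types (c x y z zeta eta : R).

Local Notation fug := (fug k).
Local Notation subcritical := (subcritical k).

Let k0 : 0 < k%:R :> R.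
Proof. by rewrite ltr0n (ltn_trans _ k_gt1). Qed.

Lemma lambertWE y : 0 <= y -> lambertW R (y * expR y) = y.
Proof.
move=> y0; have lt u w : 0 <= u -> u < w -> u * expR u < w * expR w.
  move=> u0 uw; apply: (@le_lt_trans _ _ (u * expR w)).
    by rewrite ler_wpM2l // ler_expR ltW.
  by rewrite ltr_pM2r ?expR_gt0.
apply: xget_unique => //= w [w0 e]; apply/eqP; rewrite eq_le !leNgt.
by apply/andP; split; apply/negP => /lt; rewrite e ltxx => H; have := H _; auto.
Qed.

(** Raising [x * expR (zeta * x ^+ k) = c] to the power [k] and multiplying by [k * zeta] gives
    [y * expR y = k * c ^ k * zeta] with [y = k * zeta * x ^ k], which Lambert's function
    inverts. *)
Lemma xstarE c zeta x : 0 <= zeta -> 0 < x -> fug (1 - zeta) x = c ->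
  xstar R k.+1 c zeta = x.
Proof.
move=> z0 x0; rewrite /fug subKr => <-; rewrite /xstar -natr1 addrK.
have [->|zn0] := eqVneq zeta 0; first by rewrite mul0r expR0 mulr1.
rewrite (_ : _ * _ * zeta = k%:R * zeta * x ^+ k * expR (k%:R * zeta * x ^+ k)); last first.
  by rewrite exprMn -[k%:R * zeta * _]mulrA expRM_natl; ring.
rewrite lambertWE; last by rewrite !mulr_ge0 ?exprn_ge0 // ltW.
rewrite mulrAC divff ?mul1r; last by rewrite mulf_neq0 // gt_eqF.
by rewrite -powR_mulrn ?ltW // -powRrM divff ?gt_eqF // powRr1 // ltW.
Qed.

Lemma IVT_isder (f : R -> R) (df : R -> R) a b v : a <= b ->
  (forall x, a <= x <= b -> is_derive x 1 f (df x)) -> f a <= v <= f b ->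
  exists2 x, a <= x <= b & f x = v.
Proof.
move=> ab H /andP[av vb]; have [] := @IVT R f a b v ab (derive_continuous_within H).
  by rewrite ge_min av /= le_max vb orbT.
by move=> x; rewrite in_itv /= => xab fx; exists x.
Qed.

Lemma fug_surj z c : z <= 1 -> 0 < c -> exists2 x, 0 < x & fug z x = c.
Proof.
move=> z1 c0; have [|x /andP[x0 _] fx] := @IVT_isder (fug z) _ 0 c c (ltW c0) (fun x _ => isder_fug k_gt1 z x).
  rewrite /fug mul0r (ltW c0) /= ler_peMr ?(ltW c0) // -[leLHS]expR0 ler_expR.
  by rewrite mulr_ge0 ?subr_ge0 ?exprn_ge0 // ltW.
exists x => //; rewrite lt_neqAle x0 andbT; apply: contraTneq c0 => x00.
by rewrite -fx -x00 /fug mul0r ltxx.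
Qed.

Lemma xstarP c zeta : 0 < c -> 0 <= zeta ->
  0 < xstar R k.+1 c zeta /\ fug (1 - zeta) (xstar R k.+1 c zeta) = c.
Proof.
move=> c0 z0; have z1 : 1 - zeta <= 1 by rewrite gerBl.
by have [x x0 fx] := fug_surj z1 c0; rewrite (xstarE z0 x0 fx).
Qed.

(* In terms of [x], [zeta = ln (c / x) / x ^ k], and the equation for [zeta] becomes
   [x ^ k.+1 - x ln (c / x) = eta c ^ k.+1]; at [x = x1], where [zeta = 1], the left side is [0]. *)
Lemma zeta_exists eta c : 0 <= eta -> eta < 1 -> 0 < c ->
  exists2 zeta, 0 <= zeta <= 1 & (1 - zeta) * xstar R k.+1 c zeta ^+ k.+1 = eta * c ^+ k.+1.
Proof.
move=> e0 e1 c0; have [x1 x10 fx1] := fug_surj (@ler01 R) c0.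
have x1c : x1 <= c.
  rewrite -fx1 /fug ler_peMr ?(ltW x10) // -[leLHS]expR0 ler_expR.
  by rewrite mulr_ge0 ?subr_ge0 ?exprn_ge0 // ltW.
pose g x := x ^+ k.+1 - x * (ln c - ln x).
have gD x : x1 <= x <= c -> is_derive x 1 g
    (k.+1%:R * x ^+ k * 1 - (1 * (ln c - ln x) + x * (0 - 1 / x))).
  move=> /andP[x1x _]; have x0 : 0 < x by apply: lt_le_trans x1x.
  exact: (isder_sub (isder_pow k.+1 (isder_id x)) (isder_mul (isder_id x)
    (isder_sub (isder_cst x (ln c)) (@isder_ln _ (fun x => x) x 1 x0 (isder_id x))))).
have lx1 : ln c - ln x1 = x1 ^+ k.
  by rewrite -fx1 lnM ?posrE ?expR_gt0 // expRK addrAC subrr add0r subr0 mul1r.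
have [|x /andP[x1x xc] gx] := @IVT_isder g _ x1 c (eta * c ^+ k.+1) x1c gD.
  rewrite /g lx1 -exprS !subrr mulr0 subr0 mulr_ge0 ?exprn_ge0 ?(ltW c0) //=.
  by rewrite ler_piMl ?exprn_ge0 // ltW.
have x0 : 0 < x by apply: lt_le_trans x1x.
have xk : 0 < x ^+ k by rewrite exprn_gt0.
pose zeta := (ln c - ln x) / x ^+ k.
have z0 : 0 <= zeta by rewrite divr_ge0 ?(ltW xk) // subr_ge0 ler_ln.
have z1 : zeta <= 1.
  rewrite ler_pdivrMr // mul1r; apply: (@le_trans _ _ (ln c - ln x1)).
    by rewrite lerD2l lerN2 ler_ln.
  by rewrite lx1 lerXn2r ?nnegrE ?(ltW x0) ?(ltW x10).
exists zeta; first by rewrite z0 z1.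
rewrite (xstarE z0 x0) -?gx; last first.
  rewrite /fug subKr /zeta divfK ?gt_eqF // expRB !lnK ?posrE // mulrC divfK // gt_eqF //.
rewrite /g mulrBl mul1r; congr (_ - _).
by rewrite exprS mulrCA divfK // gt_eqF.
Qed.

(** As [zeta] grows, [fug] at a fixed point grows, so the solution [xstar] does not increase; the
    left side is then strictly decreasing in [zeta]. *)
Lemma zeta_unique eta c zeta zeta' : 0 <= eta -> eta < 1 -> 0 < c ->
  0 <= zeta <= 1 -> 0 <= zeta' <= 1 ->
  (1 - zeta) * xstar R k.+1 c zeta ^+ k.+1 = eta * c ^+ k.+1 ->
  (1 - zeta') * xstar R k.+1 c zeta' ^+ k.+1 = eta * c ^+ k.+1 -> zeta = zeta'.
Proof.
move=> e0 e1 c0; wlog lt : zeta zeta' / zeta < zeta' => [H|].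
  case: (ltgtP zeta zeta') => // lt z01 z01' E1 E2; first exact: H.
  by apply/esym; apply: H.
move=> /andP[z0 z1] /andP[z0' z1'] E1 E2.
have [x0 fx] := xstarP c0 z0; have [x0' fx'] := xstarP c0 z0'.
set x := xstar _ _ _ zeta in x0 fx E1; set x' := xstar _ _ _ zeta' in x0' fx' E2.
have xx' : x' <= x.
  rewrite leNgt; apply/negP => xx; have := fug_lt k (_ : 1 - zeta <= 1) x0 xx.
  rewrite gerBl => /(_ z0); rewrite fx -fx' /fug !subKr ltr_pM2l // ltr_expR ltNge.
  by rewrite ler_wpM2r ?exprn_ge0 ?ltW.
have h : (1 - zeta') * x' ^+ k.+1 <= (1 - zeta') * x ^+ k.+1.
  by rewrite ler_wpM2l ?subr_ge0 // lerXn2r ?nnegrE ?(ltW x0) ?(ltW x0').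
have : (1 - zeta') * x ^+ k.+1 < (1 - zeta) * x ^+ k.+1.
  by rewrite ltr_pM2r ?exprn_gt0 // ltrD2l ltrN2.
by move=> h'; move: (le_lt_trans h h'); rewrite E1 E2 ltxx.
Qed.

(** Suppose [w = k * zeta * x ^ k >= 1]. Then [eta = (1 - zeta) * expR (- (k + 1) * w / k)] is at
    most [(1 - zeta) * eta_star], so [zeta <= 1 - eta / eta_star]. On the other hand
    [k * zeta * c ^ k = w * expR w >= expR 1], and together these give [c >= cbar]. *)
Lemma subcritical_below_cbar eta c zeta : 0 <= eta -> eta < 1 -> 0 < c -> (c%:E < cbar R k.+1 eta)%E ->
  0 <= zeta <= 1 -> (1 - zeta) * xstar R k.+1 c zeta ^+ k.+1 = eta * c ^+ k.+1 ->
  subcritical (1 - zeta) (xstar R k.+1 c zeta).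
Proof.
move=> e0 e1 c0 cb /andP[z0 z1] E; have [x0 fx] := xstarP c0 z0.
set x := xstar _ _ _ _ in x0 fx E *.
split=> //; [by rewrite subr_ge0|by rewrite gerBl|rewrite ltNge; apply/negP => w1].
rewrite subKr in w1; set w := k%:R * zeta * x ^+ k in w1.
have xE : c = x * expR (zeta * x ^+ k) by rewrite -fx /fug subKr.
have ck : zeta * k%:R * c ^+ k = w * expR w.
  have -> : expR w = expR (zeta * x ^+ k) ^+ k by rewrite /w -mulrA expRM_natl.
  by rewrite {1}xE exprMn /w; ring.
have zp : 0 < zeta.
  rewrite lt_neqAle z0 andbT; apply: contraTneq w1 => z00.
  by rewrite /w -z00 mulr0 mul0r -ltNge ltr01.
have es0 : 0 < eta_star R k.+1 by apply: expR_gt0.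
have ee : eta <= (1 - zeta) * eta_star R k.+1.
  have -> : eta = (1 - zeta) * expR (- (zeta * x ^+ k)) ^+ k.+1.
    have c1 : c ^+ k.+1 != 0 by rewrite expf_neq0 // gt_eqF.
    apply: (mulIf c1); rewrite -E {1}xE -mulrA -exprMn; congr (_ * _ ^+ _).
    by rewrite mulrCA -expRD addNr expR0 mulr1.
  rewrite ler_wpM2l ?subr_ge0 // /eta_star -expRM_natl ler_expR -natr1 addrK mulrN lerN2.
  rewrite ler_pdivrMr // (_ : _ * _ * _ = (k%:R + 1) * w); last by rewrite /w; ring.
  by rewrite ler_peMr // addr_ge0 // ltW.
have les : eta < eta_star R k.+1.
  by apply: le_lt_trans ee _; rewrite gtr_pMl // gtrBl.
move: cb; rewrite /cbar les lte_fin -natr1 addrK; apply/negP; rewrite -leNgt.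
have z_le : zeta <= 1 - eta / eta_star R k.+1.
  by rewrite lerBrDl -lerBrDr ler_pdivrMr.
have zz : 0 < 1 - eta / eta_star R k.+1 by apply: lt_le_trans z_le.
have kn0 : (0 < k)%N by apply: ltnW.
rewrite -(ler_pXn2r kn0) ?nnegrE ?powR_ge0 ?(ltW c0) //.
rewrite -powR_mulrn ?powR_ge0 // -powRrM mulVf ?gt_eqF // powRr1; last first.
  by rewrite divr_ge0 ?expR_ge0 // mulr_ge0 // ltW.
rewrite ler_pdivrMr ?mulr_gt0 // mulrC; apply: (@le_trans _ _ (zeta * k%:R * c ^+ k)).
  by rewrite ck -[leLHS]mul1r; apply: ler_pM; rewrite ?expR_ge0 // ler_expR.
by rewrite [k%:R * _]mulrC ler_wpM2r ?exprn_ge0 ?(ltW c0) // ler_wpM2r // ltW.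
Qed.

End LambertParametrization.

(** * Expectations *)

Lemma near_cvg (R : realType) (f g : nat -> R) (l : R) :
  (\forall n \near eventually, f n = g n) ->
  (f n @[n --> eventually] --> l)%classic -> (g n @[n --> eventually] --> l)%classic.
Proof. by move=> fg L; apply: cvg_trans L; exact: near_eq_cvg. Qed.

Section SupersetSums.
Variables (R : realType) (T : finType) (K : {set T}).
Implicit Types (A S : {set T}).

Lemma sum_superset (F : {set T} -> R) S : S \subset K ->
  \sum_(A : {set T} | (A \subset K) && (S \subset A)) F A =
  \sum_(B : {set T} | B \subset K :\: S) F (S :|: B).
Proof.
move=> SK; rewrite (reindex_onto (fun B => S :|: B) (fun A => A :\: S)) /=; last first.
  by move=> A /andP[_ SA]; rewrite -[RHS](setID A S) (setIidPr SA).
apply: eq_bigl => B; rewrite subUset SK subsetUl andbT /= subsetD; congr (_ && _).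
rewrite setDUl setDv set0U; apply/eqP/idP => [<-|]; last by move/setDidPl.
by rewrite -setI_eq0 setIDAC setDIl setDv setI0.
Qed.

Lemma sum_subset_card (K' : {set T}) (f : nat -> R) :
  \sum_(A : {set T} | A \subset K') f #|A| = \sum_(m < #|K'|.+1) f m * 'C(#|K'|, m)%:R.
Proof.
rewrite (partition_big (fun A : {set T} => inord #|A| : 'I_(#|K'|.+1)) xpredT) //=.
apply: eq_bigr => m _; rewrite (eq_bigr (fun=> f m)); last first.
  by move=> A /andP[AK /eqP <-]; rewrite inordK // ltnS subset_leq_card.
rewrite sumr_const -[LHS]mulr_natr -cards_draws; congr (_ * _%:R).
apply: eq_card => A; rewrite [in RHS]inE; apply: andb_id2l => AK.
by rewrite -val_eqE /= inordK // ltnS subset_leq_card.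
Qed.

Lemma binomial_superset (p : R) S : S \subset K ->
  \sum_(A : {set T} | (A \subset K) && (S \subset A)) p ^+ #|A| * (1 - p) ^+ (#|K| - #|A|) =
  p ^+ #|S|.
Proof.
move=> SK; rewrite sum_superset //.
have cS (B : {set T}) : B \subset K :\: S -> #|S :|: B| = (#|S| + #|B|)%N.
  rewrite subsetD => /andP[_ d]; rewrite cardsU (_ : S :&: B = set0) ?cards0 ?subn0 //.
  by apply/eqP; rewrite setI_eq0 disjoint_sym.
pose f j := p ^+ #|S| * (p ^+ j * (1 - p) ^+ (#|K :\: S| - j)).
transitivity (\sum_(B : {set T} | B \subset K :\: S) f #|B|).
  by apply: eq_bigr => B BK; rewrite /f cS // exprD -mulrA cardsDS // subnDA.
rewrite sum_subset_card /f; under eq_bigr do rewrite -mulrA; rewrite -mulr_sumr.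
rewrite (_ : \sum_(_ < _) _ = 1) ?mulr1 //.
transitivity ((1 - p + p) ^+ #|K :\: S|); last by rewrite subrK expr1n.
by rewrite exprDn; apply: eq_bigr => i _; rewrite mulr_natr [in RHS]mulrC.
Qed.

Lemma ffactD n a b : (n ^_ (a + b) = n ^_ a * (n - a) ^_ b)%N.
Proof.
elim: b => [|b IH]; first by rewrite addn0 ffactn0 muln1.
by rewrite addnS !ffactnSr IH subnDA mulnA.
Qed.

Lemma uniform_superset m S : S \subset K -> (m <= #|K|)%N ->
  #|[set A : {set T} | [&& A \subset K, #|A| == m & S \subset A]]|%:R / ('C(#|K|, m))%:R =
  (m ^_ #|S|)%:R / (#|K| ^_ #|S|)%:R :> R.
Proof.
move=> SK mK; have SK' := subset_leq_card SK.
have K0 : (0 < #|K| ^_ #|S|)%N by rewrite ffact_gt0.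
have C0 : (0 < 'C(#|K|, m))%N by rewrite bin_gt0.
case: (leqP #|S| m) => [Sm|mS]; last first.
  rewrite (ffact_small mS) mul0r (_ : #|_| = 0)%N ?mul0r //.
  apply/eqP; rewrite cards_eq0 -subset0; apply/subsetP => A; rewrite inE => /and3P[_ /eqP cA SA].
  by move: mS; rewrite -cA ltnNge subset_leq_card.
have -> : #|[set A : {set T} | [&& A \subset K, #|A| == m & S \subset A]]| =
    'C(#|K| - #|S|, m - #|S|).
  rewrite -cardsDS // -cards_draws.
  have inj : {in [set A : {set T} | A \subset K :\: S & #|A| == (m - #|S|)%N] &,
      injective (fun B => S :|: B)}.
    move=> A B; rewrite !inE !subsetD => /andP[/andP[_ dA] _] /andP[/andP[_ dB] _] e.
    have := congr1 (fun X => X :\: S) e; rewrite /= !setDUl setDv !set0U.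
    by rewrite (setDidPl dA) (setDidPl dB).
  rewrite -(card_in_imset inj); apply: eq_card => A; rewrite inE.
  apply/and3P/imsetP => [[AK /eqP cA SA]|[B]].
    exists (A :\: S); last by rewrite -{1}(setIidPr SA) setID.
    by rewrite inE setSD // cardsDS // cA eqxx.
  rewrite inE subsetD => /andP[/andP[BK d] /eqP cB] ->; split.
  - by rewrite subUset SK.
  - rewrite cardsU (_ : S :&: B = set0) ?cards0 ?subn0 ?cB ?subnKC //.
    by apply/eqP; rewrite setI_eq0 disjoint_sym.
  - exact: subsetUl.
apply/eqP; rewrite eqr_div ?pnatr_eq0 -?lt0n // -!natrM; apply/eqP; congr (_%:R).
apply/eqP; rewrite -(eqn_pmul2r (fact_gt0 (m - #|S|))); apply/eqP.
rewrite mulnAC bin_ffact [RHS]mulnAC ffact_fact // [RHS]mulnC bin_ffact.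
by rewrite -[in RHS](subnKC Sm) ffactD mulnC.
Qed.

End SupersetSums.

(** * Limits of the mean number of copies *)

Section MeanLimits.
Variables (R : realType) (k : nat).
Variables (N D m : nat -> nat) (q : nat -> R).
Let M n : R := (N n)%:R * q n.
Hypothesis HM : forall A, \forall n \near eventually, A <= M n.
Hypothesis q_gt0 : \forall n \near eventually, 0 < q n.
Hypothesis q_le1 : \forall n \near eventually, q n <= 1.
Hypothesis regular : \forall n \near eventually, (D n)%:R * k.+1%:R = (N n)%:R / q n ^+ k.

Lemma binomial_mean_limit (eta c : R) (p : nat -> R) : (p n / q n @[n --> eventually] --> c)%classic ->
  (eta * ((D n)%:R * p n ^+ k.+1) / M n @[n --> eventually] --> eta * (c ^+ k.+1 / k.+1%:R))%classic.
Proof.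
move=> pc; have L : ((eta * ((p n / q n) ^+ k.+1 / k.+1%:R)) @[n --> eventually] --> eta * (c ^+ k.+1 / k.+1%:R))%classic.
  apply: cvgMl_tmp; apply: cvgMr_tmp; exact: (cvg_comp _ _ pc (@exprn_continuous R k.+1 c)).
apply: near_cvg L; apply: filterS3 regular q_gt0 (HM 1) => n r q0 M1.
have N0 : (N n)%:R != 0 :> R by apply: contraTneq M1 => N0; rewrite /M N0 mul0r -ltNge ltr01.
have -> : (D n)%:R = (N n)%:R / q n ^+ k / k.+1%:R by rewrite -r mulfK.
rewrite /M expr_div_n [q n ^+ k.+1]exprS; have : q n ^+ k != 0 by rewrite expf_neq0 // gt_eqF.
have : k.+1%:R != 0 :> R by [].
by move: (k.+1%:R) (q n ^+ k) (p n ^+ k.+1) => a b d a0 b0; field; rewrite a0 b0 N0 gt_eqF.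
Qed.

Lemma invM_cvg0 : ((M n)^-1 @[n --> eventually] --> (0 : R))%classic.
Proof.
apply/cvgrPdist_lt => e e0; apply: filterS (HM (e^-1 + 1)) => n h.
have M0 : 0 < M n by apply: lt_le_trans h; rewrite addr_gt0 ?invr_gt0.
rewrite sub0r normrN gtr0_norm ?invr_gt0 // invf_plt ?posrE //.
by apply: lt_le_trans h; rewrite ltrDl.
Qed.

Lemma N_unbounded (A : R) : \forall n \near eventually, A <= (N n)%:R.
Proof.
apply: filterS2 (HM A) q_le1 => n h q1; apply: le_trans h _.
by rewrite ler_piMr.
Qed.

Lemma invN_cvg0 : ((N n)%:R^-1 @[n --> eventually] --> (0 : R))%classic.
Proof.
apply/cvgrPdist_lt => e e0; apply: filterS (N_unbounded (e^-1 + 1)) => n h.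
have M0 : 0 < (N n)%:R :> R by apply: lt_le_trans h; rewrite addr_gt0 ?invr_gt0.
rewrite sub0r normrN gtr0_norm ?invr_gt0 // invf_plt ?posrE //.
by apply: lt_le_trans h; rewrite ltrDl.
Qed.

Variable b : R.
Hypothesis b0 : 0 < b.
Hypothesis mc : ((m n)%:R / M n @[n --> eventually] --> b)%classic.

Lemma m_unbounded (A : R) : \forall n \near eventually, A <= (m n)%:R.
Proof.
have b2 : 0 < b / 2 by rewrite divr_gt0.
move/cvgrPdist_lt: mc => /(_ _ b2) H.
apply: filterS3 H (HM 1) (HM (A / (b / 2))) => n h M1 MA.
have M0 : 0 < M n by apply: lt_le_trans M1.
apply: (@le_trans _ _ (b / 2 * M n)); first by rewrite mulrC -ler_pdivrMr.
rewrite -ler_pdivlMr //; move: h; rewrite ltr_norml => /andP[_]; lra.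
Qed.

Lemma ffact_ratio_limit j : ((m n ^_ j)%:R / (N n ^_ j)%:R / q n ^+ j @[n --> eventually] --> b ^+ j)%classic.
Proof.
elim: j => [|j IH].
  under eq_fun do rewrite !ffactn0 expr0 !divr1.
  by rewrite expr0; exact: cvg_cst.
(* The factor passing from [j] to [j.+1] is [(m - j) / (N - j) / q], rewritten with [M = N * q]. *)
have L : (((m n ^_ j)%:R / (N n ^_ j)%:R / q n ^+ j *
    (((m n)%:R / M n - j%:R * (M n)^-1) / (1 - j%:R * (N n)%:R^-1))) @[n --> eventually] -->
    b ^+ j * ((b - j%:R * 0) / (1 - j%:R * 0)))%classic.
  apply: cvgM IH _; apply: cvgM.
    by apply: cvgB mc _; apply: cvgMl_tmp; exact: invM_cvg0.
  apply: cvgV; first by rewrite mulr0 subr0 oner_eq0.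
  by apply: cvgB; [exact: cvg_cst|apply: cvgMl_tmp; exact: invN_cvg0].
rewrite !mulr0 !subr0 divr1 -exprSr in L.
apply: near_cvg L; apply: filterS3 q_gt0 (m_unbounded j%:R) (N_unbounded (j%:R + 1)) => n q0 mj Nj.
have jm : (j <= m n)%N by rewrite -(ler_nat R).
have jN : (j < N n)%N by rewrite -(ler_nat R) -natr1.
rewrite !ffactnSr !natrM !natrB ?(ltnW jN) // exprSr /M.
have f0 : (N n ^_ j)%:R != 0 :> R by rewrite pnatr_eq0 -lt0n ffact_gt0 ltnW.
have g0 : (N n)%:R - j%:R != 0 :> R by rewrite subr_eq0 eqr_nat gtn_eqF.
have h0 : (N n)%:R != 0 :> R by rewrite pnatr_eq0 -lt0n (leq_trans _ jN).
have := expf_neq0 j (lt0r_neq0 q0); have := lt0r_neq0 q0.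
move: (q n ^+ j) f0 g0 h0 => Q; move: (q n) (_ ^_ _)%:R (_ ^_ _)%:R (m n)%:R (N n)%:R j%:R.
by move=> a d e f g i e0 gi g0 a0 Q0; field; rewrite e0 gi g0 a0 Q0.
Qed.

Lemma uniform_mean_limit (eta : R) :
  (eta * ((D n)%:R * ((m n ^_ k.+1)%:R / (N n ^_ k.+1)%:R)) / M n @[n --> eventually] -->
   eta * (b ^+ k.+1 / k.+1%:R))%classic.
Proof.
have L : ((eta * ((m n ^_ k.+1)%:R / (N n ^_ k.+1)%:R / q n ^+ k.+1 / k.+1%:R)) @[n --> eventually] -->
    eta * (b ^+ k.+1 / k.+1%:R))%classic.
  by apply: cvgMl_tmp; apply: cvgMr_tmp; exact: ffact_ratio_limit.
apply: near_cvg L; apply: filterS3 regular q_gt0 (HM 1) => n r q0 M1.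
have N0 : (N n)%:R != 0 :> R by apply: contraTneq M1 => N0; rewrite /M N0 mul0r -ltNge ltr01.
have -> : (D n)%:R = (N n)%:R / q n ^+ k / k.+1%:R by rewrite -r mulfK.
rewrite /M exprS; have : q n ^+ k != 0 by rewrite expf_neq0 // gt_eqF.
have : k.+1%:R != 0 :> R by [].
move: (k.+1%:R) (q n ^+ k) ((m n ^_ _)%:R / _) => a B d a0 B0; field; rewrite a0 B0 N0 gt_eqF //.
Qed.

End MeanLimits.

(** Clears denominators in the density inequality. An empty [F] is treated apart: its numerator is
    -1 in [dens2] but 0 under truncated subtraction. *)
Lemma balanced_counts (R : realType) h k (EH : {set {set 'I_h}}) :
  strictly_2_balanced R h EH -> #|EH| = k.+1 ->
  forall (VF : {set 'I_h}) (F : {set {set 'I_h}}), is_subgraph h EH VF F ->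
  (2 < #|VF|)%N -> (VF, F) != ([set: 'I_h], EH) -> ((#|F| - 1) * (h - 2) < k * (#|VF| - 2))%N.
Proof.
move=> [E3 [h3 [m2E H]]] cE VF F sF V3 ne; have := H VF F sF V3 ne.
rewrite m2E /dens2 cE -[k.+1%:R]natr1 addrK.
have d0 a : (2 < a)%N -> 0 < (a - 2)%:R :> R by move=> a3; rewrite ltr0n subn_gt0.
have -> : #|VF|%:R - 2 = (#|VF| - 2)%:R :> R by rewrite natrB // ltnW.
have -> : h%:R - 2 = (h - 2)%:R :> R by rewrite natrB // ltnW.
have [F0 _|F0] := posnP #|F|.
  rewrite F0 mul0n muln_gt0 subn_gt0 V3 andbT.
  by move: E3; rewrite cE => /(leq_trans (ltn0Sn 1)).
have -> : #|F|%:R - 1 = (#|F| - 1)%:R :> R by rewrite natrB.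
rewrite ltr_pdivrMr ?d0 // mulrAC ltr_pdivlMr ?d0 //.
by rewrite -!natrM ltr_nat.
Qed.

Lemma uniform_rateE (R : realType) k (z b : R) :
  - lnw z (Xlim k z b) + (Phi k z b - (1 - z) * b ^+ k * b - b) =
  - (b ^+ k.+1 * (1 - z + (if z == 0 then 0 else z * ln z)) / k.+1%:R).
Proof.
have K0 : k.+1%:R != 0 :> R by rewrite pnatr_eq0.
have E : k%:R = k.+1%:R - 1 :> R by rewrite -[k.+1%:R]natr1 addrK.
rewrite /lnw /Phi /Xlim E exprSr; case: ifP => [/eqP ->|_].
  by move: (b ^+ _) (k.+1%:R) K0 => y K K0; field.
by move: (b ^+ _) (k.+1%:R) (ln z) K0 => y K l K0; field.
Qed.

(** * Lower tails of the number of copies *)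

Section Main.
Variables (R : realType) (h k : nat) (EH : {set {set 'I_h}}).
Hypotheses (gH : is_graph h EH) (cE : #|EH| = k.+1) (k_gt1 : (1 < k)%N) (h_gt2 : (2 < h)%N).
Hypothesis bal : forall (VF : {set 'I_h}) (F : {set {set 'I_h}}), is_subgraph h EH VF F ->
  (2 < #|VF|)%N -> (VF, F) != ([set: 'I_h], EH) -> ((#|F| - 1) * (h - 2) < k * (#|VF| - 2))%N.

Let cov := balanced_cover gH cE k_gt1 h_gt2 bal.
Let unif n : uniform (Kn n) (copies EH n) k := uniform_copies gH cE.
Let q n : R := qn R k EH n.
Let M n : R := #|Kn n|%:R * q n.

Lemma natr_ncov n (G : {set {set 'I_n}}) :
  (ncov (copies EH n) G)%:R = \sum_(c in copies EH n) (c \subset G)%:R :> R.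
Proof.
rewrite -natr_sum -big_mkcondr sum1_card; congr (_%:R); apply: eq_card => c.
by rewrite inE.
Qed.

Lemma Exp_p_XH n p : Exp_p R n p (fun G => XH R h n EH G) = #|copies EH n|%:R * p ^+ k.+1.
Proof.
rewrite /Exp_p; under eq_bigr do rewrite (XH_ncov cov) natr_ncov mulr_sumr.
rewrite exchange_big /= mulr_natl -sumr_const; apply: eq_bigr => c cc.
have [cK <-] := unif cc; rewrite -(binomial_superset p cK) [RHS]big_mkcondr /=.
by apply: eq_bigr => G _; rewrite /wp; case: (c \subset G); rewrite ?mulr1 ?mulr0.
Qed.

Lemma Exp_m_XH n m : (m <= #|Kn n|)%N -> Exp_m R n m (fun G => XH R h n EH G) =
  #|copies EH n|%:R * ((m ^_ k.+1)%:R / (#|Kn n| ^_ k.+1)%:R).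
Proof.
move=> mK; rewrite /Exp_m; under eq_bigr do rewrite (XH_ncov cov) natr_ncov.
rewrite exchange_big /= mulr_natl -sumr_const mulr_suml; apply: eq_bigr => c cc.
have [cK ck] := unif cc; rewrite -ck -(uniform_superset R cK mK); congr (_ / _).
rewrite -natr_sum -big_mkcondr sum1_card; congr (_%:R); apply: eq_card => G.
by rewrite [RHS]inE andbA.
Qed.

Lemma q_pos : \forall n \near eventually, 0 < q n.
Proof. by apply: filterS (nbhs_infty_ge (2 * h)) => n; exact: qn_gt0. Qed.

Lemma q_le1 : \forall n \near eventually, q n <= 1.
Proof.
by apply: filterS (@sparse_copies R _ _ _ gH cE k_gt1 h_gt2 bal _ ltr01) => n [].
Qed.

Lemma copies_regular : \forall n \near eventually,
  #|copies EH n|%:R * k.+1%:R = #|Kn n|%:R / q n ^+ k :> R.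
Proof.
apply: filterS (nbhs_infty_ge (2 * h)) => n hn; rewrite qn_exp // invrK.
have n2 : (1 < n)%N.
  by rewrite (leq_trans _ hn) // leq_pmulr // (ltn_trans _ h_gt2).
have /card_gt0P[v vK] : (0 < #|Kn n|)%N by rewrite card_Kn bin_gt0.
rewrite -(degree_DeltaH R gH cE k_gt1 h_gt2 bal vK) -!natrM.
by rewrite card_Kn (dg_eq gH cE vK) mulnC.
Qed.

Let HM := @scale_unbounded R _ _ _ gH cE k_gt1 h_gt2 bal.
Let Hs := @sparse_copies R _ _ _ gH cE k_gt1 h_gt2 bal.

Let scaleE n : powR (DeltaH R h EH n) (k.+1%:R - 1)^-1 / ('C(n, 2))%:R = (M n)^-1.
Proof. by rewrite /M invfM mulrC card_Kn invrK -natr1 addrK. Qed.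

(** The tilt is [z = 1 - zeta]. The equation for [zeta] says that the tilted mean
    [Xlim k (1 - zeta) x] equals the limit [eta * c ^ k.+1 / k.+1] of the scaled threshold, as the
    optimal tilt must. *)
Theorem binomial_lower_tail (eta c zeta : R) (p : nat -> R) :
  0 <= eta -> eta < 1 -> 0 < c -> 0 <= zeta <= 1 ->
  (1 - zeta) * xstar R k.+1 c zeta ^+ k.+1 = eta * c ^+ k.+1 ->
  subcritical k (1 - zeta) (xstar R k.+1 c zeta) -> (forall n, 0 <= p n <= 1) ->
  (p n * powR (DeltaH R h EH n) (k.+1%:R - 1)^-1 / c @[n --> eventually] --> (1 : R))%classic ->
  (powR (DeltaH R h EH n) (k.+1%:R - 1)^-1 / ('C(n, 2))%:R *
    ln (Prob_p R n (p n) (fun G => XH R h n EH G <= eta * Exp_p R n (p n) (fun G' => XH R h n EH G')))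
    @[n --> eventually] -->
    xstar R k.+1 c zeta + xstar R k.+1 c zeta ^+ k.+1 * (1 - k.+1%:R^-1) * zeta
    - (if eta == 0 then 0 else ln (1 - zeta) * eta * c ^+ k.+1 / k.+1%:R) - c)%classic.
Proof.
move=> e0 e1 c0 /andP[z0 z1] E sx p01 pc.
have [x0 fx] := xstarP k_gt1 c0 z0; set x := xstar _ _ _ _ in E sx x0 fx *.
(* With [zeta = 0] one has [xstar = c], and the equation would force [eta = 1]. *)
have zn1 : 1 - zeta < 1.
  rewrite gtrBl lt_neqAle z0 andbT; apply: contraTneq e1 => z00.
  rewrite -leNgt -(ler_pM2r (exprn_gt0 k.+1 c0)) -E -z00 subr0 mul1r /x -z00.
  by rewrite /xstar eqxx mul1r.
(* This matches the two conventions at zero: the one in [lnw], stated for [1 - zeta], and the one in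
   the limit, stated for [eta]. *)
have ze : (1 - zeta == 0) = (eta == 0).
  apply/idP/idP => /eqP H0; move/eqP: E; rewrite H0 mul0r.
    by rewrite eq_sym mulf_eq0 expf_eq0 /= (gt_eqF c0) orbF.
  by rewrite mulf_eq0 expf_eq0 /= (gt_eqF x0) orbF.
have pq : (p n / q n @[n --> eventually] --> fug k (1 - zeta) x)%classic.
  have L : (c * (p n * powR (DeltaH R h EH n) (k.+1%:R - 1)^-1 / c) @[n --> eventually] --> c * 1)%classic.
    exact: cvgMl_tmp.
  rewrite mulr1 in L.
  rewrite fx; apply: near_cvg L; apply: nearW => n.
  by rewrite /q /qn invrK -natr1 addrK mulrC divfK // gt_eqF.
pose t n := eta * (#|copies EH n|%:R * p n ^+ k.+1).
have t0 n : 0 <= t n by have /andP[p0 _] := p01 n; rewrite !mulr_ge0 ?exprn_ge0.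
have tz : 1 - zeta == 0 -> forall n, t n < 1.
  by rewrite ze => /eqP eta0 n; rewrite /t eta0 mul0r ltr01.
have XE : Xlim k (1 - zeta) x = eta * (c ^+ k.+1 / k.+1%:R).
  by rewrite /Xlim mulrA E mulrA.
have tc : (t n / M n @[n --> eventually] --> Xlim k (1 - zeta) x)%classic.
  by rewrite XE; apply: (binomial_mean_limit HM q_pos copies_regular); rewrite -fx.
have p0 n : 0 <= p n by have /andP[] := p01 n.
have p1 n : p n <= 1 by have /andP[] := p01 n.
have := @binomial_tail_rate R k k_gt1 (fun n => {set 'I_n}) (fun n => Kn n) (fun n => copies EH n)
  q unif Hs HM _ _ p t sx zn1 p0 p1 pq t0 tz tc.
rewrite (_ : Phi k (1 - zeta) x - _ - _ = x + x ^+ k.+1 * (1 - k.+1%:R^-1) * zeta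
    - (if eta == 0 then 0 else ln (1 - zeta) * eta * c ^+ k.+1 / k.+1%:R) - c); last first.
  rewrite fx /Phi /lnw ze subKr; congr (_ + _ - _ - _).
    rewrite -natr1; have : k%:R + 1 != 0 :> R by rewrite natr1.
    by move: (x ^+ _) (k%:R) => y K K0; field.
  by case: eqP => // _; rewrite XE !mulrA.
move=> L; apply: near_cvg L; apply: nearW => n /=.
rewrite -/(M n) scaleE; congr (_ * ln _); rewrite /binomial_tail /Prob_p Exp_p_XH.
by apply: eq_bigl => G; rewrite (XH_ncov cov).
Qed.

(** With the edge density fixed at [b], tilting by [z] just multiplies the limiting count by [z].
    The tilt is therefore [z = eta], and the hypothesis on [b] is subcriticality of [(eta, b)]. *)
Theorem uniform_lower_tail (eta b : R) (m : nat -> nat) :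
  0 <= eta -> eta < 1 -> 0 < b -> k%:R * b ^+ k * (1 - eta) < 1 ->
  ((m n)%:R * powR (DeltaH R h EH n) (k.+1%:R - 1)^-1 / (b * ('C(n, 2))%:R)
    @[n --> eventually] --> (1 : R))%classic ->
  (powR (DeltaH R h EH n) (k.+1%:R - 1)^-1 / ('C(n, 2))%:R *
    ln (Prob_m R n (m n) (fun G => XH R h n EH G <= eta * Exp_m R n (m n) (fun G' => XH R h n EH G')))
    @[n --> eventually] -->
    - (b ^+ k.+1 * (1 - eta + (if eta == 0 then 0 else eta * ln eta)) / k.+1%:R))%classic.
Proof.
move=> e0 e1 b0 Hb mc.
have sb : subcritical k eta b.
  by split=> //; [exact: ltW|rewrite mulrAC].
have mM : ((m n)%:R / M n @[n --> eventually] --> b)%classic.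
  have L : (b * ((m n)%:R * powR (DeltaH R h EH n) (k.+1%:R - 1)^-1 / (b * ('C(n, 2))%:R))
      @[n --> eventually] --> b * 1)%classic by exact: cvgMl_tmp.
  rewrite mulr1 in L.
  apply: near_cvg L; apply: nearW => n.
  rewrite -scaleE invfM; move: (powR _ _) (_%:R^-1) => P C.
  by field; exact: lt0r_neq0.
pose t n := eta * (#|copies EH n|%:R * ((m n ^_ k.+1)%:R / (#|Kn n| ^_ k.+1)%:R)).
have t0 n : 0 <= t n by rewrite !mulr_ge0.
have tz : eta == 0 -> forall n, t n < 1.
  by move=> /eqP eta0 n; rewrite /t eta0 mul0r ltr01.
have tc : (t n / M n @[n --> eventually] --> Xlim k eta b)%classic.
  exact: (uniform_mean_limit HM q_pos q_le1 copies_regular b0 mM).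
have := @uniform_tail_rate R k k_gt1 (fun n => {set 'I_n}) (fun n => Kn n) (fun n => copies EH n)
  q unif Hs HM _ _ m t sb e1 mM t0 tz tc.
rewrite uniform_rateE.
move=> L; apply: near_cvg L; apply: filterS (size_le_card (E := copies EH) Hs HM sb mM) => n mK /=.
rewrite -/(M n) scaleE; congr (_ * ln _); rewrite /uniform_tail /frac /level /Prob_m Exp_m_XH //.
congr (_%:R / _); apply: eq_card => G.
by rewrite [in LHS]inE [in RHS]inE (XH_ncov cov).
Qed.

End Main.

Unset Implicit Arguments.
Set Strict Implicit.
Local Open Scope classical_set_scope.
Local Open Scope ring_scope.

Theorem mainTheorem2 (R : realType) (h : nat) (EH : {set {set 'I_h}})
  (HH : is_graph h EH) (Hbal : strictly_2_balanced R h EH) :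
  let k := #|EH| in
  (* G(n,p) part *)
  (forall (eta c : R), 0 <= eta -> eta < 1 -> 0 < c -> (c%:E < cbar R k eta)%E ->
     (exists! zeta : R, 0 <= zeta <= 1 /\
        (1 - zeta) * (xstar R k c zeta) ^+ k = eta * c ^+ k) /\
     (forall zeta : R, 0 <= zeta <= 1 ->
        (1 - zeta) * (xstar R k c zeta) ^+ k = eta * c ^+ k ->
      forall p : nat -> R, (forall n, 0 <= p n <= 1) ->
        (fun n => p n * powR (DeltaH R h EH n) (k%:R - 1)^-1 / c) @ \oo --> (1 : R) ->
        (fun n => powR (DeltaH R h EH n) (k%:R - 1)^-1 / ('C(n, 2))%:R *
           ln (Prob_p R n (p n) (fun G => XH R h n EH G <=
                 eta * Exp_p R n (p n) (fun G' => XH R h n EH G'))))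
        @ \oo -->
          (xstar R k c zeta + (xstar R k c zeta) ^+ k * (1 - k%:R^-1) * zeta
           - (if eta == 0 then 0 else ln (1 - zeta) * eta * c ^+ k / k%:R)
           - c))) /\
  (* G(n,m) part *)
  (forall (eta b : R), 0 <= eta -> eta < 1 -> 0 < b ->
     (k%:R - 1) * b ^+ (k.-1) * (1 - eta) < 1 ->
     forall m : nat -> nat,
       (fun n => (m n)%:R * powR (DeltaH R h EH n) (k%:R - 1)^-1
                 / (b * ('C(n, 2))%:R)) @ \oo --> (1 : R) ->
       (fun n => powR (DeltaH R h EH n) (k%:R - 1)^-1 / ('C(n, 2))%:R *
          ln (Prob_m R n (m n) (fun G => XH R h n EH G <=
                eta * Exp_m R n (m n) (fun G' => XH R h n EH G'))))
       @ \oo -->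
         (- (b ^+ k * (1 - eta + (if eta == 0 then 0 else eta * ln eta)) / k%:R))).
Proof.
move=> k.
have [E3 [h3 _]] := Hbal.
have [k' [k_gt1 cE]] : exists k' : nat, (1 < k')%N /\ #|EH| = k'.+1.
  by move: E3; case: #|EH| => // k' k1; exists k'.
have bal := balanced_counts Hbal cE.
rewrite /k cE; split=> [eta c e0 e1 c0 cb|eta b e0 e1 b0 Hb m mc]; last first.
  apply: (uniform_lower_tail HH cE k_gt1 h3 bal e0 e1 b0 _ mc).
  by move: Hb; rewrite -[k'.+1%:R]natr1 addrK.
split.
  have [zeta z01 zE] := zeta_exists k_gt1 e0 e1 c0.
  exists zeta; split=> // zeta' [z01' zE'].
  exact: (zeta_unique k_gt1 e0 e1 c0 z01 z01' zE zE').
move=> zeta z01 zE p p01 pc.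
apply: (binomial_lower_tail HH cE k_gt1 h3 bal e0 e1 c0 z01 zE _ p01 pc).
exact: (subcritical_below_cbar k_gt1 e0 e1 c0 cb z01 zE).
Qed.
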